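(* Let $1\le p\le\infty$ and let $v$ be a weight function on $\mathbb{C}$ such that $$\lim_{r\to\infty}v(r)\,\frac{e^r}{r^{\frac1{2p}}}=0$$ (with $\frac1{2p}=0$ if $p=\infty$). If the differentiation operator $D:B_{p,0}\to B_{p,0}$, $Df=f'$, is (well defined and) continuous, where $B_{p,0}=B_{p,0}(\mathbb{C},v)$, then there is a dense vector subspace of $B_{p,0}$ all of whose nonzero elements are distributionally irregular for the operator $D:B_{p,0}\to B_{p,0}$.
   Context: A weight on $\mathbb{C}$ is a strictly positive continuous function $v$ on $\mathbb{C}$ that is radial, i.e. $v(z)=v(|z|)$ for all $z\in\mathbb{C}$, such that $v(r)$ is non-increasing on $[0,\infty)$ and $\lim_{r\to\infty}r^mv(r)=0$ for every $m\in\mathbb{N}$ (positive integers). For an entire function $f$ and $r>0$: $M_p(f,r)=\left(\frac1{2\pi}\int_0^{2\pi}|f(re^{it})|^p\,dt\right)^{1/p}$ if $1\le p<\infty$, and $M_\infty(f,r)=\sup_{|z|=r}|f(z)|$. $B_{p,0}(\mathbb{C},v)$ is the space of entire functions $f$ with $\lim_{r\to\infty}v(r)M_p(f,r)=0$; it is a Banach space with the norm $\|f\|_{p,v}=\sup_{r>0}v(r)M_p(f,r)$. For $A\subset\mathbb{N}$, the upper density is $\overline{\mathrm{dens}}(A)=\limsup_{n\to\infty}\frac{\mathrm{card}(A\cap\{1,\dots,n\})}{n}$. If $X$ is a Banach space and $T:X\to X$ is a bounded linear operator, a vector $x_0\in X$ is distributionally irregular for $T$ if there are increasing sequences of positive integers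 $A=(n_k)_k$ and $B=(m_k)_k$ with $\overline{\mathrm{dens}}(A)=1=\overline{\mathrm{dens}}(B)$ such that $\lim_{k\to\infty}\|T^{n_k}x_0\|=0$ and $\lim_{k\to\infty}\|T^{m_k}x_0\|=\infty$. *)

(* Defs.v *)
From Stdlib Require Import Reals List ClassicalEpsilon.
From Coquelicot Require Import Coquelicot.
Open Scope R_scope.

(* Stdlib's [Rpower 0 a] is 1; [rpow] is the real power x^a of a number
   x >= 0 with exponent a > 0, so that 0^a = 0. *)
Definition rpow (x a : R) : R :=
  if Rlt_dec 0 x then Rpower x a else 0.

(* [v (RtoC r)] is the value written v(r). *)
Record weight (v : C -> R) : Prop := {
  weight_pos : forall z : C, 0 < v z;
  weight_continuous : forall z : C, continuous v z;
  weight_radial : forall z : C, v z = v (RtoC (Cmod z));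
  weight_nonincreasing :
    forall r s : R, 0 <= r -> r <= s -> v (RtoC s) <= v (RtoC r);
  weight_decay :
    forall m : nat, (0 < m)%nat ->
      is_lim (fun r => r ^ m * v (RtoC r)) p_infty 0
}.

(* The exponent 1/(2p), equal to 0 for p = +oo. *)
Definition inv_2p (p : Rbar) : R :=
  match p with
  | Finite q => / (2 * q)
  | _ => 0
  end.

Definition entire (f : C -> C) : Prop :=
  forall z : C, ex_derive (K := C_AbsRing) (V := C_NormedModule) f z.

(* Only 1 <= p <= +oo is meaningful. For continuous f the integrand is
   continuous and the supremum is finite, so the totalized operators [RInt]
   and [real (Lub_Rbar _)] have their usual meaning. *)
Definition Mp (p : Rbar) (f : C -> C) (r : R) : R :=
  match p with
  | Finite q =>
      rpow (/ (2 * PI) *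
            RInt (fun t => rpow (Cmod (f (r * cos t, r * sin t))) q)
                 0 (2 * PI))
           (/ q)
  | _ => real (Lub_Rbar (fun x => exists z : C, Cmod z = r /\ x = Cmod (f z)))
  end.

Definition Bp0 (p : Rbar) (v : C -> R) (f : C -> C) : Prop :=
  entire f /\ is_lim (fun r => v (RtoC r) * Mp p f r) p_infty 0.

(* The supremum is finite for f in [Bp0 p v]. *)
Definition norm_pv (p : Rbar) (v : C -> R) (f : C -> C) : R :=
  real (Lub_Rbar
    (fun x => exists r : R, 0 < r /\ x = v (RtoC r) * Mp p f r)).

(* A normed space of functions C -> C is given by its membership predicate B
   and its norm [nrm], with the pointwise operations. *)

Definition well_defined (B : (C -> C) -> Prop) (T : (C -> C) -> C -> C) : Prop :=
  forall f, B f -> B (T f).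

Definition continuous_operator (B : (C -> C) -> Prop) (nrm : (C -> C) -> R)
    (T : (C -> C) -> C -> C) : Prop :=
  forall f, B f -> forall eps : R, 0 < eps ->
    exists delta : R, 0 < delta /\
      forall g, B g ->
        nrm (fun z => (g z - f z)%C) < delta ->
        nrm (fun z => (T g z - T f z)%C) < eps.

Record vector_subspace (B V : (C -> C) -> Prop) : Prop := {
  subspace_incl : forall f, V f -> B f;
  subspace_zero : V (fun _ => RtoC 0);
  subspace_plus : forall f g, V f -> V g -> V (fun z => (f z + g z)%C);
  subspace_scal : forall (c : C) f, V f -> V (fun z => (c * f z)%C)
}.

Definition dense_in (B : (C -> C) -> Prop) (nrm : (C -> C) -> R)
    (V : (C -> C) -> Prop) : Prop :=
  forall f, B f -> forall eps : R, 0 < eps ->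
    exists g, V g /\ nrm (fun z => (f z - g z)%C) < eps.

(* card (A ∩ {1, ..., n}) *)
Definition count_upto (A : nat -> Prop) (n : nat) : nat :=
  length (filter (fun k => if excluded_middle_informative (A k) then true else false)
                 (seq 1 n)).

Definition upper_density (A : nat -> Prop) : Rbar :=
  LimSup_seq (fun n => INR (count_upto A n) / INR n).

Definition increasing_positive (a : nat -> nat) : Prop :=
  (0 < a 0%nat)%nat /\ forall k, (a k < a (S k))%nat.

Definition seq_range (a : nat -> nat) (n : nat) : Prop := exists k, a k = n.

Definition distributionally_irregular (nrm : (C -> C) -> R)
    (T : (C -> C) -> C -> C) (x0 : C -> C) : Prop :=
  exists a b : nat -> nat,
    increasing_positive a /\ increasing_positive b /\
    upper_density (seq_range a) = Finite 1 /\
    upper_density (seq_range b) = Finite 1 /\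
    is_lim_seq (fun k => nrm (Nat.iter (a k) T x0)) 0 /\
    is_lim_seq (fun k => nrm (Nat.iter (b k) T x0)) p_infty.

(* Main.v *)
(** Let [u(z) = e^z], a fixed vector of [D]; the growth condition puts it in the
    space, since on the circle of radius [r] the [L^p] mean of [e^z] is of order
    [e^r / r^(1/(2p))].  Polynomials are dense and each is killed by a power of [D].
    So if [P] and [P'] are polynomials very close to [u], then [Q = P' - P] and its first
    derivatives are tiny, while [D^j Q] stays close to [u] over an arbitrarily long
    range of [j] beyond [deg P] and vanishes beyond [deg P'].  Placing multiples
    [(k+1) Q_k] of such blocks on rapidly growing, well separated ranges gives a vector whose
    orbit is huge on the long plateaus and tiny on the long gaps.  Splitting the
    blocks into infinitely many infinite classes gives vectors [f_i] no nonzero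
    combination of which loses this behaviour, and adding to each [f_i] a monomial
    (which [D] eventually kills) makes their span dense.

    Polynomials are dense because [f(rho z) -> f(z)] in norm as [rho -> 1]: the tails are
    controlled by [v(r) <= v(rho r)], with no need for monotonicity of the means in
    [r], and the Taylor series of [f(rho z)] converges geometrically in norm.
    Goursat's theorem is not needed: the derivative of an element of the space is
    again in the space, hence continuous. *)

Require Import Defs.
From Stdlib Require Import Reals List ClassicalEpsilon FunctionalExtensionality.
From Stdlib Require Import Lra Lia Arith Cantor Wf_nat.
From Coquelicot Require Import Coquelicot.
Open Scope R_scope.

(** * Windows and upper density *)

(** Irregularity is read off from windows [[s, (m + 1) * s]]: each fills a proportion of about
    [m / (m + 1)] of the integers up to its end, so windows of growing ratio already give upper
    density 1. Hence every gap and every plateau of index k has ratio [k + 1]. A block multiplied by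
    [k + 1] must stay small until it awakes, so its first iterates are kept below
    [(1/2)^k / (k + 1)], and sums of sleeping blocks are geometric tails. In a combination with a
    nonzero coefficient at [i0], the plateau of a block of class [i0] is a quiet time for every
    other [f_i], so nothing can cancel it. Each monomial is attached to infinitely many [f_i], some
    of them of arbitrarily small norm; this is what keeps the span dense. The construction is
    carried out in an abstract normed space of functions. Its completeness hypothesis requires
    limits of series to be holomorphic, which is why Cauchy's formula is developed with explicit
    error bounds. The estimate of [e^z] comes from comparing [exp (b cos t)] with a Poisson
    kernel. *)

Lemma functional_choice {A B : Type} (P : A -> B -> Prop) :
  (forall x, exists y, P x y) -> exists f : A -> B, forall x, P x (f x).
Proof.
  intros H.
  exists (fun x => proj1_sig (constructive_indefinite_description _ (H x))).
  intros x. apply proj2_sig.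
Qed.

(** Each value is the least element of [A] above the previous one, so none is skipped, and [k < a k]
    guarantees that every element is eventually reached. *)
Lemma infinite_subset_enumeration (A : nat -> Prop) :
  (forall n, A n -> (0 < n)%nat) -> (forall N, exists n, (N < n)%nat /\ A n) ->
  exists a, increasing_positive a /\ forall n, seq_range a n <-> A n.
Proof.
  intros Hpos Hinf.
  destruct (functional_choice
    (fun N n => ((N < n)%nat /\ A n) /\ forall m, (N < m)%nat /\ A m -> (n <= m)%nat)) as [nxt Hn].
  { intros N.
    destruct (dec_inh_nat_subset_has_unique_least_element
      (fun n => (N < n)%nat /\ A n)) as [n [[H1 H2] _]].
    - intros n. apply Classical_Prop.classic.
    - apply Hinf.
    - exists n. split; auto. }
  pose (a := fix a k := match k with O => nxt O | S k => nxt (a k) end).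
  assert (HA : forall k, A (a k)) by (destruct k; apply Hn).
  assert (Hs : forall k, (a k < a (S k))%nat) by (intros k; apply Hn).
  exists a. split; [split; [apply Hn | auto]|]. intros n. split.
  - intros [k <-]. apply HA.
  - intros Hx.
    assert (Hb : forall k, (k < a k)%nat).
    { induction k. apply Hn. specialize (Hs k). lia. }
    assert (H : forall k, (n < a k)%nat -> seq_range a n).
    { induction k; intros Hk.
      - exfalso. assert (a 0 <= n)%nat by (apply Hn; split; auto). lia.
      - destruct (lt_eq_lt_dec n (a k)) as [[Hl|He]|Hg].
        + auto.
        + exists k. auto.
        + exfalso. assert (a (S k) <= n)%nat by (apply Hn; auto). lia. }
    apply (H n). apply Hb.
Qed.

Lemma count_upto_le (A : nat -> Prop) (n : nat) : (count_upto A n <= n)%nat.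
Proof.
  unfold count_upto.
  etransitivity. apply filter_length_le. rewrite length_seq. lia.
Qed.

Lemma count_upto_window (A : nat -> Prop) (s N : nat) :
  (1 <= s)%nat -> (forall j, (s <= j <= N)%nat -> A j) -> (N + 1 - s <= count_upto A N)%nat.
Proof.
  intros Hs HA. unfold count_upto.
  destruct (le_lt_dec s N) as [HsN|]; [|lia].
  replace N with ((s - 1) + (N + 1 - s))%nat at 2 by lia.
  rewrite seq_app, filter_app, length_app.
  replace (1 + (s - 1))%nat with s by lia.
  rewrite (forallb_filter_id _ (seq s (N + 1 - s))).
  - rewrite length_seq. lia.
  - apply forallb_forall. intros j Hj. apply in_seq in Hj.
    destruct (excluded_middle_informative (A j)) as [|n]; auto.
    exfalso; apply n, HA; lia.
Qed.

(** The window of index k supplies at least [k * t k] of the first [(k + 1) * t k] integers, a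
    proportion of at least [1 - 1 / (k + 1)]. *)
Lemma upper_density_windows (A : nat -> Prop) (t : nat -> nat) :
  (forall k, (k < t k)%nat) ->
  (forall k j, (t k <= j <= (k + 1) * t k)%nat -> A j) ->
  upper_density A = Finite 1.
Proof.
  intros Ht HA. apply is_LimSup_seq_unique. intros eps. split.
  - intros N.
    destruct (nfloor_ex (/ eps)) as [m [_ Hm]].
    { left. apply Rinv_0_lt_compat, cond_pos. }
    (* The summand [N] puts the end of the window beyond [N]; the summand [m] makes
       [1 / (k + 1) < eps]. *)
    set (k := (N + m)%nat). exists ((k + 1) * t k)%nat.
    specialize (Ht k). split. { unfold k in *. nia. }
    pose proof (count_upto_window A (t k) ((k + 1) * t k) ltac:(lia) (HA k)) as Hc.
    apply Rlt_le_trans with (INR (k * t k) / INR ((k + 1) * t k)).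
    + rewrite !mult_INR, plus_INR. simpl (INR 1).
      assert (0 < INR (t k)) by (apply lt_0_INR; lia).
      assert (0 <= INR N) by apply pos_INR.
      assert (INR k = INR N + INR m) by (unfold k; apply plus_INR).
      assert (0 <= INR k) by apply pos_INR.
      replace (INR k * INR (t k) / ((INR k + 1) * INR (t k))) with (1 - / (INR k + 1))
        by (field; lra).
      assert (/ (INR k + 1) < eps); [|simpl; lra].
      rewrite <- (Rinv_inv eps). apply Rinv_lt_contravar; [|lra].
      apply Rmult_lt_0_compat; [|lra]. apply Rinv_0_lt_compat, cond_pos.
    + apply Rmult_le_compat_r.
      * left. apply Rinv_0_lt_compat, lt_0_INR. nia.
      * apply le_INR. nia.
  - exists 1%nat. intros n Hn.
    apply Rle_lt_trans with 1.
    + assert (0 < INR n) by (apply lt_0_INR; lia).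
      apply Rle_div_l; [assumption|]. rewrite Rmult_1_l. apply le_INR, count_upto_le.
    + destruct eps; simpl; lra.
Qed.

(** Turns windows of every ratio, on which stronger and stronger properties hold, into a single
    sequence of upper density 1 along which each [P m] holds eventually. It serves once for the gaps
    and once for the plateaus. *)
Lemma windows_enumeration (P : nat -> nat -> Prop) :
  (forall m j, P (S m) j -> P m j) ->
  (forall m, exists s, (m < s)%nat /\ forall j, (s <= j <= (m + 1) * s)%nat -> P m j) ->
  exists a, increasing_positive a /\ upper_density (seq_range a) = Finite 1 /\
    forall m, exists K, forall k, (K <= k)%nat -> P m (a k).
Proof.
  intros Hmono Hwin.
  assert (Hle : forall m n j, (m <= n)%nat -> P n j -> P m j).
  { intros m n j Hmn. induction Hmn; auto. }
  apply functional_choice in Hwin. destruct Hwin as [s Hs].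
  (* The level [S k + (k + 1) * t k] passed to [s] puts the new window after the end of the previous
     one and makes its ratio at least [k + 2]. *)
  pose (t := fix t k := match k with O => s O | S k => s (S k + (k + 1) * t k)%nat end).
  assert (HtS : forall k, t (S k) = s (S k + (k + 1) * t k)%nat) by reflexivity.
  assert (Ht : forall k, (k < t k)%nat).
  { destruct k. apply Hs. rewrite HtS. pose proof (proj1 (Hs (S k + (k + 1) * t k)%nat)). lia. }
  assert (Hst : forall k, ((k + 1) * t k < t (S k))%nat).
  { intros k. rewrite HtS. pose proof (proj1 (Hs (S k + (k + 1) * t k)%nat)). lia. }
  assert (HP : forall k j, (t k <= j <= (k + 1) * t k)%nat -> P k j).
  { intros k j Hj. destruct k.
    - apply Hs. exact Hj.
    - apply (Hle _ (S k + (k + 1) * t k)%nat); [lia|]. apply Hs. rewrite HtS in Hj.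
      split; [lia|]. etransitivity; [apply Hj|]. apply Nat.mul_le_mono_r. lia. }
  assert (Hinc : forall k m, (k <= m)%nat -> (t k <= t m)%nat).
  { intros k m H. induction H; auto. specialize (Hst m). nia. }
  set (A := fun j => exists k, (t k <= j <= (k + 1) * t k)%nat).
  destruct (infinite_subset_enumeration A) as [a [Ha HaA]].
  { intros n [k Hk]. specialize (Ht k). lia. }
  { intros N. exists (t N). split. apply Ht. exists N. nia. }
  exists a. split; [exact Ha|]. split.
  - apply (upper_density_windows _ t Ht). intros k j Hj. apply HaA. exists k. exact Hj.
  - intros m. exists (t m). intros k Hk.
    assert (Hak : (k <= a k)%nat).
    { clear Hk. induction k. lia. destruct Ha as [_ Ha]. specialize (Ha k). lia. }
    assert (H : A (a k)) by (apply HaA; exists k; auto).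
    destruct H as [i Hi].
    (* A point beyond [t m] cannot lie in a window of index [i < m], since that window ends before
       [t (S i) <= t m]. *)
    apply (Hle m i); [|apply HP; exact Hi].
    destruct (le_lt_dec m i) as [|Him]; auto.
    specialize (Hinc (S i) m Him). specialize (Hst i). lia.
Qed.

(** * A criterion for a dense irregular manifold *)

Definition fzero : C -> C := fun _ => RtoC 0.
Definition fadd (f g : C -> C) : C -> C := fun z => (f z + g z)%C.
Definition fsub (f g : C -> C) : C -> C := fun z => (f z - g z)%C.
Definition fscal (c : C) (f : C -> C) : C -> C := fun z => (c * f z)%C.

Fixpoint fsum (g : nat -> C -> C) (n : nat) : C -> C :=
  match n with
  | O => fzero
  | S m => fadd (fsum g m) (g m)
  end.

Ltac fun_ring :=
  apply functional_extensionality; intro; unfold fadd, fsub, fscal, fzero; ring.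

(** Homogeneity is stated as an inequality, the half that is immediate for a supremum;
    [ns_norm_scal_eq] recovers the equality by applying it to the inverse scalar. *)
Record normed_space (B : (C -> C) -> Prop) (nrm : (C -> C) -> R) : Prop := {
  ns_zero : B fzero;
  ns_add : forall f g, B f -> B g -> B (fadd f g);
  ns_scal : forall c f, B f -> B (fscal c f);
  ns_norm_ge_0 : forall f, B f -> 0 <= nrm f;
  ns_norm_add : forall f g, B f -> B g -> nrm (fadd f g) <= nrm f + nrm g;
  ns_norm_scal : forall c f, B f -> nrm (fscal c f) <= Cmod c * nrm f
}.

(** Completeness in the form used by the block construction: convergence of series dominated by the
    geometric series of ratio 1/2. *)
Definition series_complete (B : (C -> C) -> Prop) (nrm : (C -> C) -> R) : Prop :=
  forall g, (forall k, B (g k)) -> (forall k, nrm (g k) <= (1 / 2) ^ k) ->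
    exists f, B f /\ is_lim_seq (fun K => nrm (fsub f (fsum g K))) 0.

(** Linearity is asked on [B] alone: [C_derive] is a total operation and need not be additive where
    derivatives fail to exist. *)
Record linear_on (B : (C -> C) -> Prop) (T : (C -> C) -> C -> C) : Prop := {
  lin_wd : well_defined B T;
  lin_add : forall f g, B f -> B g -> T (fadd f g) = fadd (T f) (T g);
  lin_scal : forall c f, B f -> T (fscal c f) = fscal c (T f)
}.

Section NormedSpace.

Variables (B : (C -> C) -> Prop) (nrm : (C -> C) -> R).
Hypothesis HB : normed_space B nrm.

Lemma fsub_eq (f g : C -> C) : fsub f g = fadd f (fscal (RtoC (-1)) g).
Proof. fun_ring. Qed.

Lemma ns_sub (f g : C -> C) : B f -> B g -> B (fsub f g).
Proof. intros. rewrite fsub_eq. apply (ns_add _ _ HB); auto. apply (ns_scal _ _ HB); auto. Qed.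

Lemma ns_fsum (g : nat -> C -> C) (n : nat) : (forall k, (k < n)%nat -> B (g k)) -> B (fsum g n).
Proof.
  induction n; intros H; simpl. apply (ns_zero _ _ HB).
  apply (ns_add _ _ HB); auto.
Qed.

Lemma ns_norm_zero : nrm fzero = 0.
Proof.
  pose proof (ns_zero _ _ HB) as H0.
  pose proof (ns_norm_scal _ _ HB (RtoC 0) fzero H0) as H.
  replace (fscal 0 fzero) with fzero in H by fun_ring.
  rewrite Cmod_0 in H. pose proof (ns_norm_ge_0 _ _ HB _ H0). lra.
Qed.

Lemma ns_norm_opp (f : C -> C) : B f -> nrm (fscal (RtoC (-1)) f) <= nrm f.
Proof.
  intros H. pose proof (ns_norm_scal _ _ HB (RtoC (-1)) f H) as H1.
  rewrite Cmod_R, Rabs_left in H1 by lra. lra.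
Qed.

Lemma ns_norm_sub (f g : C -> C) : B f -> B g -> nrm (fsub f g) <= nrm f + nrm g.
Proof.
  intros Hf Hg. rewrite fsub_eq.
  eapply Rle_trans. apply (ns_norm_add _ _ HB); auto. apply (ns_scal _ _ HB); auto.
  pose proof (ns_norm_opp g Hg). lra.
Qed.

Lemma ns_norm_sub_rev (f g : C -> C) : B f -> B g -> nrm f - nrm g <= nrm (fsub f g).
Proof.
  intros Hf Hg.
  pose proof (ns_norm_add _ _ HB (fsub f g) g (ns_sub _ _ Hf Hg) Hg) as H.
  replace (fadd (fsub f g) g) with f in H by fun_ring. lra.
Qed.

Lemma ns_norm_scal_eq (c : C) (f : C -> C) : B f -> nrm (fscal c f) = Cmod c * nrm f.
Proof.
  intros Hf. apply Rle_antisym. apply (ns_norm_scal _ _ HB); auto.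
  destruct (Ceq_dec c 0) as [->|Hc].
  - rewrite Cmod_0, Rmult_0_l. apply (ns_norm_ge_0 _ _ HB), (ns_scal _ _ HB), Hf.
  - pose proof (ns_norm_scal _ _ HB (/ c)%C (fscal c f) (ns_scal _ _ HB _ _ Hf)) as H.
    replace (fscal (/ c) (fscal c f)) with f in H
      by (apply functional_extensionality; intro; unfold fscal; field; auto).
    rewrite Cmod_inv in H by auto.
    assert (Hp : 0 < Cmod c) by (apply Cmod_gt_0; auto).
    apply Rmult_le_compat_l with (r := Cmod c) in H; [|lra].
    rewrite <- Rmult_assoc, Rinv_r, Rmult_1_l in H by lra. exact H.
Qed.

Fixpoint rsum (u : nat -> R) (n : nat) : R :=
  match n with O => 0 | S m => rsum u m + u m end.

Lemma rsum_le (u w : nat -> R) (n : nat) :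
  (forall k, (k < n)%nat -> u k <= w k) -> rsum u n <= rsum w n.
Proof.
  induction n; intros H; simpl. lra.
  assert (u n <= w n) by auto. assert (rsum u n <= rsum w n) by auto. lra.
Qed.

Lemma rsum_ge_0 (u : nat -> R) (n : nat) : (forall k, 0 <= u k) -> 0 <= rsum u n.
Proof. intros H. induction n; simpl. lra. specialize (H n). lra. Qed.

Lemma rsum_scal_r (u : nat -> R) (c : R) (n : nat) :
  rsum (fun k => u k * c) n = rsum u n * c.
Proof. induction n; simpl. ring. rewrite IHn. ring. Qed.

Lemma ns_norm_fsum (g : nat -> C -> C) (n : nat) :
  (forall k, (k < n)%nat -> B (g k)) -> nrm (fsum g n) <= rsum (fun k => nrm (g k)) n.
Proof.
  induction n; intros H; simpl. rewrite ns_norm_zero. lra.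
  eapply Rle_trans. apply (ns_norm_add _ _ HB); auto. apply ns_fsum; auto.
  assert (nrm (fsum g n) <= rsum (fun k => nrm (g k)) n) by auto. lra.
Qed.

Lemma fsum_ext (g h : nat -> C -> C) (n : nat) :
  (forall k, (k < n)%nat -> g k = h k) -> fsum g n = fsum h n.
Proof.
  induction n; intros H; simpl; auto. rewrite H, IHn by auto. auto.
Qed.

Lemma fsum_zero (g : nat -> C -> C) (n : nat) :
  (forall k, (k < n)%nat -> g k = fzero) -> fsum g n = fzero.
Proof.
  induction n; intros H; simpl; auto. rewrite H, IHn by auto. fun_ring.
Qed.

Lemma fsum_remove (g : nat -> C -> C) (i n : nat) : (i < n)%nat ->
  fsum g n = fadd (g i) (fsum (fun l => if Nat.eq_dec l i then fzero else g l) n).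
Proof.
  intros H. induction H; simpl.
  - destruct Nat.eq_dec; [|easy].
    rewrite (fsum_ext (fun l => if Nat.eq_dec l i then fzero else g l) g).
    + fun_ring.
    + intros l Hl. destruct Nat.eq_dec; auto. lia.
  - rewrite IHle. destruct Nat.eq_dec; [lia|]. fun_ring.
Qed.

Lemma fsum_extend (g : nat -> C -> C) (n m : nat) : (n <= m)%nat ->
  (forall k, (n <= k)%nat -> g k = fzero) -> fsum g m = fsum g n.
Proof.
  intros H Hg. induction H; simpl; auto. rewrite IHle, Hg by auto. fun_ring.
Qed.

Lemma fsum_add (g h : nat -> C -> C) (n : nat) :
  fsum (fun k => fadd (g k) (h k)) n = fadd (fsum g n) (fsum h n).
Proof. induction n; simpl. fun_ring. rewrite IHn. fun_ring. Qed.

Lemma fsum_scal (c : C) (g : nat -> C -> C) (n : nat) :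
  fsum (fun k => fscal c (g k)) n = fscal c (fsum g n).
Proof. induction n; simpl. fun_ring. rewrite IHn. fun_ring. Qed.

Variable T : (C -> C) -> C -> C.
Hypothesis HT : linear_on B T.

Lemma iter_linear (j : nat) : linear_on B (Nat.iter j T).
Proof.
  induction j as [|j [IH1 IH2 IH3]]; simpl.
  - split; intros; simpl; auto. intros f Hf. exact Hf.
  - split.
    + intros f Hf. apply (lin_wd _ _ HT), IH1, Hf.
    + intros f g Hf Hg. simpl. rewrite IH2 by auto. apply (lin_add _ _ HT); apply IH1; auto.
    + intros c f Hf. simpl. rewrite IH3 by auto. apply (lin_scal _ _ HT); apply IH1; auto.
Qed.

Lemma lin_zero (S : (C -> C) -> C -> C) : linear_on B S -> S fzero = fzero.
Proof.
  intros HS. pose proof (lin_scal _ _ HS (RtoC 0) fzero (ns_zero _ _ HB)) as H.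
  replace (fscal 0 fzero) with fzero in H by fun_ring. rewrite H. fun_ring.
Qed.

Lemma lin_sub (S : (C -> C) -> C -> C) (f g : C -> C) : linear_on B S ->
  B f -> B g -> S (fsub f g) = fsub (S f) (S g).
Proof.
  intros HS Hf Hg. rewrite fsub_eq, (lin_add _ _ HS), (lin_scal _ _ HS) by
    (auto; apply (ns_scal _ _ HB); auto). fun_ring.
Qed.

Lemma lin_fsum (S : (C -> C) -> C -> C) (g : nat -> C -> C) (n : nat) : linear_on B S ->
  (forall k, (k < n)%nat -> B (g k)) -> S (fsum g n) = fsum (fun k => S (g k)) n.
Proof.
  intros HS. induction n; intros H; simpl. apply lin_zero; auto.
  rewrite (lin_add _ _ HS), IHn; auto. apply ns_fsum; auto.
Qed.

Hypothesis HTc : continuous_operator B nrm T.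

Lemma iter_continuous (J : nat) (eps : R) : 0 < eps ->
  exists delta, 0 < delta /\ forall g, B g -> nrm g < delta ->
    forall j, (j <= J)%nat -> nrm (Nat.iter j T g) < eps.
Proof.
  revert eps. induction J; intros eps He.
  - exists eps. split; auto. intros g _ Hg j Hj. replace j with O by lia. exact Hg.
  - destruct (HTc fzero (ns_zero _ _ HB) eps He) as [d [Hd H]].
    (* [d] serves the last application of [T], [eps] the earlier iterates. *)
    destruct (IHJ (Rmin d eps)) as [d' [Hd' H']]. { apply Rmin_glb_lt; auto. }
    exists d'. split; auto. intros g Bg Hg j Hj.
    destruct (Nat.eq_dec j (S J)) as [->|].
    + simpl.
      assert (Bj : B (Nat.iter J T g)) by (apply (lin_wd _ _ (iter_linear J)); auto).
      specialize (H (Nat.iter J T g) Bj).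
      specialize (H' g Bg Hg J (le_n _)).
      change (fun z => (Nat.iter J T g z - fzero z)%C) with (fsub (Nat.iter J T g) fzero) in H.
      change (fun z => (T (Nat.iter J T g) z - T fzero z)%C)
        with (fsub (T (Nat.iter J T g)) (T fzero)) in H.
      rewrite (lin_zero T HT) in H.
      replace (fsub (Nat.iter J T g) fzero) with (Nat.iter J T g) in H by fun_ring.
      replace (fsub (T (Nat.iter J T g)) fzero) with (T (Nat.iter J T g)) in H by fun_ring.
      apply H. eapply Rlt_le_trans. apply H'. apply Rmin_l.
    + eapply Rlt_le_trans. apply (H' g); auto. lia. apply Rmin_r.
Qed.

(** In the application these are the monomials. *)
Variable e : nat -> C -> C.
Hypothesis Be : forall n, B (e n).
Hypothesis He : forall n j, (n < j)%nat -> Nat.iter j T (e n) = fzero.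
Hypothesis Hdense : forall f eps, B f -> 0 < eps ->
  exists a N, nrm (fsub f (fsum (fun n => fscal (a n) (e n)) N)) < eps.

Lemma B_combination (a : nat -> C) (N : nat) : B (fsum (fun n => fscal (a n) (e n)) N).
Proof. apply ns_fsum. intros. apply (ns_scal _ _ HB); auto. Qed.

Lemma iter_combination (a : nat -> C) (N j : nat) : (N <= j)%nat ->
  Nat.iter j T (fsum (fun n => fscal (a n) (e n)) N) = fzero.
Proof.
  intros H. rewrite (lin_fsum _ _ _ (iter_linear j)).
  - apply fsum_zero. intros k Hk. rewrite (lin_scal _ _ (iter_linear j)), He by (auto; lia).
    fun_ring.
  - intros. apply (ns_scal _ _ HB); auto.
Qed.

(** * Blocks with long plateaus, and the irregular family built from them *)

Hypothesis Hcomplete : series_complete B nrm.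
Variable u : C -> C.
Hypothesis Bu : B u.
Hypothesis Tu : T u = u.
(** At most half the norm of [u], so that approximating [u] with an error below [eta] leaves a norm
    of at least [eta]. *)
Variable eta : R.
Hypothesis eta_pos : 0 < eta.
Hypothesis norm_u : 2 * eta <= nrm u.

Lemma iter_u (j : nat) : Nat.iter j T u = u.
Proof. induction j; simpl; auto. rewrite IHj. auto. Qed.

(* [Q] is the difference of two approximants of the fixed vector [u] by vectors
   that are killed by a power of [T]. *)
Lemma plateau (J k : nat) (delta : R) : 0 < delta ->
  exists Q mu E, B Q /\ (J < mu)%nat /\ ((k + 1) * mu <= E)%nat /\
    (forall j, (j <= J)%nat -> nrm (Nat.iter j T Q) <= delta) /\
    (forall j, (mu <= j <= (k + 1) * mu)%nat -> eta <= nrm (Nat.iter j T Q)) /\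
    (forall j, (E <= j)%nat -> Nat.iter j T Q = fzero).
Proof.
  intros Hd.
  (* Approximants [P] of [u] that are killed by a power of [T], close to [u] together with their
     iterates up to [L]. *)
  assert (Happ : forall L eps, 0 < eps -> exists P N, B P /\
    (forall j, (N <= j)%nat -> Nat.iter j T P = fzero) /\
    (forall j, (j <= L)%nat -> nrm (Nat.iter j T (fsub u P)) < eps)).
  { intros L eps Heps. destruct (iter_continuous L eps Heps) as [d [Hd' H]].
    destruct (Hdense u d Bu Hd') as [a [N Ha]].
    exists (fsum (fun n => fscal (a n) (e n)) N), N.
    split; [apply B_combination|]. split; [intros; apply iter_combination; auto|].
    intros. apply H; auto. apply ns_sub; auto. apply B_combination. }
  destruct (Happ J (delta / 2)) as [P [N [BP [HP1 HP2]]]]; [lra|].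
  (* From [mu] on, [P] is dead and the quiet range [j <= J] is over. *)
  set (mu := (S (N + J))%nat).
  (* The second approximation has to last until the end of the plateau. The bound [delta / 2] keeps
     [Q] small at the beginning, and [eta] keeps the iterates of [P'] away from zero on the
     plateau. *)
  destruct (Happ (((k + 1) * mu)%nat) (Rmin (delta / 2) eta)) as [P' [N' [BP' [HP1' HP2']]]].
  { apply Rmin_glb_lt; lra. }
  pose proof (fun j => iter_linear j) as L.
  assert (W : forall j f, B f -> B (Nat.iter j T f)) by (intros; apply (lin_wd _ _ (L _)); auto).
  exists (fsub P' P), mu, ((k + 1) * mu + N')%nat.
  split; [apply ns_sub; auto|]. split; [unfold mu; lia|]. split; [lia|]. repeat split.
  - intros j Hj.
    (* On the early range both approximants are close to [u], which cancels. *)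
    replace (fsub P' P) with (fsub (fsub u P) (fsub u P')) by fun_ring.
    rewrite (lin_sub _ _ _ (L j)) by (apply ns_sub; auto).
    eapply Rle_trans. apply ns_norm_sub; apply W; apply ns_sub; auto.
    specialize (HP2 j Hj).
    assert (Hj' : (j <= (k + 1) * mu)%nat) by (unfold mu; nia).
    specialize (HP2' j Hj'). pose proof (Rmin_l (delta / 2) eta). lra.
  - intros j [Hj1 Hj2].
    rewrite (lin_sub _ _ _ (L j)) by auto.
    rewrite (HP1 j) by (unfold mu in Hj1; lia).
    replace (fsub (Nat.iter j T P') fzero) with (Nat.iter j T P') by fun_ring.
    specialize (HP2' j Hj2). rewrite (lin_sub _ _ _ (L j)) in HP2' by auto.
    pose proof (ns_norm_sub_rev _ _ (W j u Bu) (W j P' BP')) as H. rewrite iter_u in *.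
    pose proof (Rmin_r (delta / 2) eta). lra.
  - intros j Hj.
    rewrite (lin_sub _ _ _ (L j)), HP1, HP1' by (auto; unfold mu in *; nia). fun_ring.
Qed.

(** Chains the blocks in time: at [E k] all blocks of index below [k] are dead; until
    [(k + 1) * E k] the others are still small; from [mu k] to [(k + 1) * mu k] block [k] is on its
    plateau; at [E (S k)] it is dead. The factor [/ INR (k + 1)] makes up for the later
    multiplication by [k + 1]. *)
Lemma plateaus : exists (Q : nat -> C -> C) (mu E : nat -> nat),
  (forall k, B (Q k)) /\ (forall k, (k < E k)%nat) /\
  (forall k, (E k <= mu k)%nat /\ ((k + 1) * mu k <= E (S k))%nat) /\
  (forall k j, (j <= (k + 1) * E k)%nat ->
     nrm (Nat.iter j T (Q k)) <= / INR (k + 1) * (1 / 2) ^ k) /\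
  (forall k j, (mu k <= j <= (k + 1) * mu k)%nat -> eta <= nrm (Nat.iter j T (Q k))) /\
  (forall k j, (E (S k) <= j)%nat -> Nat.iter j T (Q k) = fzero).
Proof.
  (* The choice is made for every pair of an index and a starting time, so that the recursion
     defining [E] can pass the end of one block to the next. *)
  destruct (functional_choice (fun (kE : nat * nat) (X : (C -> C) * (nat * nat)) =>
    let (k, E) := kE in let '(Q, (mu, E')) := X in
    B Q /\ (((k + 1) * E < mu)%nat) /\ ((k + 1) * mu <= E')%nat /\
    (forall j, (j <= (k + 1) * E)%nat ->
       nrm (Nat.iter j T Q) <= / INR (k + 1) * (1 / 2) ^ k) /\
    (forall j, (mu <= j <= (k + 1) * mu)%nat -> eta <= nrm (Nat.iter j T Q)) /\
    (forall j, (E' <= j)%nat -> Nat.iter j T Q = fzero))) as [F HF].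
  { intros [k E].
    destruct (plateau ((k + 1) * E) k (/ INR (k + 1) * (1 / 2) ^ k)) as [Q [mu [E' H]]].
    - apply Rmult_lt_0_compat. apply Rinv_0_lt_compat, lt_0_INR; lia. apply pow_lt; lra.
    - exists (Q, (mu, E')). exact H. }
  pose (E := fix E k := match k with O => 1%nat | S k => snd (snd (F (k, E k))) end).
  exists (fun k => fst (F (k, E k))), (fun k => fst (snd (F (k, E k)))), E.
  assert (HF' : forall k, let Q := fst (F (k, E k)) in let mu := fst (snd (F (k, E k))) in
    B Q /\ (((k + 1) * E k < mu)%nat) /\ ((k + 1) * mu <= E (S k))%nat /\
    (forall j, (j <= (k + 1) * E k)%nat ->
       nrm (Nat.iter j T Q) <= / INR (k + 1) * (1 / 2) ^ k) /\
    (forall j, (mu <= j <= (k + 1) * mu)%nat -> eta <= nrm (Nat.iter j T Q)) /\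
    (forall j, (E (S k) <= j)%nat -> Nat.iter j T Q = fzero)).
  { intros k. specialize (HF (k, E k)). simpl. destruct (F (k, E k)) as [Q [mu E']]. exact HF. }
  assert (HE0 : E O = 1%nat) by reflexivity.
  clearbody E. split; [intros k; apply HF'|]. split.
  { induction k. lia. destruct (HF' k) as [_ [H1 [H2 _]]]. nia. }
  split; [|repeat split; intros; apply HF'; auto].
  intros k. destruct (HF' k) as [_ [H1 [H2 _]]]. split; [nia|exact H2].
Qed.

Lemma rsum_geom_tail (k K : nat) :
  rsum (fun l => if le_lt_dec k l then (1 / 2) ^ l else 0) K <= 2 * (1 / 2) ^ k.
Proof.
  (* The subtracted term [2 * (1 / 2) ^ K] is what makes the induction close. *)
  assert (H : forall K, rsum (fun l => if le_lt_dec k l then (1 / 2) ^ l else 0) K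
    <= if le_lt_dec k K then 2 * (1 / 2) ^ k - 2 * (1 / 2) ^ K else 0).
  { clear K. induction K; simpl rsum.
    - destruct (le_lt_dec k 0); [|lra]. replace k with O by lia. lra.
    - destruct (le_lt_dec k K) as [h|h]; destruct (le_lt_dec k (S K)) as [h'|h']; try lia.
      + simpl. lra.
      + assert (k = S K) by lia. subst k. lra.
      + lra. }
  eapply Rle_trans. apply H.
  assert (0 < (1 / 2) ^ k) by (apply pow_lt; lra).
  assert (0 < (1 / 2) ^ K) by (apply pow_lt; lra).
  destruct (le_lt_dec k K); lra.
Qed.

(** Under the Cantor pairing every class [block_index k = i] is infinite, its members being the
    codes of the pairs [(i, m)]. The map distributes the blocks among the vectors [f i], and later
    also selects the monomial that is added to [f i]. *)
Definition block_index (k : nat) : nat := fst (Cantor.of_nat k).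

(** Class [i] therefore contains no block of index below [i], which makes [f i] small for large [i];
    the inequality also bounds the degree of the monomial attached to an index. *)
Lemma block_index_le (k : nat) : (block_index k <= k)%nat.
Proof.
  unfold block_index. pose proof (Cantor.cancel_to_of k) as H.
  destruct (Cantor.of_nat k) as [x y]. simpl.
  pose proof (Cantor.to_nat_non_decreasing x y). lia.
Qed.

Lemma block_index_to_nat (i m : nat) : block_index (Cantor.to_nat (i, m)) = i.
Proof. unfold block_index. rewrite Cantor.cancel_of_to. reflexivity. Qed.

(** By continuity of the [j]-th iterate, the iterate of the limit is within any [eps] of the iterate
    of some partial sum. *)
Lemma iter_limit_le (g : nat -> C -> C) (f : C -> C) (j : nat) (M : R) :
  B f -> (forall k, B (g k)) -> is_lim_seq (fun K => nrm (fsub f (fsum g K))) 0 ->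
  (forall K, nrm (Nat.iter j T (fsum g K)) <= M) -> nrm (Nat.iter j T f) <= M.
Proof.
  intros Bf Bg Hlim HM. apply le_epsilon. intros eps Heps.
  destruct (iter_continuous j eps Heps) as [d [Hd H]].
  apply is_lim_seq_spec in Hlim. destruct (Hlim (mkposreal d Hd)) as [N HN].
  specialize (HN N (le_n _)). simpl in HN. rewrite Rminus_0_r in HN.
  assert (BS : B (fsum g N)) by (apply ns_fsum; auto).
  pose proof (iter_linear j) as L.
  specialize (H _ (ns_sub _ _ Bf BS) (Rle_lt_trans _ _ _ (Rle_abs _) HN) j (le_n _)).
  rewrite (lin_sub _ _ _ L) in H by auto.
  pose proof (ns_norm_sub_rev (Nat.iter j T f) (Nat.iter j T (fsum g N))
    (lin_wd _ _ L _ Bf) (lin_wd _ _ L _ BS)). specialize (HM N). lra.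
Qed.

(** [f i] is the sum of [(k + 1) Q_k] over the class of [i]. At a time governed by [k], earlier
    blocks are dead and later ones contribute at most a geometric tail, so only block [k] can
    matter, and it occurs in exactly one of the sums. *)
Lemma irregular_family : exists (f : nat -> C -> C) (mu E : nat -> nat),
  (forall i, B (f i)) /\ (forall k, (k < E k)%nat /\ (E k <= mu k)%nat) /\
  (forall i, nrm (f i) <= 2 * (1 / 2) ^ i) /\
  (forall i k j, (E k <= j <= (k + 1) * E k)%nat ->
     nrm (Nat.iter j T (f i)) <= 2 * (1 / 2) ^ k) /\
  (forall i k j, (mu k <= j <= (k + 1) * mu k)%nat -> block_index k <> i ->
     nrm (Nat.iter j T (f i)) <= 2 * (1 / 2) ^ k) /\
  (forall i k j, (mu k <= j <= (k + 1) * mu k)%nat -> block_index k = i ->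
     INR (k + 1) * eta - 2 * (1 / 2) ^ k <= nrm (Nat.iter j T (f i))).
Proof.
  destruct plateaus as [Q [mu [E [BQ [HE [Hmu [HQ1 [HQ2 HQ3]]]]]]]].
  set (g := fun i k => if Nat.eq_dec (block_index k) i
    then fscal (RtoC (INR (k + 1))) (Q k) else fzero).
  assert (Bg : forall i k, B (g i k)).
  { intros i k. unfold g. destruct Nat.eq_dec.
    apply (ns_scal _ _ HB), BQ. apply (ns_zero _ _ HB). }
  pose proof (fun j => iter_linear j) as L.
  assert (W : forall j f, B f -> B (Nat.iter j T f)) by (intros; apply (lin_wd _ _ (L _)); auto).
  assert (Hg0 : forall i k j, (E (S k) <= j)%nat -> Nat.iter j T (g i k) = fzero).
  { intros i k j Hj. unfold g. destruct Nat.eq_dec.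
    rewrite (lin_scal _ _ (L j)), HQ3 by auto. fun_ring. apply lin_zero, L. }
  assert (Hg1 : forall i k j, (j <= (k + 1) * E k)%nat -> nrm (Nat.iter j T (g i k)) <= (1 / 2) ^ k).
  { intros i k j Hj. unfold g. destruct Nat.eq_dec.
    - rewrite (lin_scal _ _ (L j)), ns_norm_scal_eq by auto.
      assert (0 < INR (k + 1)) by (apply lt_0_INR; lia).
      rewrite Cmod_R, Rabs_pos_eq by lra.
      specialize (HQ1 k j Hj). apply Rmult_le_compat_l with (r := INR (k + 1)) in HQ1; [|lra].
      rewrite <- Rmult_assoc, Rinv_r, Rmult_1_l in HQ1 by lra. exact HQ1.
    - rewrite (lin_zero _ (L j)), ns_norm_zero. apply pow_le; lra. }
  assert (Hf : forall i, exists f, B f /\ is_lim_seq (fun K => nrm (fsub f (fsum (g i) K))) 0).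
  { intros i. apply Hcomplete; auto.
    intros k. apply (Hg1 i k O). lia. }
  apply functional_choice in Hf. destruct Hf as [f Hf].
  assert (HEmono : forall k l, (k <= l)%nat -> (E k <= E l)%nat).
  { intros k l Hkl. induction Hkl; auto. destruct (Hmu m). nia. }
  (* Common estimate, where [h] is [g i], possibly with block [k] deleted: terms below [k] are dead
     at time [j], the others are zero or still in their small range. *)
  assert (Hsum : forall i k j (h : nat -> C -> C), (forall l, B (h l)) ->
    (forall l, h l = g i l \/ h l = fzero) ->
    (forall l, (l < k)%nat -> Nat.iter j T (h l) = fzero) ->
    (forall l, (k <= l)%nat -> h l = fzero \/ (j <= (l + 1) * E l)%nat) ->
    forall K, nrm (Nat.iter j T (fsum h K)) <= 2 * (1 / 2) ^ k).
  { intros i k j h Bh Hhg Hlow Hhigh K.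
    rewrite (lin_fsum _ _ _ (L j)) by auto.
    eapply Rle_trans. apply ns_norm_fsum. auto.
    eapply Rle_trans; [|apply (rsum_geom_tail k K)].
    apply rsum_le. intros l _. destruct le_lt_dec as [Hl|Hl].
    - assert (Hz : nrm (Nat.iter j T fzero) <= (1 / 2) ^ l).
      { rewrite (lin_zero _ (L j)), ns_norm_zero. apply pow_le; lra. }
      destruct (Hhigh l Hl) as [->|Hj]; auto.
      destruct (Hhg l) as [->| ->]; auto.
    - rewrite Hlow, ns_norm_zero by auto. lra. }
  exists f, mu, E. split; [apply Hf|]. split; [intros k; split; [apply HE|apply Hmu]|].
  assert (Hwin : forall k l j, (k < l)%nat -> (j <= (k + 1) * mu k)%nat -> (j <= (l + 1) * E l)%nat).
  { intros k l j Hkl Hj. specialize (HEmono (S k) l Hkl). destruct (Hmu k). nia. }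
  split; [|split; [|split]].
  (* Time 0 with [k = i], since class [i] has no block of index below [i]. *)
  - intros i. apply (iter_limit_le (g i) (f i) O); auto. apply Hf. apply Hf.
    apply (Hsum i); auto.
    intros l Hl. unfold g. destruct Nat.eq_dec as [<-|].
    + pose proof (block_index_le l). lia.
    + apply lin_zero, (L O).
    + intros; right; lia.
  - intros i k j Hj. apply (iter_limit_le (g i)); auto. apply Hf. apply Hf.
    apply (Hsum i); auto.
    + intros l Hl. apply Hg0. specialize (HEmono (S l) k Hl). lia.
    + intros l Hl. right. specialize (HEmono k l Hl). nia.
  - intros i k j Hj Hki. apply (iter_limit_le (g i)); auto. apply Hf. apply Hf.
    apply (Hsum i); auto.
    + intros l Hl. apply Hg0. specialize (HEmono (S l) k Hl). destruct (Hmu k). lia.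
    + intros l Hl. destruct (Nat.eq_dec l k) as [->|].
      * left. unfold g. destruct Nat.eq_dec; auto. contradiction.
      * right. apply (Hwin k); lia.
  - intros i k j Hj Hki.
    set (h := fun l => if Nat.eq_dec l k then fzero else g i l).
    assert (Bh : forall l, B (h l)).
    { intros l. unfold h. destruct Nat.eq_dec; auto. apply (ns_zero _ _ HB). }
    (* [f i] without its block [k]; it is the limit of the partial sums of [h]. *)
    set (r := fsub (f i) (fscal (RtoC (INR (k + 1))) (Q k))).
    assert (BkQ : B (fscal (RtoC (INR (k + 1))) (Q k))) by (apply (ns_scal _ _ HB); auto).
    assert (Br : B r) by (apply ns_sub; auto; apply Hf).
    assert (Hgk : g i k = fscal (RtoC (INR (k + 1))) (Q k)).
    { unfold g. destruct Nat.eq_dec; auto. contradiction. }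
    assert (Hr : nrm (Nat.iter j T r) <= 2 * (1 / 2) ^ k).
    { apply (iter_limit_le h); auto.
      - apply is_lim_seq_ext_loc with (fun K => nrm (fsub (f i) (fsum (g i) K))); [|apply Hf].
        exists (S k). intros K HK. f_equal.
        rewrite (fsum_remove (g i) k K HK), Hgk. fold h. unfold r. fun_ring.
      - apply (Hsum i); auto.
        + intros l. unfold h. destruct Nat.eq_dec; auto.
        + intros l Hl. unfold h. destruct Nat.eq_dec; [lia|]. apply Hg0.
          specialize (HEmono (S l) k Hl). destruct (Hmu k). lia.
        + intros l Hl. unfold h. destruct Nat.eq_dec; auto. right. apply (Hwin k); lia. }
    (* [f i] is written as the block minus [- r], so that the reverse triangle inequality
       applies. *)
    pose proof (ns_norm_sub_rev (Nat.iter j T (fscal (RtoC (INR (k + 1))) (Q k)))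
      (Nat.iter j T (fscal (RtoC (-1)) r))) as H.
    assert (Hrn : B (fscal (RtoC (-1)) r)) by (apply (ns_scal _ _ HB); auto).
    specialize (H (W _ _ BkQ) (W _ _ Hrn)).
    rewrite <- (lin_sub _ _ _ (L j)) in H by auto.
    replace (fsub (fscal (RtoC (INR (k + 1))) (Q k)) (fscal (RtoC (-1)) r)) with (f i) in H
      by (unfold r; fun_ring).
    rewrite !(lin_scal _ _ (L j)), !ns_norm_scal_eq, !Cmod_R in H by auto.
    rewrite (Rabs_left (-1)), (Rabs_pos_eq (INR (k + 1)) (pos_INR _)) in H by lra.
    specialize (HQ2 k j Hj).
    apply Rmult_le_compat_l with (r := INR (k + 1)) in HQ2; [|apply pos_INR]. lra.
Qed.

(** * Spans, and the dense manifold of irregular vectors *)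

Lemma fsum_pad (b : nat -> C) (w : nat -> C -> C) (n m : nat) : (n <= m)%nat ->
  fsum (fun i => fscal (if lt_dec i n then b i else RtoC 0) (w i)) m =
  fsum (fun i => fscal (b i) (w i)) n.
Proof.
  intros H. rewrite (fsum_extend _ n m H).
  - apply fsum_ext. intros k Hk. destruct lt_dec; auto. contradiction.
  - intros k Hk. destruct lt_dec; [lia|]. fun_ring.
Qed.

Definition span (w : nat -> C -> C) (g : C -> C) : Prop :=
  exists b n, g = fsum (fun i => fscal (b i) (w i)) n.

Lemma span_subspace (w : nat -> C -> C) : (forall i, B (w i)) -> vector_subspace B (span w).
Proof.
  intros Hw. split.
  - intros g [b [n ->]]. apply ns_fsum. intros. apply (ns_scal _ _ HB); auto.
  - exists (fun _ => RtoC 0), O. reflexivity.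
  - intros g h [b [n ->]] [c [m ->]].
    exists (fun i => ((if lt_dec i n then b i else RtoC 0) + (if lt_dec i m then c i else RtoC 0))%C),
      (max n m).
    rewrite <- (fsum_pad b w n (max n m)), <- (fsum_pad c w m (max n m)) by lia.
    change (fadd (fsum (fun i => fscal (if lt_dec i n then b i else RtoC 0) (w i)) (max n m))
      (fsum (fun i => fscal (if lt_dec i m then c i else RtoC 0) (w i)) (max n m)) =
      fsum (fun i => fscal ((if lt_dec i n then b i else RtoC 0) +
        (if lt_dec i m then c i else RtoC 0)) (w i)) (max n m)).
    rewrite <- fsum_add. apply fsum_ext. intros. fun_ring.
  - intros c g [b [n ->]]. exists (fun i => (c * b i)%C), n.
    change (fscal c (fsum (fun i => fscal (b i) (w i)) n) =
      fsum (fun i => fscal (c * b i) (w i)) n).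
    rewrite <- fsum_scal. apply fsum_ext. intros. fun_ring.
Qed.

Lemma span_generator (w : nat -> C -> C) (i : nat) : span w (w i).
Proof.
  exists (fun l => if Nat.eq_dec l i then RtoC 1 else RtoC 0), (S i).
  rewrite (fsum_remove _ i) by lia. rewrite fsum_zero.
  - destruct Nat.eq_dec; [|easy]. fun_ring.
  - intros k _. destruct Nat.eq_dec; auto. fun_ring.
Qed.

Lemma span_fsum (w h : nat -> C -> C) (n : nat) : (forall i, B (w i)) ->
  (forall k, span w (h k)) -> span w (fsum h n).
Proof.
  intros Hw H. induction n; simpl.
  - apply (subspace_zero _ _ (span_subspace w Hw)).
  - apply (subspace_plus _ _ (span_subspace w Hw)); auto.
Qed.

Lemma pow_half_bounds (k : nat) : 0 < (1 / 2) ^ k <= 1.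
Proof. induction k; simpl; lra. Qed.

Lemma pow_half_small (eps : R) : 0 < eps ->
  exists N, forall k, (N <= k)%nat -> (1 / 2) ^ k < eps.
Proof.
  intros H. destruct (pow_lt_1_zero (1 / 2)) with (y := eps) as [N HN]; auto.
  - rewrite Rabs_pos_eq; lra.
  - exists N. intros k Hk. eapply Rle_lt_trans; [apply Rle_abs|]. apply HN. lia.
Qed.

Lemma nat_above (x : R) : exists n : nat, x <= INR n.
Proof.
  destruct (Rle_dec x 0) as [H|H]. exists O. exact H.
  destruct (nfloor_ex x) as [n Hn]. lra. exists (S n). rewrite S_INR. lra.
Qed.

(** The manifold is the span of [w i = e (block_index i) + f i]. Each [e n] occurs in the generators
    of index [Cantor.to_nat (n, m)] for all [m], whose second part is as small as desired; this
    gives density. Along the orbit of a combination the vectors [e n] die after finitely many steps,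
    and the combination of the [f i] remains. *)
Theorem dense_irregular_manifold : exists V : (C -> C) -> Prop,
  vector_subspace B V /\ dense_in B nrm V /\
  forall g, V g -> g <> fzero -> distributionally_irregular nrm T g.
Proof.
  destruct irregular_family as [f [mu [E [Bf [HE [Hf0 [Hf1 [Hf2 Hf3]]]]]]]].
  set (w := fun i => fadd (e (block_index i)) (f i)).
  assert (Bw : forall i, B (w i)) by (intros; apply (ns_add _ _ HB); auto).
  pose proof (fun j => iter_linear j) as L.
  assert (W : forall j f, B f -> B (Nat.iter j T f)) by (intros; apply (lin_wd _ _ (L _)); auto).
  exists (span w). split; [apply span_subspace, Bw|]. split.
  - intros h Bh eps Heps.
    destruct (Hdense h (eps / 2) Bh) as [a [N Ha]]; [lra|].
    set (A := rsum (fun n => Cmod (a n)) N).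
    assert (HA : 0 <= A) by (apply rsum_ge_0; intros; apply Cmod_ge_0).
    destruct (pow_half_small (eps / (4 * (A + 1)))) as [m Hm].
    { apply Rdiv_lt_0_compat; lra. }
    (* Generators that carry [e n] and have index at least [m]: replacing each [e n] by [w (t n)]
       costs at most [A * (2 * (1 / 2) ^ m)]. *)
    set (t := fun n => Cantor.to_nat (n, m)).
    exists (fsum (fun n => fscal (a n) (w (t n))) N). split.
    { apply span_fsum; auto. intros k. apply (subspace_scal _ _ (span_subspace w Bw)), span_generator. }
    replace (fsum (fun n => fscal (a n) (w (t n))) N) with
      (fadd (fsum (fun n => fscal (a n) (e n)) N) (fsum (fun n => fscal (a n) (f (t n))) N)).
    2:{ rewrite <- fsum_add. apply fsum_ext. intros k _. unfold w, t.
        rewrite block_index_to_nat. fun_ring. }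
    set (p := fsum (fun n => fscal (a n) (e n)) N) in *.
    set (r := fsum (fun n => fscal (a n) (f (t n))) N).
    assert (Bp : B p) by apply B_combination.
    assert (Br : B r) by (apply ns_fsum; intros; apply (ns_scal _ _ HB), Bf).
    change (nrm (fsub h (fadd p r)) < eps).
    replace (fsub h (fadd p r)) with (fsub (fsub h p) r) by fun_ring.
    eapply Rle_lt_trans. apply ns_norm_sub; auto. apply ns_sub; auto.
    assert (Hr : nrm r <= A * (2 * (1 / 2) ^ m)).
    { eapply Rle_trans. apply ns_norm_fsum. intros; apply (ns_scal _ _ HB), Bf.
      unfold A. rewrite <- rsum_scal_r. apply rsum_le. intros k _.
      rewrite ns_norm_scal_eq by auto. apply Rmult_le_compat_l; [apply Cmod_ge_0|].
      eapply Rle_trans; [apply Hf0|]. apply Rmult_le_compat_l; [lra|].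
      pose proof (Cantor.to_nat_non_decreasing k m) as Hkm. fold (t k) in Hkm.
      replace (t k) with (m + (t k - m))%nat by lia. rewrite pow_add.
      rewrite <- (Rmult_1_r ((1 / 2) ^ m)) at 2. apply Rmult_le_compat_l; [apply pow_le; lra|].
      apply pow_half_bounds. }
    assert (nrm r <= eps / 2); [|lra].
    eapply Rle_trans; [apply Hr|]. specialize (Hm m (le_n _)).
    apply Rle_trans with ((A + 1) * (2 * (eps / (4 * (A + 1))))).
    + apply Rmult_le_compat; try lra. assert (0 < (1 / 2) ^ m) by (apply pow_lt; lra). lra.
    + right. field. lra.
  - intros g [b [I Hg]] Hnz.
    assert (Hi0 : exists i0, (i0 < I)%nat /\ b i0 <> 0).
    { apply Classical_Prop.NNPP. intros Hn. apply Hnz. rewrite Hg. apply fsum_zero.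
      intros k Hk. destruct (Ceq_dec (b k) 0) as [->|Hb]. fun_ring.
      exfalso. apply Hn. exists k. auto. }
    destruct Hi0 as [i0 [Hi0 Hb0]].
    set (A := rsum (fun n => Cmod (b n)) I).
    assert (HA : 0 <= A) by (apply rsum_ge_0; intros; apply Cmod_ge_0).
    (* From time [I] on every [e (block_index i)] in the combination is dead, because
       [block_index i <= i < I]. *)
    assert (Hiter : forall j, (I <= j)%nat ->
      Nat.iter j T g = fsum (fun i => fscal (b i) (Nat.iter j T (f i))) I).
    { intros j Hj. rewrite Hg, (lin_fsum _ _ _ (L j)) by (intros; apply (ns_scal _ _ HB), Bw).
      apply fsum_ext. intros k Hk. rewrite (lin_scal _ _ (L j)) by auto. unfold w.
      rewrite (lin_add _ _ (L j)), He by (auto; pose proof (block_index_le k); lia). fun_ring. }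
    assert (Hup : forall (h : nat -> C -> C) delta, (forall i, B (h i)) -> 0 <= delta ->
      (forall i, nrm (h i) <= delta) ->
      nrm (fsum (fun i => fscal (b i) (h i)) I) <= A * delta).
    { intros h d Bh Hd Hh. eapply Rle_trans. apply ns_norm_fsum.
      intros; apply (ns_scal _ _ HB), Bh. unfold A. rewrite <- rsum_scal_r.
      apply rsum_le. intros k _. rewrite ns_norm_scal_eq by auto.
      apply Rmult_le_compat_l; [apply Cmod_ge_0|auto]. }
    pose proof pow_half_bounds as Hpk.
    destruct (windows_enumeration (fun m j => nrm (Nat.iter j T g) <= / INR (m + 1)))
      as [a1 [Ha1 [Hd1 Hl1]]].
    { intros m j H. eapply Rle_trans. apply H. apply Rinv_le_contravar.
      apply lt_0_INR; lia. apply le_INR; lia. }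
    { intros m. destruct (pow_half_small (/ INR (m + 1) / (2 * (A + 1)))) as [N HN].
      { apply Rdiv_lt_0_compat; [|lra]. apply Rinv_0_lt_compat, lt_0_INR; lia. }
      (* [m] provides the ratio and the position of the window, [I] the death of the monomials, [N]
         the smallness of the geometric bound. *)
      set (k := (m + I + N)%nat). destruct (HE k) as [HEk _].
      exists (E k). split; [unfold k in *; lia|]. intros j Hj.
      rewrite Hiter by (unfold k in *; lia).
      specialize (HN k ltac:(unfold k; lia)). specialize (Hpk k).
      eapply Rle_trans. apply Hup with (delta := 2 * (1 / 2) ^ k); auto. lra.
      - intros i. apply (Hf1 i k j). split; [lia|]. etransitivity. apply Hj.
        apply Nat.mul_le_mono_r. unfold k; lia.
      - apply Rle_trans with ((A + 1) * (2 * (/ INR (m + 1) / (2 * (A + 1))))).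
        + apply Rmult_le_compat; lra.
        + right. field. split. apply not_0_INR; lia. lra. }
    destruct (windows_enumeration (fun m j => INR m <= nrm (Nat.iter j T g)))
      as [a2 [Ha2 [Hd2 Hl2]]].
    { intros m j H. rewrite S_INR in H. lra. }
    { intros m. assert (Hbp : 0 < Cmod (b i0)) by (apply Cmod_gt_0; auto).
      assert (Hbe : 0 < Cmod (b i0) * eta) by (apply Rmult_lt_0_compat; auto).
      (* Chosen so that [N * |b i0| * eta] covers [m] and the losses: [2 |b i0|] from the other
         blocks of [f i0], and [2 A] from the other vectors [f i]. *)
      destruct (nat_above ((INR m + 2 * Cmod (b i0) + 2 * A) / (Cmod (b i0) * eta))) as [N HN].
      (* A block of class [i0], on whose plateau every [f i] with [i <> i0] is quiet. *)
      set (k := Cantor.to_nat (i0, (m + I + N)%nat)).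
      pose proof (Cantor.to_nat_non_decreasing i0 (m + I + N)) as Hk. fold k in Hk.
      assert (Hki : block_index k = i0) by apply block_index_to_nat. clearbody k.
      destruct (HE k) as [HEk1 HEk2].
      exists (mu k). split; [lia|]. intros j Hj.
      assert (Hj' : (mu k <= j <= (k + 1) * mu k)%nat).
      { split; [apply Hj|]. etransitivity. apply Hj. apply Nat.mul_le_mono_r. lia. }
      rewrite Hiter, (fsum_remove _ i0 I Hi0) by lia.
      set (h := fun l => if Nat.eq_dec l i0 then fzero else Nat.iter j T (f l)).
      assert (Bh : forall l, B (h l)).
      { intros l. unfold h. destruct Nat.eq_dec; auto. apply (ns_zero _ _ HB). }
      specialize (Hpk k).
      assert (Hh : nrm (fsum (fun i => fscal (b i) (h i)) I) <= A * (2 * (1 / 2) ^ k)).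
      { apply Hup; auto. lra. intros i. unfold h. destruct Nat.eq_dec.
        - rewrite ns_norm_zero. lra.
        - apply (Hf2 i k j Hj'). congruence. }
      rewrite (fsum_ext _ (fun i => fscal (b i) (h i))).
      2:{ intros l _. unfold h. destruct Nat.eq_dec; auto. fun_ring. }
      set (r := fsum (fun i => fscal (b i) (h i)) I) in *.
      assert (Br : B r) by (apply ns_fsum; intros; apply (ns_scal _ _ HB), Bh).
      assert (B0 : B (fscal (b i0) (Nat.iter j T (f i0)))) by (apply (ns_scal _ _ HB); auto).
      pose proof (ns_norm_sub (fadd (fscal (b i0) (Nat.iter j T (f i0))) r) r
        (ns_add _ _ HB _ _ B0 Br) Br) as H.
      replace (fsub (fadd (fscal (b i0) (Nat.iter j T (f i0))) r) r)
        with (fscal (b i0) (Nat.iter j T (f i0))) in H by fun_ring.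
      rewrite ns_norm_scal_eq in H by auto.
      specialize (Hf3 i0 k j Hj' Hki).
      apply Rmult_le_compat_l with (r := Cmod (b i0)) in Hf3; [|lra].
      assert (HkN : INR N <= INR (k + 1)) by (apply le_INR; lia).
      apply Rle_div_l in HN; [|auto].
      assert (INR N * (Cmod (b i0) * eta) <= INR (k + 1) * (Cmod (b i0) * eta))
        by (apply Rmult_le_compat_r; lra).
      assert (A * (2 * (1 / 2) ^ k) <= 2 * A) by nra.
      assert (Cmod (b i0) * (2 * (1 / 2) ^ k) <= 2 * Cmod (b i0)) by nra.
      nra. }
    exists a1, a2. split; auto. split; auto. split; auto. split; auto. split.
    + apply is_lim_seq_spec. intros eps.
      destruct (nat_above (/ eps)) as [m Hm].
      destruct (Hl1 m) as [K HK]. exists K. intros k Hk. rewrite Rminus_0_r, Rabs_pos_eq.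
      * eapply Rle_lt_trans. apply HK; auto.
        rewrite <- (Rinv_inv eps).
        assert (0 < / eps) by apply Rinv_0_lt_compat, cond_pos.
        assert (INR m < INR (m + 1)) by (apply lt_INR; lia).
        apply Rinv_lt_contravar; [|lra]. apply Rmult_lt_0_compat; lra.
      * apply (ns_norm_ge_0 _ _ HB), W. rewrite Hg. apply ns_fsum.
        intros; apply (ns_scal _ _ HB), Bw.
    + apply is_lim_seq_spec. intros M.
      destruct (nat_above (M + 1)) as [m Hm].
      destruct (Hl2 m) as [K HK]. exists K. intros k Hk. specialize (HK k Hk). simpl in HK. lra.
Qed.

End NormedSpace.

(** * Complex differentiability and continuity *)

Lemma Cmod_le_Rabs (z : C) : Cmod z <= Rabs (Re z) + Rabs (Im z).
Proof.
  replace z with (RtoC (Re z) + Ci * RtoC (Im z))%C at 1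
    by (destruct z; unfold Re, Im, RtoC, Ci, Cplus, Cmult; simpl; f_equal; ring).
  eapply Rle_trans. apply Cmod_triangle.
  rewrite Cmod_mult, Cmod_Ci, !Cmod_R. lra.
Qed.

Lemma im_le_Cmod (z : C) : Rabs (Im z) <= Cmod z.
Proof.
  eapply Rle_trans; [|apply Rmax_Cmod]. apply Rmax_r.
Qed.

Lemma Cmod_triangle_rev (w z : C) : Cmod w - Cmod z <= Cmod (w - z).
Proof.
  pose proof (Cmod_triangle (w - z) z) as H.
  replace (w - z + z)%C with w in H by ring. lra.
Qed.

Definition has_cderiv (f : C -> C) (z d : C) : Prop :=
  is_derive (K := C_AbsRing) (V := C_NormedModule) f z d.

Lemma has_cderiv_eps (f : C -> C) (z d : C) : has_cderiv f z d <->
  forall eps, 0 < eps -> exists delta, 0 < delta /\ forall w, Cmod (w - z) < delta ->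
    Cmod (f w - f z - d * (w - z)) <= eps * Cmod (w - z).
Proof.
  assert (E : forall w, minus (minus (f w) (f z)) (scal (minus w z) d)
    = (f w - f z - d * (w - z))%C).
  { intros w. change (f w - f z - (w - z) * d = f w - f z - d * (w - z))%C. ring. }
  split.
  - intros [_ H] eps He. specialize (H z (fun P HP => HP) (mkposreal _ He)).
    destruct H as [dl Hd]. exists dl. split. apply cond_pos.
    intros w Hw. rewrite <- E. apply (Hd w Hw).
  - intros H. split. apply (is_linear_scal_l (K := C_AbsRing) (V := C_NormedModule)).
    intros x Hx eps.
    replace x with z in *
      by (apply (is_filter_lim_locally_unique (V := AbsRing_NormedModule C_AbsRing)); exact Hx).
    destruct (H eps (cond_pos eps)) as [dl [Hdl Hd]].
    exists (mkposreal dl Hdl). intros w Hw. specialize (Hd w Hw). rewrite <- E in Hd. exact Hd.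
Qed.

Lemma entire_cderiv (f : C -> C) : entire f -> forall z, has_cderiv f z (C_derive f z).
Proof. intros H z. apply C_derive_correct. exact z. apply H. Qed.

Lemma cderiv_entire (f g : C -> C) : (forall z, has_cderiv f z (g z)) -> entire f.
Proof. intros H z. exists (g z). apply H. Qed.

Lemma cderiv_unique (f g : C -> C) : (forall z, has_cderiv f z (g z)) -> C_derive f = g.
Proof.
  intros H. apply functional_extensionality. intros z. apply is_C_derive_unique, H.
Qed.

Lemma has_cderiv_const (c z : C) : has_cderiv (fun _ => c) z (RtoC 0).
Proof.
  apply has_cderiv_eps. intros eps He. exists 1. split; [lra|]. intros w _.
  replace (c - c - 0 * (w - z))%C with (RtoC 0) by ring. rewrite Cmod_0.
  apply Rmult_le_pos; [lra|apply Cmod_ge_0].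
Qed.

Lemma has_cderiv_add (f g : C -> C) (z a b : C) :
  has_cderiv f z a -> has_cderiv g z b -> has_cderiv (fadd f g) z (a + b)%C.
Proof. intros Hf Hg. exact (is_derive_plus _ _ _ _ _ Hf Hg). Qed.

Lemma has_cderiv_bounded (f : C -> C) (z a : C) : has_cderiv f z a ->
  exists delta, 0 < delta /\ forall w, Cmod (w - z) < delta ->
    Cmod (f w - f z) <= (Cmod a + 1) * Cmod (w - z).
Proof.
  intros H. destruct (proj1 (has_cderiv_eps _ _ _) H 1 Rlt_0_1) as [d [Hd Hw]].
  exists d. split; auto. intros w Hwz. specialize (Hw w Hwz).
  pose proof (Cmod_triangle (f w - f z - a * (w - z)) (a * (w - z))) as Ht.
  rewrite Cmod_mult in Ht.
  replace (f w - f z - a * (w - z) + a * (w - z))%C with (f w - f z)%C in Ht by ring. lra.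
Qed.

Lemma has_cderiv_mult (f g : C -> C) (z a b : C) :
  has_cderiv f z a -> has_cderiv g z b ->
  has_cderiv (fun w => f w * g w)%C z (a * g z + f z * b)%C.
Proof.
  intros Hf Hg. apply has_cderiv_eps. intros eps He.
  destruct (has_cderiv_bounded _ _ _ Hg) as [d1 [Hd1 H1]].
  assert (Pf : 0 <= Cmod (f z)) by apply Cmod_ge_0.
  assert (Pg : 0 <= Cmod (g z)) by apply Cmod_ge_0.
  assert (Pa : 0 <= Cmod a) by apply Cmod_ge_0.
  assert (Pb : 0 <= Cmod b) by apply Cmod_ge_0.
  (* [M] collects the coefficients of the error in the product rule; an increment below
     [eps / (2 * M)] makes the quadratic term linear. *)
  set (M := Cmod (f z) + Cmod (g z) + (Cmod a + 1) * (Cmod b + 1) + 1).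
  assert (HM : 0 < M) by (unfold M; nra).
  destruct (proj1 (has_cderiv_eps _ _ _) Hf (eps / (2 * M))) as [d2 [Hd2 H2]].
  { apply Rdiv_lt_0_compat; lra. }
  destruct (proj1 (has_cderiv_eps _ _ _) Hg (eps / (2 * M))) as [d3 [Hd3 H3]].
  { apply Rdiv_lt_0_compat; lra. }
  destruct (has_cderiv_bounded _ _ _ Hf) as [d4 [Hd4 H4]].
  exists (Rmin (Rmin d1 d2) (Rmin (Rmin d3 d4) (eps / (2 * M)))).
  assert (Hq : 0 < eps / (2 * M)) by (apply Rdiv_lt_0_compat; lra).
  split. { repeat apply Rmin_glb_lt; auto. }
  intros w Hw.
  pose proof (Rmin_l (Rmin d1 d2) (Rmin (Rmin d3 d4) (eps / (2 * M)))).
  pose proof (Rmin_r (Rmin d1 d2) (Rmin (Rmin d3 d4) (eps / (2 * M)))).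
  pose proof (Rmin_l (Rmin d3 d4) (eps / (2 * M))). pose proof (Rmin_r (Rmin d3 d4) (eps / (2 * M))).
  pose proof (Rmin_l d1 d2). pose proof (Rmin_r d1 d2).
  pose proof (Rmin_l d3 d4). pose proof (Rmin_r d3 d4).
  assert (Hw1 : Cmod (w - z) < d1) by lra. assert (Hw2 : Cmod (w - z) < d2) by lra.
  assert (Hw3 : Cmod (w - z) < d3) by lra. assert (Hw4 : Cmod (w - z) < d4) by lra.
  assert (Hw5 : Cmod (w - z) < eps / (2 * M)) by lra.
  specialize (H1 w Hw1). specialize (H2 w Hw2). specialize (H3 w Hw3). specialize (H4 w Hw4).
  replace (f w * g w - f z * g z - (a * g z + f z * b) * (w - z))%C with
    ((f w - f z - a * (w - z)) * g z + f z * (g w - g z - b * (w - z))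
      + (f w - f z) * (g w - g z))%C by ring.
  eapply Rle_trans. apply Cmod_triangle.
  eapply Rle_trans. apply Rplus_le_compat_r, Cmod_triangle.
  rewrite !Cmod_mult.
  set (h := Cmod (w - z)) in *. assert (Hh : 0 <= h) by apply Cmod_ge_0.
  set (q := eps / (2 * M)) in *.
  replace eps with (2 * (q * M)) by (unfold q; field; lra).
  assert (A1 : Cmod (f w - f z - a * (w - z)) * Cmod (g z) <= q * h * Cmod (g z))
    by (apply Rmult_le_compat_r; auto).
  assert (A2 : Cmod (f z) * Cmod (g w - g z - b * (w - z)) <= Cmod (f z) * (q * h))
    by (apply Rmult_le_compat_l; auto).
  assert (A3 : Cmod (f w - f z) * Cmod (g w - g z) <=
     ((Cmod a + 1) * h) * ((Cmod b + 1) * h))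
    by (apply Rmult_le_compat; auto; apply Cmod_ge_0).
  assert (A4 : ((Cmod a + 1) * h) * ((Cmod b + 1) * h) <= (Cmod a + 1) * (Cmod b + 1) * (q * h)) by
    (replace ((Cmod a + 1) * h * ((Cmod b + 1) * h))
       with ((Cmod a + 1) * (Cmod b + 1) * (h * h)) by ring;
     apply Rmult_le_compat_l; nra).
  assert (A5 : 0 <= q * h) by nra.
  apply Rle_trans with (q * h * M).
  - apply Rle_trans with (q * h * Cmod (g z) + Cmod (f z) * (q * h)
      + (Cmod a + 1) * (Cmod b + 1) * (q * h)); [lra|].
    unfold M. ring_simplify. nra.
  - assert (0 <= q * h * M) by (apply Rmult_le_pos; lra).
    replace (2 * (q * M) * h) with (2 * (q * h * M)) by ring. lra.
Qed.

Lemma has_cderiv_scal (c : C) (f : C -> C) (z a : C) :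
  has_cderiv f z a -> has_cderiv (fscal c f) z (c * a)%C.
Proof.
  intros H. pose proof (has_cderiv_mult (fun _ => c) f z (RtoC 0) a (has_cderiv_const c z) H) as Hm.
  replace (c * a)%C with (0 * f z + c * a)%C by ring. exact Hm.
Qed.

Lemma has_cderiv_id (z : C) : has_cderiv (fun w => w) z (RtoC 1).
Proof.
  apply has_cderiv_eps. intros eps He. exists 1. split; [lra|]. intros w _.
  replace (w - z - 1 * (w - z))%C with (RtoC 0) by ring. rewrite Cmod_0.
  apply Rmult_le_pos; [lra|apply Cmod_ge_0].
Qed.

Lemma has_cderiv_pow (n : nat) (z : C) :
  has_cderiv (fun w => w ^ n)%C z (RtoC (INR n) * z ^ (pred n))%C.
Proof.
  induction n.
  - simpl. replace (0 * 1)%C with (RtoC 0) by ring. apply has_cderiv_const.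
  - pose proof (has_cderiv_mult (fun w => w) (fun w => w ^ n)%C z _ _ (has_cderiv_id z) IHn) as H.
    replace (RtoC (INR (S n)) * z ^ pred (S n))%C
      with (1 * z ^ n + z * (RtoC (INR n) * z ^ pred n))%C; [exact H|].
    rewrite S_INR, RtoC_plus. destruct n; simpl; ring.
Qed.

(** Continuity by components, so that the real continuity rules and the real Riemann integral apply.
    The domain is arbitrary because functions of [t], of [z] and of the pair [(x, t)] all occur. *)
Definition ccont {U : UniformSpace} (g : U -> C) (x : U) : Prop :=
  continuous (fun y => Re (g y)) x /\ continuous (fun y => Im (g y)) x.

Section CContinuity.
Context {U : UniformSpace}.
Implicit Types (g h : U -> C) (x : U).

Lemma ccont_const (c : C) (x : U) : ccont (fun _ => c) x.
Proof. split; apply continuous_const. Qed.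

Lemma ccont_add (g h : U -> C) (x : U) :
  ccont g x -> ccont h x -> ccont (fun y => g y + h y)%C x.
Proof. intros [H1 H2] [H3 H4]. split; simpl; apply (continuous_plus (V := R_NormedModule)); auto. Qed.

Lemma ccont_sub (g h : U -> C) (x : U) :
  ccont g x -> ccont h x -> ccont (fun y => g y - h y)%C x.
Proof. intros [H1 H2] [H3 H4]. split; simpl; apply (continuous_minus (V := R_NormedModule)); auto. Qed.

Lemma ccont_mult (g h : U -> C) (x : U) :
  ccont g x -> ccont h x -> ccont (fun y => g y * h y)%C x.
Proof.
  intros [H1 H2] [H3 H4]. split; simpl.
  - apply (continuous_minus (V := R_NormedModule)); apply (continuous_mult (K := R_AbsRing)); auto.
  - apply (continuous_plus (V := R_NormedModule)); apply (continuous_mult (K := R_AbsRing)); auto.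
Qed.

Lemma ccont_pow (g : U -> C) (n : nat) (x : U) : ccont g x -> ccont (fun y => g y ^ n)%C x.
Proof. intros H. induction n; simpl. apply ccont_const. apply ccont_mult; auto. Qed.

Lemma ccont_RtoC (g : U -> R) (x : U) : continuous g x -> ccont (fun y => RtoC (g y)) x.
Proof. intros H. split; simpl; auto. apply continuous_const. Qed.

Lemma continuous_Rinv_comp (g : U -> R) (x : U) : continuous g x -> g x <> 0 ->
  continuous (fun y => / g y) x.
Proof.
  intros H Hx. apply (continuous_comp g Rinv); auto.
  apply continuity_pt_filterlim. apply continuity_pt_inv; auto. apply continuity_pt_id.
Qed.

Lemma continuous_sum_sq (g : U -> C) (x : U) : ccont g x ->
  continuous (fun y => Re (g y) ^ 2 + Im (g y) ^ 2) x.
Proof.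
  intros [H1 H2].
  apply continuous_ext with (fun y => Re (g y) * Re (g y) + Im (g y) * Im (g y)).
  { intros y. simpl. rewrite !Rmult_1_r. reflexivity. }
  apply (continuous_plus (V := R_NormedModule) (fun y => Re (g y) * Re (g y))).
  - exact (continuous_mult (K := R_AbsRing) (fun y => Re (g y)) (fun y => Re (g y)) x H1 H1).
  - exact (continuous_mult (K := R_AbsRing) (fun y => Im (g y)) (fun y => Im (g y)) x H2 H2).
Qed.

Lemma ccont_inv (g : U -> C) (x : U) : ccont g x -> g x <> 0 -> ccont (fun y => / g y)%C x.
Proof.
  intros [H1 H2] Hx.
  assert (H : continuous (fun y => / (Re (g y) ^ 2 + Im (g y) ^ 2)) x).
  { apply continuous_Rinv_comp.
    - apply continuous_sum_sq. split; auto.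
    - rewrite <- Cmod2_alt. apply pow_nonzero. apply Rgt_not_eq, Cmod_gt_0, Hx. }
  split; simpl.
  - apply (continuous_mult (K := R_AbsRing)); auto.
  - apply (continuous_mult (K := R_AbsRing)); auto. apply (continuous_opp (V := R_NormedModule)); auto.
Qed.

Lemma continuous_Cmod (g : U -> C) (x : U) : ccont g x -> continuous (fun y => Cmod (g y)) x.
Proof.
  intros H.
  apply (continuous_comp (fun y => Re (g y) ^ 2 + Im (g y) ^ 2) sqrt).
  - apply continuous_sum_sq, H.
  - apply continuous_sqrt.
Qed.

Lemma ccont_comp (f : C -> C) (g : U -> C) (x : U) :
  ccont (U := C_UniformSpace) f (g x) -> ccont g x -> ccont (fun y => f (g y)) x.
Proof.
  intros [F1 F2] [G1 G2].
  assert (Hp : forall k : C -> R, continuous (T := C_UniformSpace) (U := R_UniformSpace) k (g x) ->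
    continuous (fun y => k (g y)) x).
  { intros k Hk.
    apply continuous_ext with (fun y => (fun a b => k (a, b)) (Re (g y)) (Im (g y))).
    { intros y. destruct (g y); reflexivity. }
    apply (continuous_comp_2 (fun y => Re (g y)) (fun y => Im (g y)) (fun a b => k (a, b))); auto.
    apply (continuous_ext (T := C_UniformSpace) (U := R_UniformSpace) k). { intros [a b]; reflexivity. }
    refine (eq_ind (g x) (fun p => continuous (T := C_UniformSpace) (U := R_UniformSpace) k p) Hk
      (Re (g x), Im (g x)) _). destruct (g x); reflexivity. }
  split; apply (Hp (fun w => _ (f w))); auto.
Qed.
End CContinuity.

Lemma ccont_id (z : C) : ccont (U := C_UniformSpace) (fun w => w) z.
Proof. destruct z as [a b]. split. apply continuous_fst. apply continuous_snd. Qed.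

Lemma ccont_eps (f : C -> C) (z : C) :
  (forall eps, 0 < eps -> exists delta, 0 < delta /\
    forall w, Cmod (w - z) < delta -> Cmod (f w - f z) < eps) ->
  ccont (U := C_UniformSpace) f z.
Proof.
  intros H.
  assert (Hk : forall k : C -> R, (forall w w', Rabs (k w - k w') <= Cmod (w - w')) ->
    continuous (T := C_UniformSpace) (U := R_UniformSpace) (fun w => k (f w)) z).
  { intros k Hk. apply filterlim_locally. intros eps.
    destruct (H eps (cond_pos eps)) as [d [Hd Hw]].
    (* Balls of [C_UniformSpace] are products of intervals and the modulus is at most the sum of the
       coordinates, hence the half radius. *)
    assert (Hd2 : 0 < d / 2) by lra.
    exists (mkposreal _ Hd2). intros w Hb.
    apply (Rle_lt_trans _ _ _ (Hk _ _)). apply Hw.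
    eapply Rle_lt_trans. apply Cmod_le_Rabs.
    destruct Hb as [Hb1 Hb2].
    change (Rabs (Re w - Re z) < d / 2) in Hb1. change (Rabs (Im w - Im z) < d / 2) in Hb2.
    simpl. unfold Re, Im, Rminus in *. lra. }
  split.
  - apply Hk. intros w w'. apply (re_le_Cmod (w - w')).
  - apply Hk. intros w w'. apply (im_le_Cmod (w - w')).
Qed.

Lemma has_cderiv_ccont (f : C -> C) (z d : C) :
  has_cderiv f z d -> ccont (U := C_UniformSpace) f z.
Proof.
  intros H. apply ccont_eps. intros eps He.
  destruct (has_cderiv_bounded _ _ _ H) as [d1 [Hd1 H1]].
  assert (Hp : 0 < Cmod d + 1) by (pose proof (Cmod_ge_0 d); lra).
  exists (Rmin d1 (eps / (Cmod d + 1))). split.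
  { apply Rmin_glb_lt; auto. apply Rdiv_lt_0_compat; lra. }
  intros w Hw.
  eapply Rle_lt_trans. apply H1. eapply Rlt_le_trans; [exact Hw|apply Rmin_l].
  apply Rmult_lt_reg_l with (/ (Cmod d + 1)). apply Rinv_0_lt_compat; auto.
  rewrite <- Rmult_assoc, Rinv_l, Rmult_1_l by lra.
  eapply Rlt_le_trans; [exact Hw|]. rewrite Rmult_comm. apply Rmin_r.
Qed.

Lemma entire_ccont (f : C -> C) (z : C) : entire f -> ccont (U := C_UniformSpace) f z.
Proof. intros H. eapply has_cderiv_ccont, entire_cderiv, H. Qed.

(** * Means over the circle *)

Definition mean (u : R -> R) : R := / (2 * PI) * RInt u 0 (2 * PI).

Lemma two_PI_pos : 0 < 2 * PI.
Proof. pose proof PI_RGT_0. lra. Qed.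

Lemma mean_ext (u w : R -> R) : (forall t, u t = w t) -> mean u = mean w.
Proof. intros H. unfold mean. f_equal. apply RInt_ext. auto. Qed.

Lemma ex_RInt_cont (u : R -> R) (a b : R) : (forall t, continuous u t) -> ex_RInt u a b.
Proof. intros H. apply (ex_RInt_continuous (V := R_CompleteNormedModule)). auto. Qed.

Lemma mean_le (u w : R -> R) : (forall t, continuous u t) -> (forall t, continuous w t) ->
  (forall t, u t <= w t) -> mean u <= mean w.
Proof.
  intros Hu Hw H. unfold mean. pose proof two_PI_pos.
  apply Rmult_le_compat_l. left; apply Rinv_0_lt_compat; auto.
  apply RInt_le; auto; try apply ex_RInt_cont; auto. lra.
Qed.

Lemma mean_const (c : R) : mean (fun _ => c) = c.
Proof.
  unfold mean. rewrite RInt_const. pose proof two_PI_pos.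
  change (/ (2 * PI) * ((2 * PI - 0) * c) = c). field. apply PI_neq0.
Qed.

Lemma mean_add (u w : R -> R) : (forall t, continuous u t) -> (forall t, continuous w t) ->
  mean (fun t => u t + w t) = mean u + mean w.
Proof.
  intros Hu Hw. unfold mean. rewrite <- Rmult_plus_distr_l. f_equal.
  apply (RInt_plus (V := R_CompleteNormedModule) u w); apply ex_RInt_cont; auto.
Qed.

Lemma mean_scal (c : R) (u : R -> R) : (forall t, continuous u t) ->
  mean (fun t => c * u t) = c * mean u.
Proof.
  intros Hu. unfold mean.
  rewrite (RInt_scal (V := R_CompleteNormedModule) u) by (apply ex_RInt_cont; auto).
  change (/ (2 * PI) * (c * RInt u 0 (2 * PI)) = c * (/ (2 * PI) * RInt u 0 (2 * PI))). ring.
Qed.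

Lemma mean_ge_0 (u : R -> R) : (forall t, continuous u t) -> (forall t, 0 <= u t) -> 0 <= mean u.
Proof.
  intros Hu H. rewrite <- (mean_const 0). apply mean_le; auto. intros; apply continuous_const.
Qed.

Lemma mean_le_const (u : R -> R) (M : R) : (forall t, continuous u t) ->
  (forall t, u t <= M) -> mean u <= M.
Proof.
  intros Hu H. rewrite <- (mean_const M). apply mean_le; auto. intros; apply continuous_const.
Qed.

Definition cmean (g : R -> C) : C := (mean (fun t => Re (g t)), mean (fun t => Im (g t))).

Lemma Re_cont (g : R -> C) : (forall t : R, ccont g t) -> forall t : R, continuous (fun t => Re (g t)) t.
Proof. intros H t. exact (proj1 (H t)). Qed.

Lemma Im_cont (g : R -> C) : (forall t : R, ccont g t) -> forall t : R, continuous (fun t => Im (g t)) t.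
Proof. intros H t. exact (proj2 (H t)). Qed.

Lemma Cmod_cont (g : R -> C) : (forall t : R, ccont g t) ->
  forall t : R, continuous (fun t => Cmod (g t)) t.
Proof. intros H t. apply continuous_Cmod, H. Qed.

Lemma cmean_ext (g h : R -> C) : (forall t, g t = h t) -> cmean g = cmean h.
Proof. intros H. unfold cmean. f_equal; apply mean_ext; intros; rewrite H; auto. Qed.

Lemma cmean_const (c : C) : cmean (fun _ => c) = c.
Proof. unfold cmean. rewrite !mean_const. destruct c; reflexivity. Qed.

Lemma cmean_add (g h : R -> C) : (forall t, ccont g t) -> (forall t, ccont h t) ->
  cmean (fun t => g t + h t)%C = (cmean g + cmean h)%C.
Proof.
  intros Hg Hh. unfold cmean, Cplus. cbn [fst snd].
  f_equal.
  - exact (mean_add _ _ (Re_cont g Hg) (Re_cont h Hh)).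
  - exact (mean_add _ _ (Im_cont g Hg) (Im_cont h Hh)).
Qed.

Lemma cmean_scal (c : C) (g : R -> C) : (forall t, ccont g t) ->
  cmean (fun t => c * g t)%C = (c * cmean g)%C.
Proof.
  intros Hg. destruct c as [a b]. unfold cmean, Cmult. cbn [fst snd].
  assert (Hs : forall k (u : R -> R), (forall t, continuous u t) -> forall t, continuous (fun t => k * u t) t).
  { intros k u Hu t. apply (continuous_scal_r (V := R_NormedModule)). auto. }
  pose proof (Re_cont g Hg) as Hre. pose proof (Im_cont g Hg) as Him.
  f_equal.
  - replace (a * mean (fun t => Re (g t)) - b * mean (fun t => Im (g t))) with
      (a * mean (fun t => Re (g t)) + (- b) * mean (fun t => Im (g t))) by ring.
    rewrite <- !mean_scal, <- mean_add by auto. apply mean_ext. intros t.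
    unfold Re, Im. simpl. ring.
  - rewrite <- !mean_scal, <- mean_add by auto. apply mean_ext. intros t.
    unfold Re, Im. simpl. ring.
Qed.

Lemma cmean_sub (g h : R -> C) : (forall t, ccont g t) -> (forall t, ccont h t) ->
  cmean (fun t => g t - h t)%C = (cmean g - cmean h)%C.
Proof.
  intros Hg Hh. replace (cmean g - cmean h)%C with (cmean g + RtoC (-1) * cmean h)%C by ring.
  rewrite <- cmean_scal, <- cmean_add; auto.
  - apply cmean_ext. intros; ring.
  - intros t. apply ccont_mult; auto. apply ccont_const.
Qed.

(** Rotation trick: after multiplication by the conjugate of the mean [c], the mean is the real
    number [|c|^2], hence a mean of real parts, each at most [|c| |g|]. *)
Lemma cmean_Cmod (g : R -> C) : (forall t, ccont g t) ->
  Cmod (cmean g) <= mean (fun t => Cmod (g t)).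
Proof.
  intros Hg. destruct (Ceq_dec (cmean g) 0) as [H0|H0].
  - rewrite H0, Cmod_0. apply mean_ge_0. apply Cmod_cont; auto. intros; apply Cmod_ge_0.
  - apply Cmod_gt_0 in H0. apply Rmult_le_reg_l with (Cmod (cmean g)); auto.
    set (c := cmean g) in *.
    assert (Hc : (forall t, ccont (fun t => Cconj c * g t)%C t)).
    { intros t. apply ccont_mult; auto. apply ccont_const. }
    replace (Cmod c * Cmod c) with (Re (cmean (fun t => Cconj c * g t)%C)).
    + rewrite <- mean_scal by (apply Cmod_cont; auto).
      change (mean (fun t => Re (Cconj c * g t)%C) <= mean (fun t => Cmod c * Cmod (g t))).
      apply mean_le.
      * apply Re_cont; auto.
      * intros t. apply (continuous_scal_r (V := R_NormedModule)). apply Cmod_cont; auto.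
      * intros t. rewrite <- (Cmod_conj c), <- Cmod_mult.
        eapply Rle_trans; [apply Rle_abs|apply re_le_Cmod].
    + rewrite cmean_scal by auto. fold c. rewrite Cmult_comm, <- Cmod2_conj.
      simpl. ring.
Qed.

Lemma cmean_bound (g : R -> C) (u : R -> R) : (forall t, ccont g t) -> (forall t, continuous u t) ->
  (forall t, Cmod (g t) <= u t) -> Cmod (cmean g) <= mean u.
Proof.
  intros Hg Hu H. eapply Rle_trans. apply cmean_Cmod; auto. apply mean_le; auto. apply Cmod_cont; auto.
Qed.

(** Derivative of a curve in the plane with respect to a real parameter; [has_cderiv] is the complex
    derivative. *)
Definition is_cderiv (g : R -> C) (t : R) (d : C) : Prop :=
  is_derive (fun s => Re (g s)) t (Re d) /\ is_derive (fun s => Im (g s)) t (Im d).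

(** Fundamental theorem of calculus over one period; it is the source of the vanishing means behind
    Cauchy's formula. *)
Lemma cmean_deriv_periodic (g d : R -> C) : (forall t, is_cderiv g t (d t)) ->
  (forall t, ccont d t) -> g (2 * PI) = g 0 -> cmean d = RtoC 0.
Proof.
  intros Hd Hc Hp.
  assert (H : forall u w : R -> R, (forall t, is_derive u t (w t)) -> (forall t, continuous w t) ->
    u (2 * PI) = u 0 -> mean w = 0).
  { intros u w Hu Hw Hp'. unfold mean.
    rewrite (is_RInt_unique _ _ _ _ (is_RInt_derive u w 0 (2 * PI) (fun t _ => Hu t) (fun t _ => Hw t))).
    change (/ (2 * PI) * (u (2 * PI) - u 0) = 0). rewrite Hp'. ring. }
  unfold cmean, RtoC. f_equal.
  - apply (H (fun t => Re (g t))). intros; apply Hd. apply Re_cont; auto. rewrite Hp; auto.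
  - apply (H (fun t => Im (g t))). intros; apply Hd. apply Im_cont; auto. rewrite Hp; auto.
Qed.

(** Complex differentiability makes [Re f] and [Im f] differentiable in two real variables, with
    partial derivatives [(Re d, - Im d)] and [(Im d, Re d)]; the real chain rule then applies. *)
Lemma has_cderiv_comp (f : C -> C) (g : R -> C) (t : R) (d l : C) :
  has_cderiv f (g t) d -> is_cderiv g t l -> is_cderiv (fun s => f (g s)) t (d * l)%C.
Proof.
  intros Hf [G1 G2].
  assert (Hdiff : forall (k : C -> R) (a b : R),
    (forall w w', k (w - w')%C = k w - k w') -> (forall w, Rabs (k w) <= Cmod w) ->
    (forall w, k (d * w)%C = a * Re w + b * Im w) ->
    differentiable_pt_lim (fun x y => k (f (x, y))) (Re (g t)) (Im (g t)) a b).
  { intros k a b K1 K2 K3 eps.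
    assert (He : 0 < eps / 2) by (destruct eps; simpl; lra).
    destruct (proj1 (has_cderiv_eps _ _ _) Hf _ He) as [dl [Hdl Hw]].
    assert (Hd2 : 0 < dl / 2) by lra.
    exists (mkposreal _ Hd2). intros u v Hu Hv. simpl in Hu, Hv.
    set (z := g t) in *. set (w := (u, v) : C).
    assert (Hz : (Re z, Im z) = z) by (destruct z; reflexivity). rewrite Hz.
    assert (Hwz : Cmod (w - z) <= Rabs (u - Re z) + Rabs (v - Im z)).
    { eapply Rle_trans; [apply Cmod_le_Rabs|]. apply Rle_refl. }
    replace (k (f w) - k (f z) - (a * (u - Re z) + b * (v - Im z)))
      with (k (f w - f z - d * (w - z))%C).
    - eapply Rle_trans; [apply K2|]. eapply Rle_trans; [apply Hw; lra|].
      pose proof (Rmax_l (Rabs (u - Re z)) (Rabs (v - Im z))).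
      pose proof (Rmax_r (Rabs (u - Re z)) (Rabs (v - Im z))).
      set (m := Rmax _ _) in *. apply Rle_trans with (eps / 2 * (2 * m)).
      + apply Rmult_le_compat_l; lra.
      + right; field.
    - rewrite !K1, K3. reflexivity. }
  split; apply is_derive_Reals; apply is_derive_Reals in G1, G2.
  - apply derivable_pt_lim_ext with (fun s => (fun x y => Re (f (x, y))) (Re (g s)) (Im (g s))).
    { intros s. destruct (g s); reflexivity. }
    replace (Re (d * l)) with (Re d * Re l + (- Im d) * Im l) by (unfold Re, Im; simpl; ring).
    apply (derivable_pt_lim_comp_2d (fun x y => Re (f (x, y))) (fun s => Re (g s)) (fun s => Im (g s))); auto.
    apply Hdiff; intros; auto.
    apply re_le_Cmod. unfold Re, Im; simpl; ring.
  - apply derivable_pt_lim_ext with (fun s => (fun x y => Im (f (x, y))) (Re (g s)) (Im (g s))).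
    { intros s. destruct (g s); reflexivity. }
    replace (Im (d * l)) with (Im d * Re l + Re d * Im l) by (unfold Re, Im; simpl; ring).
    apply (derivable_pt_lim_comp_2d (fun x y => Im (f (x, y))) (fun s => Re (g s)) (fun s => Im (g s))); auto.
    apply Hdiff; intros; auto.
    apply im_le_Cmod. unfold Re, Im; simpl; ring.
Qed.

Lemma is_cderiv_mult (g h : R -> C) (t : R) (a b : C) : is_cderiv g t a -> is_cderiv h t b ->
  is_cderiv (fun s => g s * h s)%C t (a * h t + g t * b)%C.
Proof.
  intros [G1 G2] [H1 H2].
  assert (M : forall u w du dw, is_derive u t du -> is_derive w t dw ->
    is_derive (fun s => u s * w s) t (du * w t + u t * dw)).
  { intros u w du dw Hu Hw. apply (is_derive_mult (K := R_AbsRing) u w t du dw Hu Hw Rmult_comm). }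
  split.
  - replace (Re (a * h t + g t * b)) with
      ((Re a * Re (h t) + Re (g t) * Re b) - (Im a * Im (h t) + Im (g t) * Im b))
      by (unfold Re, Im; simpl; ring).
    apply (is_derive_minus (V := R_NormedModule) (fun s => Re (g s) * Re (h s))
      (fun s => Im (g s) * Im (h s))); apply M; auto.
  - replace (Im (a * h t + g t * b)) with
      ((Re a * Im (h t) + Re (g t) * Im b) + (Im a * Re (h t) + Im (g t) * Re b))
      by (unfold Re, Im; simpl; ring).
    apply (is_derive_plus (V := R_NormedModule) (fun s => Re (g s) * Im (h s))
      (fun s => Im (g s) * Re (h s))); apply M; auto.
Qed.

Lemma is_cderiv_const (c : C) (t : R) : is_cderiv (fun _ => c) t (RtoC 0).
Proof. split; apply (is_derive_const (V := R_NormedModule)). Qed.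

Lemma is_cderiv_add (g h : R -> C) (t : R) (a b : C) : is_cderiv g t a -> is_cderiv h t b ->
  is_cderiv (fun s => g s + h s)%C t (a + b)%C.
Proof.
  intros [G1 G2] [H1 H2]. split.
  - apply (is_derive_plus (V := R_NormedModule) (fun s => Re (g s)) (fun s => Re (h s))); auto.
  - apply (is_derive_plus (V := R_NormedModule) (fun s => Im (g s)) (fun s => Im (h s))); auto.
Qed.

Definition cis (t : R) : C := (cos t, sin t).

Lemma is_cderiv_cis (t : R) : is_cderiv cis t (Ci * cis t)%C.
Proof.
  split; unfold cis, Re, Im; simpl.
  - replace (0 * cos t - 1 * sin t) with (- sin t) by ring. apply is_derive_cos.
  - replace (0 * sin t + 1 * cos t) with (cos t) by ring. apply is_derive_sin.
Qed.

Lemma Cmod_cis (t : R) : Cmod (cis t) = 1.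
Proof.
  unfold Cmod, cis. simpl. rewrite !Rmult_1_r.
  pose proof (sin2_cos2 t) as H. unfold Rsqr in H.
  replace (cos t * cos t + sin t * sin t) with 1 by lra. apply sqrt_1.
Qed.

Lemma cis_period : cis (2 * PI) = cis 0.
Proof. unfold cis. rewrite cos_2PI, sin_2PI, cos_0, sin_0. reflexivity. Qed.

Lemma continuous_cos_R (t : R) : continuous cos t.
Proof. apply (ex_derive_continuous (K := R_AbsRing) (V := R_NormedModule)). eexists. apply is_derive_cos. Qed.

Lemma continuous_sin_R (t : R) : continuous sin t.
Proof. apply (ex_derive_continuous (K := R_AbsRing) (V := R_NormedModule)). eexists. apply is_derive_sin. Qed.

Lemma ccont_cis (t : R) : ccont cis t.
Proof. split; unfold cis; simpl. apply continuous_cos_R. apply continuous_sin_R. Qed.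

(** * Cauchy's formula *)

(** Differentiation under the integral sign: the derivative of the mean of [u x] is the mean of
    [du x], which vanishes. *)
Lemma mean_param_const (u du : R -> R -> R) :
  (forall x t, is_derive (fun y => u y t) x (du x t)) ->
  (forall x t, continuous (fun q : R * R => du (fst q) (snd q)) (x, t)) ->
  (forall x t, continuous (u x) t) -> (forall x, mean (du x) = 0) ->
  mean (u 1) = mean (u 0).
Proof.
  intros Hd Hc Hu H0. unfold mean. f_equal. symmetry.
  apply (eq_is_derive (V := R_NormedModule) (fun x => RInt (u x) 0 (2 * PI))); [|lra].
  intros x _.
  assert (HD : forall y t, Derive (fun z => u z t) y = du y t).
  { intros y t. apply is_derive_unique, Hd. }
  replace (@zero R_NormedModule) with (RInt (fun t => Derive (fun y => u y t) x) 0 (2 * PI)).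
  - apply is_derive_RInt_param.
    + apply filter_forall. intros y t _. eexists. apply Hd.
    + intros t _. apply continuity_2d_pt_ext with du. intros; rewrite HD; auto.
      apply continuity_2d_pt_filterlim, Hc.
    + apply filter_forall. intros y. apply ex_RInt_cont, Hu.
  - rewrite (RInt_ext _ (du x)) by (intros; apply HD).
    specialize (H0 x). unfold mean in H0. apply Rmult_integral in H0. destruct H0 as [H0|H0].
    + exfalso. revert H0. apply Rinv_neq_0_compat. pose proof two_PI_pos. lra.
    + exact H0.
Qed.

Lemma cmean_param_const (G dG : R -> R -> C) :
  (forall x t, is_cderiv (fun y => G y t) x (dG x t)) ->
  (forall x t, ccont (fun q : R * R => dG (fst q) (snd q)) (x, t)) ->
  (forall x t, ccont (G x) t) -> (forall x, cmean (dG x) = RtoC 0) ->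
  cmean (G 1) = cmean (G 0).
Proof.
  intros Hd Hc Hu H0. unfold cmean. f_equal.
  - apply (mean_param_const (fun x t => Re (G x t)) (fun x t => Re (dG x t))).
    exact (fun x t => proj1 (Hd x t)). exact (fun x t => proj1 (Hc x t)). exact (fun x t => proj1 (Hu x t)).
    intros x. exact (f_equal Re (H0 x)).
  - apply (mean_param_const (fun x t => Im (G x t)) (fun x t => Im (dG x t))).
    exact (fun x t => proj2 (Hd x t)). exact (fun x t => proj2 (Hc x t)). exact (fun x t => proj2 (Hu x t)).
    intros x. exact (f_equal Im (H0 x)).
Qed.

Definition circle (r t : R) : C := (RtoC r * cis t)%C.
(** On the circle [d zeta = i zeta dt], so the Cauchy integral of [f] is the mean of [f] times this
    quotient. *)
Definition cauchy_kernel (r : R) (z : C) (t : R) : C := (circle r t / (circle r t - z))%C.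
Definition monomial (n : nat) : C -> C := fun w => (w ^ n)%C.

Section Cauchy.
Variables (r : R) (z : C).
Hypothesis Hr : Cmod z < r.

Local Notation zeta := (circle r).
Local Notation K := (cauchy_kernel r z).

Lemma radius_pos : 0 < r.
Proof. pose proof (Cmod_ge_0 z). lra. Qed.

Lemma Cmod_zeta (t : R) : Cmod (zeta t) = r.
Proof.
  unfold circle. rewrite Cmod_mult, Cmod_cis, Cmod_R, Rabs_pos_eq. ring.
  left; apply radius_pos.
Qed.

Lemma zeta_neq_0 (t : R) : zeta t <> 0.
Proof. apply Cmod_gt_0. rewrite Cmod_zeta. apply radius_pos. Qed.

Lemma Cmod_zeta_sub (t : R) : r - Cmod z <= Cmod (zeta t - z).
Proof. pose proof (Cmod_triangle_rev (zeta t) z) as H. rewrite Cmod_zeta in H. exact H. Qed.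

Lemma zeta_sub_neq_0 (t : R) : (zeta t - z)%C <> 0.
Proof. apply Cmod_gt_0. pose proof (Cmod_zeta_sub t). lra. Qed.

Lemma ccont_zeta (t : R) : ccont zeta t.
Proof. apply ccont_mult. apply ccont_const. apply ccont_cis. Qed.

Lemma ccont_K (t : R) : ccont K t.
Proof.
  apply ccont_mult. apply ccont_zeta. apply ccont_inv. apply ccont_sub. apply ccont_zeta.
  apply ccont_const. apply zeta_sub_neq_0.
Qed.

Lemma Cmod_K (t : R) : Cmod (K t) <= r / (r - Cmod z).
Proof.
  unfold cauchy_kernel. rewrite Cmod_div, Cmod_zeta by apply zeta_sub_neq_0.
  pose proof radius_pos. apply Rmult_le_compat_l; [lra|].
  apply Rinv_le_contravar; [lra|apply Cmod_zeta_sub].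
Qed.

Lemma is_cderiv_zeta (t : R) : is_cderiv zeta t (Ci * zeta t)%C.
Proof.
  pose proof (is_cderiv_mult _ _ t _ _ (is_cderiv_const (RtoC r) t) (is_cderiv_cis t)) as H.
  replace (Ci * zeta t)%C with (0 * cis t + r * (Ci * cis t))%C by (unfold circle; ring). exact H.
Qed.

Lemma cmean_zeta : cmean zeta = RtoC 0.
Proof.
  assert (H : cmean (fun t => Ci * zeta t)%C = RtoC 0).
  { apply cmean_deriv_periodic with zeta. apply is_cderiv_zeta.
    intros t. apply ccont_mult. apply ccont_const. apply ccont_zeta.
    unfold circle. rewrite cis_period. auto. }
  rewrite cmean_scal in H by apply ccont_zeta.
  destruct (Ceq_dec (cmean zeta) 0) as [|Hn]; auto.
  exfalso. revert H. apply Cmult_neq_0; auto. apply Ci_nz.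
Qed.

Lemma is_cderiv_RtoC_mult (c : C) (x : R) : is_cderiv (fun y => RtoC y * c)%C x c.
Proof.
  destruct c as [a b]. split; unfold Re, Im; simpl; auto_derive; auto; ring.
Qed.

(** The circle is contracted to [z] along [p x t = z + x (zeta - z)]. As [(zeta - z) K = zeta], the
    derivative of [f (p x t) * K t] in [x] is [f' (p x t) * zeta]; up to the factor [i x] this is
    the derivative of [f (p x t)] in [t]. Hence its mean vanishes, and the mean of [f (p x t) * K t]
    is the same at [x = 1] and at [x = 0]. *)
Lemma homotopy (f : C -> C) : entire f -> entire (C_derive f) ->
  cmean (fun t => f (zeta t) * K t)%C = (f z * cmean K)%C.
Proof.
  intros Hf Hf'.
  set (p := fun x t => (z + RtoC x * (zeta t - z))%C).
  set (G := fun x t => (f (p x t) * K t)%C).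
  set (dG := fun x t => (C_derive f (p x t) * zeta t)%C).
  assert (Hp1 : forall t, p 1 t = zeta t) by (intros; unfold p; ring).
  assert (Hp0 : forall t, p 0 t = z) by (intros; unfold p; ring).
  assert (Cp : forall x t, ccont (p x) t).
  { intros x t. apply ccont_add. apply ccont_const. apply ccont_mult. apply ccont_const.
    apply ccont_sub. apply ccont_zeta. apply ccont_const. }
  assert (H : cmean (G 1) = cmean (G 0)).
  { apply cmean_param_const with dG.
    - intros x t. unfold G, dG.
      replace (C_derive f (p x t) * zeta t)%C with
        (C_derive f (p x t) * (0 + (zeta t - z)) * K t + f (p x t) * 0)%C.
      + apply (is_cderiv_mult (fun y => f (p y t)) (fun _ => K t)); [|apply is_cderiv_const].
        apply (has_cderiv_comp f (fun y => p y t)). apply entire_cderiv; auto.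
        apply (is_cderiv_add (fun _ => z) (fun y => y * (zeta t - z))%C).
        apply is_cderiv_const. apply is_cderiv_RtoC_mult.
      + unfold cauchy_kernel. field. apply zeta_sub_neq_0.
    - intros x t. unfold dG.
      assert (Cz : ccont (fun q : R * R => zeta (snd q)) (x, t)).
      { apply ccont_mult. apply ccont_const.
        split; unfold cis; simpl.
        apply (continuous_comp (fun q : R * R => snd q) cos). apply continuous_snd. apply continuous_cos_R.
        apply (continuous_comp (fun q : R * R => snd q) sin). apply continuous_snd. apply continuous_sin_R. }
      apply ccont_mult; auto. apply ccont_comp. apply entire_ccont; auto.
      apply ccont_add. apply ccont_const. apply ccont_mult. apply ccont_RtoC, continuous_fst.
      apply ccont_sub; auto. apply ccont_const.
    - intros x t. apply ccont_mult. apply ccont_comp; auto. apply entire_ccont; auto. apply ccont_K.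
    (* At [x = 0] the factor [i x] cannot be divided out, but there [dG] is a constant times
       [zeta]. *)
    - intros x. destruct (Req_dec x 0) as [->|Hx].
      + rewrite (cmean_ext _ (fun t => C_derive f z * zeta t)%C) by (intros; unfold dG; rewrite Hp0; auto).
        rewrite cmean_scal, cmean_zeta by apply ccont_zeta. ring.
      + assert (CdG : forall t, ccont (dG x) t).
        { intros t. apply ccont_mult. apply ccont_comp; auto. apply entire_ccont; auto. apply ccont_zeta. }
        assert (H0 : cmean (fun t => (RtoC x * Ci) * dG x t)%C = RtoC 0).
        { apply cmean_deriv_periodic with (fun t => f (p x t)).
          - intros t. unfold dG.
            replace (x * Ci * (C_derive f (p x t) * zeta t))%C
              with (C_derive f (p x t) * (0 + (0 * (zeta t - z) + x * (Ci * zeta t + 0))))%C by ring.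
            apply (has_cderiv_comp f (p x)). apply entire_cderiv; auto.
            apply (is_cderiv_add (fun _ => z) (fun t => x * (zeta t + - z))%C). apply is_cderiv_const.
            apply (is_cderiv_mult (fun _ => RtoC x) (fun t => zeta t + - z)%C). apply is_cderiv_const.
            apply (is_cderiv_add zeta (fun _ => - z)%C). apply is_cderiv_zeta. apply is_cderiv_const.
          - intros t. apply ccont_mult; auto. apply ccont_const.
          - unfold p, circle. rewrite cis_period. auto. }
        rewrite cmean_scal in H0 by auto.
        destruct (Ceq_dec (cmean (dG x)) 0) as [|Hn]; auto.
        exfalso. revert H0. repeat apply Cmult_neq_0; auto; [|apply Ci_nz].
        intros E. apply Hx. apply RtoC_inj; auto. }
  rewrite (cmean_ext _ (G 1)) by (intros; unfold G; rewrite Hp1; auto). rewrite H.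
  rewrite (cmean_ext (G 0) (fun t => f z * K t)%C) by (intros; unfold G; rewrite Hp0; auto).
  apply cmean_scal, ccont_K.
Qed.

Lemma ccont_inv_zeta_pow (n : nat) (t : R) : ccont (fun t => (/ zeta t) ^ n)%C t.
Proof. apply ccont_pow, ccont_inv. apply ccont_zeta. apply zeta_neq_0. Qed.

(** The finite geometric series for [K] in powers of [z / zeta], whose exact remainder is
    [(z / zeta)^N K]. [phi] is kept general: the constant 1 normalizes the kernel, and the values of
    [f] on the circle yield its Taylor polynomials. *)
Lemma kernel_expansion (phi : R -> C) (N : nat) : (forall t, ccont phi t) ->
  (cmean (fun t => phi t * K t) -
    fsum (fun n => fscal (cmean (fun t => phi t * (/ zeta t) ^ n)) (monomial n)) N z)%C
  = cmean (fun t => z ^ N * (phi t * ((/ zeta t) ^ N * K t)))%C.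
Proof.
  intros Hphi.
  assert (C1 : forall n t, ccont (fun t => phi t * (/ zeta t) ^ n)%C t).
  { intros n t. apply ccont_mult; auto. apply ccont_inv_zeta_pow. }
  assert (C2 : forall n t, ccont (fun t => phi t * ((/ zeta t) ^ n * K t))%C t).
  { intros n t. apply ccont_mult; auto. apply ccont_mult. apply ccont_inv_zeta_pow. apply ccont_K. }
  induction N.
  - simpl. unfold fzero. unfold Cminus. rewrite Copp_0, Cplus_0_r.
    apply cmean_ext. intros; ring.
  - simpl fsum. unfold fadd at 1.
    replace (cmean (fun t => phi t * K t) -
      (fsum (fun n => fscal (cmean (fun t => phi t * (/ zeta t) ^ n)) (monomial n)) N z +
       fscal (cmean (fun t => phi t * (/ zeta t) ^ N)) (monomial N) z))%C with
      (cmean (fun t => phi t * K t) -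
      fsum (fun n => fscal (cmean (fun t => phi t * (/ zeta t) ^ n)) (monomial n)) N z -
       fscal (cmean (fun t => phi t * (/ zeta t) ^ N)) (monomial N) z)%C by ring.
    rewrite IHN. unfold fscal, monomial.
    rewrite (Cmult_comm _ (z ^ N)), <- (cmean_scal (z ^ N) (fun t => phi t * (/ zeta t) ^ N)%C),
      <- cmean_sub; auto.
    + apply cmean_ext. intros t. unfold cauchy_kernel. simpl. field.
      split; [apply zeta_sub_neq_0|apply zeta_neq_0].
    + intros t. apply ccont_mult; auto. apply ccont_const.
    + intros t. apply ccont_mult; auto. apply ccont_const.
Qed.

Lemma kernel_remainder (phi : R -> C) (N : nat) : (forall t, ccont phi t) ->
  Cmod (cmean (fun t => phi t * K t) -
    fsum (fun n => fscal (cmean (fun t => phi t * (/ zeta t) ^ n)) (monomial n)) N z)%C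
  <= (Cmod z / r) ^ N * (r / (r - Cmod z)) * mean (fun t => Cmod (phi t)).
Proof.
  intros Hphi. pose proof radius_pos. rewrite kernel_expansion by auto. rewrite <- mean_scal.
  apply cmean_bound.
  - intros t. apply ccont_mult. apply ccont_const. apply ccont_mult; auto.
    apply ccont_mult. apply ccont_inv_zeta_pow. apply ccont_K.
  - intros t. apply (continuous_scal_r (V := R_NormedModule)). apply Cmod_cont; auto.
  - intros t. rewrite !Cmod_mult, !Cmod_pow, Cmod_inv, Cmod_zeta by apply zeta_neq_0.
    unfold Rdiv at 1. rewrite Rpow_mult_distr. pose proof (Cmod_K t).
    replace (Cmod z ^ N * (Cmod (phi t) * ((/ r) ^ N * Cmod (K t)))) with
      (Cmod z ^ N * (/ r) ^ N * Cmod (phi t) * Cmod (K t)) by ring.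
    replace (Cmod z ^ N * (/ r) ^ N * (r / (r - Cmod z)) * Cmod (phi t)) with
      (Cmod z ^ N * (/ r) ^ N * Cmod (phi t) * (r / (r - Cmod z))) by ring.
    apply Rmult_le_compat_l; auto. repeat apply Rmult_le_pos; try apply pow_le; try apply Cmod_ge_0.
    left. apply Rinv_0_lt_compat; auto.
  - apply Cmod_cont; auto.
Qed.

Lemma inv_zeta (t : R) : (/ zeta t)%C = (RtoC (/ r) * cis (- t))%C.
Proof.
  pose proof radius_pos.
  assert (E : (zeta t * (RtoC (/ r) * cis (- t)))%C = 1).
  { unfold circle.
    replace (r * cis t * (RtoC (/ r) * cis (- t)))%C with
      (RtoC r * RtoC (/ r) * (cis t * cis (- t)))%C by ring.
    rewrite <- RtoC_mult, Rinv_r by lra.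
    unfold cis, RtoC, Cmult. simpl. rewrite cos_neg, sin_neg.
    pose proof (sin2_cos2 t) as Hs. unfold Rsqr in Hs. f_equal; ring_simplify; nra. }
  replace (/ zeta t)%C with (/ zeta t * (zeta t * (RtoC (/ r) * cis (- t))))%C
    by (rewrite E; ring).
  field. apply zeta_neq_0.
Qed.

(** [zeta ^ (- m)] is periodic with derivative [- i m zeta ^ (- m)]; for [m > 0] the constant can be
    divided out. *)
Lemma cmean_inv_zeta_pow (n : nat) : cmean (fun t => (/ zeta t) ^ S n)%C = RtoC 0.
Proof.
  assert (D1 : forall t, is_cderiv (fun t => / zeta t)%C t (- Ci * / zeta t)%C).
  { intros t. rewrite inv_zeta.
    assert (D : is_cderiv (fun t => RtoC (/ r) * cis (- t))%C t (- Ci * (RtoC (/ r) * cis (- t)))%C).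
    { replace (- Ci * (RtoC (/ r) * cis (- t)))%C
        with (0 * cis (- t) + RtoC (/ r) * (- Ci * cis (- t)))%C by ring.
      apply (is_cderiv_mult (fun _ => RtoC (/ r)) (fun t => cis (- t))). apply is_cderiv_const.
      split; unfold cis, Re, Im; simpl; auto_derive; auto; ring. }
    destruct D as [D1 D2].
    split; [apply is_derive_ext with (2 := D1)|apply is_derive_ext with (2 := D2)];
      intros s; rewrite inv_zeta; auto. }
  assert (Dn : forall m t, is_cderiv (fun t => (/ zeta t) ^ m)%C t (- Ci * RtoC (INR m) * (/ zeta t) ^ m)%C).
  { induction m; intros t.
    - simpl. replace (- Ci * 0 * 1)%C with (RtoC 0) by ring. apply is_cderiv_const.
    - replace (- Ci * RtoC (INR (S m)) * (/ zeta t) ^ S m)%C with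
        ((- Ci * / zeta t) * (/ zeta t) ^ m + / zeta t * (- Ci * RtoC (INR m) * (/ zeta t) ^ m))%C
        by (rewrite S_INR, RtoC_plus; simpl; ring).
      apply (is_cderiv_mult (fun t => / zeta t)%C (fun t => (/ zeta t) ^ m)%C); auto. }
  assert (H : cmean (fun t => (- Ci * RtoC (INR (S n))) * (/ zeta t) ^ S n)%C = RtoC 0).
  { apply cmean_deriv_periodic with (fun t => (/ zeta t) ^ S n)%C. apply Dn.
    intros t. apply ccont_mult. apply ccont_const. apply ccont_inv_zeta_pow.
    unfold circle. rewrite cis_period. auto. }
  rewrite cmean_scal in H by apply ccont_inv_zeta_pow.
  destruct (Ceq_dec (cmean (fun t => (/ zeta t) ^ S n)%C) 0) as [|Hn]; auto.
  exfalso. revert H. apply Cmult_neq_0; auto. apply Cmult_neq_0.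
  - intros E. apply Ci_nz. replace Ci with (- - Ci)%C by ring. rewrite E. ring.
  - intros E. apply RtoC_inj in E. revert E. apply not_0_INR. lia.
Qed.

Lemma ratio_lt_1 : 0 <= Cmod z / r < 1.
Proof.
  pose proof radius_pos. split.
  - apply Rmult_le_pos. apply Cmod_ge_0. left. apply Rinv_0_lt_compat; auto.
  - apply Rlt_div_l; lra.
Qed.

(** When the kernel is expanded against the constant 1, only the term of index 0 has a nonzero mean,
    and the remainder tends to 0 because [|z| < r]. *)
Lemma cmean_K : cmean K = RtoC 1.
Proof.
  assert (H : forall N, Cmod (cmean K - 1) <= (Cmod z / r) ^ S N * (r / (r - Cmod z))).
  { intros N. pose proof (kernel_remainder (fun _ => RtoC 1) (S N)) as H.
    cbv beta in H.
    rewrite (cmean_ext (fun t => 1 * K t)%C K) in H by (intros; ring).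
    rewrite Cmod_1, mean_const, Rmult_1_r in H.
    replace (RtoC 1) with
      (fsum (fun n => fscal (cmean (fun t => 1 * (/ zeta t) ^ n))%C (monomial n)) (S N) z);
      [apply H; intros; apply ccont_const|].
    rewrite (fsum_remove _ 0) by lia. rewrite fsum_zero.
    - unfold fadd, fscal, fzero, monomial. simpl.
      rewrite (cmean_ext _ (fun _ => RtoC 1)), cmean_const by (intros; ring). ring.
    - intros k _. destruct Nat.eq_dec as [|Hk]; auto. destruct k; [easy|].
      rewrite (cmean_ext _ (fun t => (/ zeta t) ^ S k)%C), cmean_inv_zeta_pow by (intros; ring).
      fun_ring. }
  assert (H0 : Cmod (cmean K - 1) <= 0).
  { apply le_epsilon. intros eps He. rewrite Rplus_0_l.
    assert (Hc : 0 < r / (r - Cmod z)).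
    { pose proof radius_pos. apply Rdiv_lt_0_compat; lra. }
    pose proof ratio_lt_1 as Hq.
    destruct (pow_lt_1_zero (Cmod z / r)) with (y := eps / (r / (r - Cmod z))) as [N HN].
    { rewrite Rabs_pos_eq; lra. }
    { apply Rdiv_lt_0_compat; auto. }
    specialize (HN (S N) ltac:(lia)). specialize (H N).
    eapply Rle_trans. apply H. left. apply Rlt_div_r; auto.
    eapply Rle_lt_trans; [apply Rle_abs|]. exact HN. }
  assert (E : (cmean K - 1)%C = 0).
  { apply Cmod_eq_0. apply Rle_antisym; auto. apply Cmod_ge_0. }
  replace (cmean K) with (cmean K - 1 + 1)%C by ring. rewrite E. ring.
Qed.

Theorem cauchy_formula (f : C -> C) : entire f -> entire (C_derive f) ->
  f z = cmean (fun t => f (zeta t) * K t)%C.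
Proof. intros Hf Hf'. rewrite homotopy, cmean_K by auto. ring. Qed.

End Cauchy.

(** * Power means and Minkowski's inequality *)

Lemma rpow_pos (x a : R) : 0 < x -> rpow x a = Rpower x a.
Proof. intros H. unfold rpow. destruct Rlt_dec; easy. Qed.

Lemma rpow_zero (a : R) : rpow 0 a = 0.
Proof. unfold rpow. destruct Rlt_dec; lra. Qed.

Lemma rpow_gt_0 (x a : R) : 0 < x -> 0 < rpow x a.
Proof. intros H. rewrite rpow_pos by auto. apply exp_pos. Qed.

Lemma rpow_ge_0 (x a : R) : 0 <= rpow x a.
Proof. unfold rpow. destruct Rlt_dec. left; apply exp_pos. lra. Qed.

Lemma rpow_lt_compat (x y a : R) : 0 < a -> 0 <= x < y -> rpow x a < rpow y a.
Proof.
  intros Ha [[Hx|<-] Hxy].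
  - rewrite !rpow_pos by lra. apply Rlt_Rpower_l; auto.
  - rewrite rpow_zero. apply rpow_gt_0; auto.
Qed.

Lemma rpow_le_compat (x y a : R) : 0 < a -> 0 <= x <= y -> rpow x a <= rpow y a.
Proof.
  intros Ha [Hx [Hxy| ->]]; [|lra]. left. apply rpow_lt_compat; auto.
Qed.

Lemma rpow_mult_distr (x y a : R) : 0 <= x -> 0 <= y -> rpow (x * y) a = rpow x a * rpow y a.
Proof.
  intros [Hx|<-] [Hy|<-]; rewrite ?Rmult_0_l, ?Rmult_0_r, ?rpow_zero; try ring.
  rewrite !rpow_pos by (auto; apply Rmult_lt_0_compat; auto).
  rewrite Rpower_mult_distr; auto.
Qed.

Lemma rpow_inv_l (x a : R) : 0 < a -> 0 <= x -> rpow (rpow x a) (/ a) = x.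
Proof.
  intros Ha [Hx|<-].
  - rewrite (rpow_pos _ (/ a)) by (apply rpow_gt_0; auto). rewrite rpow_pos by auto.
    rewrite Rpower_mult, Rinv_r, Rpower_1; lra.
  - rewrite !rpow_zero. auto.
Qed.

Lemma rpow_inv_r (x a : R) : 0 < a -> 0 <= x -> rpow (rpow x (/ a)) a = x.
Proof.
  intros Ha Hx. rewrite <- (Rinv_inv a) at 2. apply rpow_inv_l; auto. apply Rinv_0_lt_compat; auto.
Qed.

Lemma rpow_one (a : R) : rpow 1 a = 1.
Proof. rewrite rpow_pos by lra. unfold Rpower. rewrite ln_1, Rmult_0_r. apply exp_0. Qed.

Lemma continuous_rpow (a x : R) : 0 < a -> continuous (fun y => rpow y a) x.
Proof.
  intros Ha. destruct (Rtotal_order x 0) as [Hx|[->|Hx]].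
  - apply continuous_ext_loc with (fun _ => 0); [|apply continuous_const].
    assert (H : 0 < - x) by lra. exists (mkposreal _ H). intros y Hy.
    change (Rabs (y - x) < - x) in Hy. apply Rabs_def2 in Hy.
    unfold rpow. destruct Rlt_dec; lra.
  - apply filterlim_locally. intros eps.
    assert (H : 0 < rpow eps (/ a)) by apply rpow_gt_0, cond_pos.
    exists (mkposreal _ H). intros y Hy. change (Rabs (y - 0) < rpow eps (/ a)) in Hy.
    change (Rabs (rpow y a - rpow 0 a) < eps).
    rewrite rpow_zero, Rminus_0_r, Rabs_pos_eq by apply rpow_ge_0.
    rewrite Rminus_0_r in Hy.
    destruct (Rlt_dec 0 y) as [Hp|Hp].
    + rewrite Rabs_pos_eq in Hy by lra. rewrite <- (rpow_inv_r eps a) by (auto; left; apply cond_pos).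
      apply rpow_lt_compat; auto. split; lra.
    + unfold rpow. destruct Rlt_dec; [lra|]. apply cond_pos.
  - apply continuous_ext_loc with (fun y => Rpower y a).
    + exists (mkposreal _ Hx). intros y Hy. change (Rabs (y - x) < x) in Hy.
      apply Rabs_def2 in Hy. rewrite rpow_pos; lra.
    + apply (ex_derive_continuous (K := R_AbsRing) (V := R_NormedModule)).
      unfold Rpower. auto_derive. auto.
Qed.

(** Comes from [1 + s <= exp s] alone. With [x = exp (th * a)] and [th = / q] the claim reads
    [exp (th * a) <= th * exp a + (1 - th)]; the tangent inequalities of [exp] at [th * a], taken at
    [a] and at 0 with weights [th] and [1 - th], add up to it because their linear terms cancel. *)
Lemma rpow_bernoulli (x q : R) : 1 <= q -> 0 <= x -> 1 + q * (x - 1) <= rpow x q.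
Proof.
  intros Hq [Hx|<-].
  - rewrite rpow_pos by auto. unfold Rpower. set (b := ln x). rewrite <- (exp_ln x Hx). fold b.
    set (a := q * b). set (th := / q).
    assert (Hth : 0 < th <= 1).
    { unfold th. split. apply Rinv_0_lt_compat; lra. rewrite <- Rinv_1. apply Rinv_le_contravar; lra. }
    replace b with (th * a) by (unfold th, a; field; lra).
    assert (E1 : exp a = exp (th * a) * exp ((1 - th) * a)) by (rewrite <- exp_plus; f_equal; ring).
    assert (E2 : exp (th * a) * exp (- (th * a)) = 1)
      by (rewrite <- exp_plus; replace (th * a + - (th * a)) with 0 by ring; apply exp_0).
    pose proof (exp_pos (th * a)) as Hp.
    assert (I1 : 1 + (1 - th) * a <= exp ((1 - th) * a)) by apply exp_ineq1_le.
    assert (I2 : 1 + - (th * a) <= exp (- (th * a))) by apply exp_ineq1_le.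
    apply Rmult_le_compat_l with (r := exp (th * a)) in I1; [|lra].
    apply Rmult_le_compat_l with (r := exp (th * a)) in I2; [|lra].
    rewrite <- E1 in I1. rewrite E2 in I2.
    apply Rmult_le_compat_l with (r := th) in I1; [|lra].
    apply Rmult_le_compat_l with (r := 1 - th) in I2; [|lra].
    assert (I : exp (th * a) <= th * exp a + (1 - th)).
    { replace (exp (th * a)) with (th * (exp (th * a) * (1 + (1 - th) * a)) +
        (1 - th) * (exp (th * a) * (1 + - (th * a)))) by ring. lra. }
    apply Rmult_le_compat_l with (r := q) in I; [|lra].
    replace (q * (th * exp a + (1 - th))) with (exp a + q - 1) in I by (unfold th; field; lra). lra.
  - rewrite rpow_zero. lra.
Qed.

(** Bernoulli's inequality at [w / m], scaled by [m ^ q], is the tangent line of the power at the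
    convex combination [m]; averaging it over [x] and [y] cancels the slope. *)
Lemma rpow_convex (x y th q : R) : 1 <= q -> 0 <= x -> 0 <= y -> 0 <= th <= 1 ->
  rpow (th * x + (1 - th) * y) q <= th * rpow x q + (1 - th) * rpow y q.
Proof.
  intros Hq Hx Hy Hth. set (m := th * x + (1 - th) * y).
  assert (Hm : 0 <= m) by (unfold m; nra).
  destruct Hm as [Hm|Hm].
  - assert (B : forall w, 0 <= w -> (1 + q * (w / m - 1)) * rpow m q <= rpow w q).
    { intros w Hw. replace w with (w / m * m) at 2 by (field; lra).
      assert (0 <= w / m) by (apply Rmult_le_pos; auto; left; apply Rinv_0_lt_compat; auto).
      rewrite rpow_mult_distr by lra. apply Rmult_le_compat_r. apply rpow_ge_0.
      apply rpow_bernoulli; auto. }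
    pose proof (B x Hx) as Bx. pose proof (B y Hy) as By.
    apply Rmult_le_compat_l with (r := th) in Bx; [|lra].
    apply Rmult_le_compat_l with (r := 1 - th) in By; [|lra].
    replace (rpow m q) with (th * ((1 + q * (x / m - 1)) * rpow m q) +
      (1 - th) * ((1 + q * (y / m - 1)) * rpow m q)). lra.
    replace (th * ((1 + q * (x / m - 1)) * rpow m q) +
      (1 - th) * ((1 + q * (y / m - 1)) * rpow m q)) with
      ((1 + q * ((th * x + (1 - th) * y) / m - 1)) * rpow m q) by (field; lra).
    fold m. replace (m / m) with 1 by (field; lra). ring.
  - rewrite <- Hm, rpow_zero. pose proof (rpow_ge_0 x q). pose proof (rpow_ge_0 y q). nra.
Qed.

Section LpMean.
Variable q : R.
Hypothesis Hq : 1 <= q.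

Definition lp_mean (u : R -> R) : R := rpow (mean (fun t => rpow (u t) q)) (/ q).

Lemma q_pos : 0 < q.
Proof. lra. Qed.

Lemma continuous_rpow_comp (u : R -> R) (t : R) : continuous u t -> continuous (fun t => rpow (u t) q) t.
Proof. intros H. apply (continuous_comp u (fun y => rpow y q)); auto. apply continuous_rpow, q_pos. Qed.

Lemma lp_mean_ge_0 (u : R -> R) : 0 <= lp_mean u.
Proof. apply rpow_ge_0. Qed.

Lemma continuous_scal_R (c : R) (u : R -> R) (t : R) : continuous u t -> continuous (fun t => c * u t) t.
Proof. intros H. apply (continuous_scal_r (V := R_NormedModule)). auto. Qed.

Lemma mean_rpow_ge_0 (u : R -> R) : (forall t, continuous u t) -> 0 <= mean (fun t => rpow (u t) q).
Proof.
  intros Hu. apply mean_ge_0. intros; apply continuous_rpow_comp; auto. intros; apply rpow_ge_0.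
Qed.

(** Trades a bound on the root of a mean for a normalized bound without roots, to which pointwise
    convexity can be applied. *)
Lemma lp_mean_le_normalized (u : R -> R) (A : R) : (forall t, continuous u t) -> (forall t, 0 <= u t) ->
  0 < A -> lp_mean u <= A <-> mean (fun t => rpow (u t / A) q) <= 1.
Proof.
  intros Cu Pu HA. pose proof q_pos.
  assert (E : mean (fun t => rpow (u t / A) q) = rpow (/ A) q * mean (fun t => rpow (u t) q)).
  { rewrite <- mean_scal by (intros; apply continuous_rpow_comp; auto). apply mean_ext. intros t.
    unfold Rdiv. rewrite rpow_mult_distr; auto. ring. left; apply Rinv_0_lt_compat; auto. }
  assert (P1 : 0 < rpow A q) by (apply rpow_gt_0; auto).
  assert (P2 : rpow (/ A) q * rpow A q = 1).
  { rewrite <- rpow_mult_distr, Rinv_l, rpow_one; auto; try lra. left; apply Rinv_0_lt_compat; auto. }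
  assert (P3 : 0 < rpow (/ A) q) by (apply rpow_gt_0, Rinv_0_lt_compat; auto).
  rewrite E. set (m := mean (fun t => rpow (u t) q)).
  assert (Hm : 0 <= m) by (apply mean_rpow_ge_0; auto).
  unfold lp_mean. fold m. split; intros H1.
  - assert (m <= rpow A q).
    { rewrite <- (rpow_inv_r m q) by auto. apply rpow_le_compat; auto. split; auto. apply rpow_ge_0. }
    rewrite <- P2. apply Rmult_le_compat_l; lra.
  - rewrite <- (rpow_inv_l A q) by lra. apply rpow_le_compat. apply Rinv_0_lt_compat; auto.
    split; auto. rewrite <- P2 in H1. apply Rmult_le_reg_l in H1; auto.
Qed.

Lemma continuous_div_R (u : R -> R) (A t : R) : continuous u t -> continuous (fun t => u t / A) t.
Proof.
  intros H. apply continuous_ext with (fun t => / A * u t). { intros s. apply Rmult_comm. }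
  apply continuous_scal_R; auto.
Qed.

(** Bernoulli at [u / A] gives [u <= A (1 - 1 / q) + (A / q) (u / A)^q] pointwise; this is
    integrated with [A] just above [lp_mean u]. *)
Lemma mean_le_lp_mean (u : R -> R) : (forall t, continuous u t) -> (forall t, 0 <= u t) ->
  mean u <= lp_mean u.
Proof.
  intros Cu Pu. apply le_epsilon. intros eps He.
  (* Adding [eps] keeps [A] positive when the mean is zero. *)
  set (A := lp_mean u + eps). pose proof (lp_mean_ge_0 u) as Hl.
  assert (HA : 0 < A) by (unfold A; lra).
  assert (H : lp_mean u <= A) by (unfold A; lra).
  apply lp_mean_le_normalized in H; auto.
  set (w := fun t => rpow (u t / A) q) in *.
  assert (Cw : forall t, continuous w t).
  { intros t. apply continuous_rpow_comp, continuous_div_R; auto. }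
  assert (Hm : mean u <= mean (fun t => A * (1 - / q) + A / q * w t)).
  { apply mean_le; auto.
    - intros t. apply (continuous_plus (V := R_NormedModule)). apply continuous_const.
      apply continuous_scal_R; auto.
    - intros t. assert (HuA : 0 <= u t / A).
      { apply Rmult_le_pos; auto. left; apply Rinv_0_lt_compat; auto. }
      pose proof (rpow_bernoulli (u t / A) q Hq HuA) as Hb. fold (w t) in Hb.
      assert (0 < A / q) by (apply Rdiv_lt_0_compat; auto; apply q_pos).
      apply Rmult_le_compat_l with (r := A / q) in Hb; [|lra].
      replace (A / q * (1 + q * (u t / A - 1))) with (u t - A * (1 - / q)) in Hb by (field; lra). lra. }
  rewrite mean_add, mean_const, mean_scal in Hm; auto.
  - assert (0 < A / q) by (apply Rdiv_lt_0_compat; auto; apply q_pos).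
    apply Rmult_le_compat_l with (r := A / q) in H; [|lra].
    replace (A * (1 - / q)) with (A - A / q) in Hm by (field; lra). lra.
  - intros; apply continuous_const.
  - intros; apply continuous_scal_R; auto.
Qed.

Lemma lp_mean_le (u w : R -> R) : (forall t, continuous u t) -> (forall t, continuous w t) ->
  (forall t, 0 <= u t <= w t) -> lp_mean u <= lp_mean w.
Proof.
  intros Cu Cw H. apply rpow_le_compat. apply Rinv_0_lt_compat, q_pos.
  split. apply mean_rpow_ge_0; auto.
  apply mean_le; try (intros; apply continuous_rpow_comp; auto).
  intros t. apply rpow_le_compat. apply q_pos. auto.
Qed.

Lemma lp_mean_const (c : R) : 0 <= c -> lp_mean (fun _ => c) = c.
Proof. intros H. unfold lp_mean. rewrite mean_const. apply rpow_inv_l; auto. apply q_pos. Qed.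

Lemma lp_mean_scal (c : R) (u : R -> R) : 0 <= c -> (forall t, continuous u t) ->
  (forall t, 0 <= u t) -> lp_mean (fun t => c * u t) = c * lp_mean u.
Proof.
  intros Hc Cu Pu. unfold lp_mean.
  rewrite (mean_ext _ (fun t => rpow c q * rpow (u t) q)) by (intros; apply rpow_mult_distr; auto).
  rewrite mean_scal by (intros; apply continuous_rpow_comp; auto).
  rewrite rpow_mult_distr. rewrite rpow_inv_l; auto. apply q_pos.
  apply rpow_ge_0. apply mean_rpow_ge_0; auto.
Qed.

(** Minkowski's inequality by convexity: [(u + w) / (A + A')] is the convex combination of [u / A]
    and [w / A'] with weight [A / (A + A')], where [A] and [A'] lie just above the two means. *)
Lemma lp_mean_triangle (u w : R -> R) : (forall t, continuous u t) -> (forall t, continuous w t) ->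
  (forall t, 0 <= u t) -> (forall t, 0 <= w t) ->
  lp_mean (fun t => u t + w t) <= lp_mean u + lp_mean w.
Proof.
  intros Cu Cw Pu Pw. apply le_epsilon. intros eps He.
  set (A := lp_mean u + eps / 2). set (A' := lp_mean w + eps / 2).
  pose proof (lp_mean_ge_0 u). pose proof (lp_mean_ge_0 w).
  assert (HA : 0 < A) by (unfold A; lra). assert (HA' : 0 < A') by (unfold A'; lra).
  assert (H1 : lp_mean u <= A) by (unfold A; lra). assert (H2 : lp_mean w <= A') by (unfold A'; lra).
  apply lp_mean_le_normalized in H1, H2; auto.
  replace (lp_mean u + lp_mean w + eps) with (A + A') by (unfold A, A'; lra).
  assert (Cs : forall t, continuous (fun t => u t + w t) t).
  { intros t. apply (continuous_plus (V := R_NormedModule)); auto. }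
  apply lp_mean_le_normalized; auto.
  { intros t. specialize (Pu t). specialize (Pw t). lra. }
  { lra. }
  set (th := A / (A + A')).
  assert (Hth : 0 <= th <= 1).
  { unfold th. split. left; apply Rdiv_lt_0_compat; lra. apply Rle_div_l; lra. }
  assert (C1 : forall t, continuous (fun t => rpow (u t / A) q) t)
    by (intros; apply continuous_rpow_comp, continuous_div_R; auto).
  assert (C2 : forall t, continuous (fun t => rpow (w t / A') q) t)
    by (intros; apply continuous_rpow_comp, continuous_div_R; auto).
  apply Rle_trans with (mean (fun t => th * rpow (u t / A) q + (1 - th) * rpow (w t / A') q)).
  - apply mean_le.
    + intros; apply continuous_rpow_comp, continuous_div_R; auto.
    + intros t. apply (continuous_plus (V := R_NormedModule)); apply continuous_scal_R; auto.
    + intros t. replace ((u t + w t) / (A + A')) with (th * (u t / A) + (1 - th) * (w t / A'))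
        by (unfold th; field; lra).
      apply rpow_convex; auto; (apply Rmult_le_pos; auto; left; apply Rinv_0_lt_compat; auto).
  - rewrite mean_add, !mean_scal; auto; try (intros; apply continuous_scal_R; auto). nra.
Qed.

End LpMean.

(** [real] sends an infinite bound to 0. Here and in [le_Lub] the member [x] excludes minus infinity
    and the bound [M] excludes plus infinity. *)
Lemma Lub_le (E : R -> Prop) (x M : R) : E x -> (forall y, E y -> y <= M) -> real (Lub_Rbar E) <= M.
Proof.
  intros Ex HM. destruct (Lub_Rbar_correct E) as [H1 H2].
  specialize (H2 (Finite M) HM). specialize (H1 x Ex).
  destruct (Lub_Rbar E); simpl in *; auto; contradiction.
Qed.

Lemma le_Lub (E : R -> Prop) (x M : R) : E x -> (forall y, E y -> y <= M) -> x <= real (Lub_Rbar E).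
Proof.
  intros Ex HM. destruct (Lub_Rbar_correct E) as [H1 H2].
  specialize (H2 (Finite M) HM). specialize (H1 x Ex).
  destruct (Lub_Rbar E); simpl in *; auto; contradiction.
Qed.

(** * Cauchy estimates and Taylor polynomials *)

Definition regular (f : C -> C) : Prop := entire f /\ entire (C_derive f).

(** It lies below [Mp p] for every [p >= 1], so Cauchy estimates expressed through it serve all
    exponents at once. *)
Definition M1 (f : C -> C) (r : R) : R := mean (fun t => Cmod (f (circle r t))).

Lemma ccont_circle_comp (f : C -> C) (r t : R) : (forall z : C, ccont (U := C_UniformSpace) f z) ->
  ccont (fun t => f (circle r t)) t.
Proof. intros H. apply ccont_comp; auto. apply ccont_zeta. Qed.

Lemma regular_ccont (f : C -> C) : regular f -> forall z : C, ccont (U := C_UniformSpace) f z.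
Proof. intros [H _] z. apply entire_ccont, H. Qed.

Lemma M1_ge_0 (f : C -> C) (r : R) : (forall z : C, ccont (U := C_UniformSpace) f z) -> 0 <= M1 f r.
Proof.
  intros H. apply mean_ge_0. apply Cmod_cont. intros; apply ccont_circle_comp; auto.
  intros; apply Cmod_ge_0.
Qed.

Lemma circle_sub_lower (r s t : R) (z : C) : Cmod z <= s -> s < r ->
  r - s <= Cmod (circle r t - z) /\ (circle r t - z)%C <> 0 /\ Cmod (circle r t) = r.
Proof.
  intros Hz Hr. assert (Hzr : Cmod z < r) by lra.
  split; [|split].
  - pose proof (Cmod_zeta_sub r z Hzr t). lra.
  - apply zeta_sub_neq_0; auto.
  - apply (Cmod_zeta r z); auto.
Qed.

Lemma regular_bound (f : C -> C) (r s : R) (z : C) : regular f -> Cmod z <= s -> s < r ->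
  Cmod (f z) <= r / (r - s) * M1 f r.
Proof.
  intros Hf Hz Hr. assert (Hzr : Cmod z < r) by lra.
  pose proof (regular_ccont f Hf) as Cf. destruct Hf as [Hf Hf'].
  rewrite (cauchy_formula r z Hzr f Hf Hf') at 1. unfold M1.
  pose proof (Cmod_ge_0 z).
  rewrite <- mean_scal by (apply Cmod_cont; intros; apply ccont_circle_comp; auto).
  apply cmean_bound.
  - intros t. apply ccont_mult. apply ccont_circle_comp; auto. apply ccont_K; auto.
  - intros t. apply (continuous_scal_r (V := R_NormedModule)), continuous_Cmod.
    apply ccont_circle_comp; auto.
  - intros t. rewrite Cmod_mult, Rmult_comm. apply Rmult_le_compat_r. apply Cmod_ge_0.
    eapply Rle_trans. apply Cmod_K; auto. apply Rmult_le_compat_l; [lra|].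
    apply Rinv_le_contravar; lra.
Qed.

(** Subtracting from the kernel at [w] its first-order expansion at [z] leaves [(w - z)^2 zeta /
    ((zeta - w) (zeta - z)^2)]. The explicit error, proportional to [M1 f r], can be summed over a
    series and also yields Lipschitz bounds on discs. *)
Lemma cauchy_first_order (f : C -> C) (r s : R) (z : C) : regular f -> Cmod z <= s -> s < r ->
  exists d, Cmod d <= r / (r - s) ^ 2 * M1 f r /\
    forall w, Cmod w <= s -> Cmod (f w - f z - d * (w - z)) <=
      r / (r - s) ^ 3 * Cmod (w - z) ^ 2 * M1 f r.
Proof.
  intros Hf Hz Hr. assert (Hzr : Cmod z < r) by lra.
  pose proof (regular_ccont f Hf) as Cf. destruct Hf as [Hf Hf'].
  pose proof (Cmod_ge_0 z) as Hz0.
  assert (Cc : forall t : R, ccont (fun t => f (circle r t)) t) by (intros; apply ccont_circle_comp; auto).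
  assert (Cs : forall (c : C) (t : R), ccont (fun t => circle r t - c)%C t).
  { intros. apply ccont_sub. apply ccont_zeta. apply ccont_const. }
  set (k1 := fun t => (circle r t / (circle r t - z) ^ 2)%C).
  assert (Ck1 : forall t : R, ccont k1 t).
  { intros t. apply ccont_mult. apply ccont_zeta. apply ccont_inv. apply ccont_pow; auto.
    apply Cpow_nz. apply (circle_sub_lower r s); auto. }
  exists (cmean (fun t => f (circle r t) * k1 t)%C). unfold M1. split.
  - rewrite <- mean_scal by (apply Cmod_cont; auto).
    apply cmean_bound.
    + intros t. apply ccont_mult; auto.
    + intros t. apply (continuous_scal_r (V := R_NormedModule)), continuous_Cmod. auto.
    + intros t. destruct (circle_sub_lower r s t z Hz Hr) as [L1 [L2 L3]].
      rewrite Cmod_mult, Rmult_comm. apply Rmult_le_compat_r. apply Cmod_ge_0.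
      unfold k1. rewrite Cmod_div, Cmod_pow, L3 by (apply Cpow_nz; auto).
      apply Rmult_le_compat_l; [lra|]. apply Rinv_le_contravar. apply pow_lt; lra.
      apply pow_incr. lra.
  - intros w Hw. assert (Hwr : Cmod w < r) by lra.
    rewrite (cauchy_formula r z Hzr f Hf Hf'), (cauchy_formula r w Hwr f Hf Hf') at 1.
    rewrite (Cmult_comm _ (w - z)).
    assert (Ckw : forall t : R, ccont (fun t => f (circle r t) * cauchy_kernel r w t)%C t).
    { intros t. apply ccont_mult; auto. apply ccont_K; auto. }
    assert (Ckz : forall t : R, ccont (fun t => f (circle r t) * cauchy_kernel r z t)%C t).
    { intros t. apply ccont_mult; auto. apply ccont_K; auto. }
    assert (Ck : forall t : R, ccont (fun t => f (circle r t) * k1 t)%C t).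
    { intros t. apply ccont_mult; auto. }
    rewrite <- cmean_scal, <- !cmean_sub; auto.
    2:{ intros t. apply ccont_sub; auto. }
    2:{ intros t. apply ccont_mult; auto. apply ccont_const. }
    rewrite <- mean_scal by (apply Cmod_cont; auto).
    apply cmean_bound.
    + intros t. apply ccont_sub. apply ccont_sub; auto. apply ccont_mult; auto. apply ccont_const.
    + intros t. apply (continuous_scal_r (V := R_NormedModule)), continuous_Cmod. auto.
    + intros t. destruct (circle_sub_lower r s t z Hz Hr) as [L1 [L2 L3]].
      destruct (circle_sub_lower r s t w Hw Hr) as [L4 [L5 _]].
      replace (f (circle r t) * cauchy_kernel r w t - f (circle r t) * cauchy_kernel r z t -
        (w - z) * (f (circle r t) * k1 t))%C with
        ((w - z) ^ 2 * (f (circle r t) * (circle r t / ((circle r t - w) * (circle r t - z) ^ 2))))%C.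
      2:{ unfold cauchy_kernel, k1. simpl. field. split; auto. }
      rewrite !Cmod_mult, Cmod_div, Cmod_mult, !Cmod_pow, L3
        by (apply Cmult_neq_0; auto; apply Cpow_nz; auto).
      set (a := Cmod (w - z)). set (b := Cmod (f (circle r t))).
      assert (0 <= a) by apply Cmod_ge_0. assert (0 <= b) by apply Cmod_ge_0.
      replace (r / (r - s) ^ 3 * a ^ 2 * b) with (a ^ 2 * (b * (r / (r - s) ^ 3))) by ring.
      apply Rmult_le_compat_l. apply pow_le; auto. apply Rmult_le_compat_l; auto.
      apply Rmult_le_compat_l; [lra|]. apply Rinv_le_contravar. apply pow_lt; lra.
      replace ((r - s) ^ 3) with ((r - s) * (r - s) ^ 2) by ring.
      apply Rmult_le_compat; try lra. apply pow_le; lra. apply pow_incr; lra.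
Qed.

Definition tcoef (f : C -> C) (r : R) (n : nat) : C :=
  cmean (fun t => f (circle r t) * (/ circle r t) ^ n)%C.

Definition tpoly (a : nat -> C) (N : nat) : C -> C := fsum (fun n => fscal (a n) (monomial n)) N.

Lemma taylor_remainder (f : C -> C) (r : R) (N : nat) (z : C) : regular f -> Cmod z < r ->
  Cmod (f z - tpoly (tcoef f r) N z) <= (Cmod z / r) ^ N * (r / (r - Cmod z)) * M1 f r.
Proof.
  intros Hf Hz.
  pose proof (kernel_remainder r z Hz (fun t => f (circle r t)) N) as H. cbv beta in H.
  rewrite <- (cauchy_formula r z Hz f (proj1 Hf) (proj2 Hf)) in H. apply H.
  intros t. apply ccont_circle_comp, regular_ccont, Hf.
Qed.

(** Once the lower coefficients vanish, the polynomial of length [S n] is [a n z^n], yet it is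
    [O(|z|^(n + 1))]; dividing by [|z|^n] and letting [z] tend to 0 gives [a n = 0]. *)
Lemma power_series_zero (a : nat -> C) (K : nat -> R) (rho : R) : 0 < rho ->
  (forall N z, Cmod z < rho -> Cmod (tpoly a N z) <= K N * Cmod z ^ N) -> forall n, a n = 0.
Proof.
  intros Hrho H. apply (well_founded_induction lt_wf). intros n IH.
  assert (Hx : forall x, 0 < x < rho -> Cmod (a n) <= K (S n) * x).
  { intros x Hx. specialize (H (S n) (RtoC x)).
    rewrite Cmod_R, Rabs_pos_eq in H by lra. specialize (H ltac:(lra)).
    unfold tpoly in H. rewrite (fsum_remove _ n) in H by lia. rewrite fsum_zero in H.
    - unfold fadd, fscal, fzero, monomial in H.
      rewrite Cplus_0_r, Cmod_mult, Cmod_pow, Cmod_R, Rabs_pos_eq in H by lra.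
      assert (0 < x ^ n) by (apply pow_lt; lra).
      apply Rmult_le_reg_r with (x ^ n); auto. simpl in H. lra.
    - intros k Hk. destruct Nat.eq_dec; auto. rewrite IH by lia. fun_ring. }
  apply Cmod_eq_0. apply Rle_antisym; [|apply Cmod_ge_0].
  apply le_epsilon. intros eps He. rewrite Rplus_0_l.
  assert (HK : 0 < Rabs (K (S n)) + 1) by (pose proof (Rabs_pos (K (S n))); lra).
  set (x := Rmin (rho / 2) (eps / (Rabs (K (S n)) + 1))).
  assert (X1 : 0 < x) by (apply Rmin_glb_lt; [lra|apply Rdiv_lt_0_compat; auto]).
  assert (X2 : x < rho) by (apply Rle_lt_trans with (rho / 2); [apply Rmin_l|lra]).
  eapply Rle_trans. apply (Hx x); auto.
  apply Rle_trans with ((Rabs (K (S n)) + 1) * (eps / (Rabs (K (S n)) + 1))).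
  - apply Rle_trans with ((Rabs (K (S n)) + 1) * x).
    + apply Rmult_le_compat_r; [lra|]. pose proof (Rle_abs (K (S n))). lra.
    + apply Rmult_le_compat_l; [lra|]. apply Rmin_r.
  - right. field. lra.
Qed.

Lemma tpoly_sub (a b : nat -> C) (N : nat) (z : C) :
  tpoly (fun n => a n - b n)%C N z = (tpoly a N z - tpoly b N z)%C.
Proof.
  unfold tpoly. induction N; simpl; unfold fzero; try ring.
  unfold fadd. rewrite IHN. unfold fscal. ring.
Qed.

(** Near 0 both Taylor polynomials of length [N] differ from [f] by [O(|z|^N)], so the differences
    of the coefficients vanish. Independence of the radius lets one polynomial be compared with [f]
    on every circle through Cauchy's formula on that circle. *)
Lemma tcoef_radius (f : C -> C) (r s : R) (n : nat) : regular f -> 0 < r -> 0 < s ->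
  tcoef f r n = tcoef f s n.
Proof.
  intros Hf Hr Hs.
  assert (H : forall n, (fun n => tcoef f r n - tcoef f s n)%C n = 0).
  (* Below half of the smaller radius the kernel factor [x / (x - |z|)] is at most 2. *)
  { apply power_series_zero with (fun N => (/ r) ^ N * 2 * M1 f r + (/ s) ^ N * 2 * M1 f s) (Rmin r s / 2).
    { assert (0 < Rmin r s) by (apply Rmin_glb_lt; auto). lra. }
    intros N z Hz. rewrite tpoly_sub.
    pose proof (Rmin_l r s). pose proof (Rmin_r r s). pose proof (Cmod_ge_0 z).
    assert (T : forall x, 0 < x -> Cmod z < x / 2 ->
      Cmod (f z - tpoly (tcoef f x) N z) <= (/ x) ^ N * 2 * M1 f x * Cmod z ^ N).
    { intros x Hx Hzx. eapply Rle_trans. apply taylor_remainder; auto. lra.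
      unfold Rdiv at 1. rewrite Rpow_mult_distr.
      pose proof (M1_ge_0 f x (regular_ccont f Hf)).
      replace ((/ x) ^ N * 2 * M1 f x * Cmod z ^ N) with (Cmod z ^ N * (/ x) ^ N * 2 * M1 f x) by ring.
      apply Rmult_le_compat_r; auto. apply Rmult_le_compat_l.
      - apply Rmult_le_pos; apply pow_le; auto. left; apply Rinv_0_lt_compat; auto.
      - apply Rle_div_l; lra. }
    replace (tpoly (tcoef f r) N z - tpoly (tcoef f s) N z)%C with
      ((f z - tpoly (tcoef f s) N z) - (f z - tpoly (tcoef f r) N z))%C by ring.
    pose proof (T r Hr ltac:(lra)). pose proof (T s Hs ltac:(lra)).
    eapply Rle_trans. apply Cmod_triangle. rewrite Cmod_opp. lra. }
  specialize (H n). cbv beta in H.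
  replace (tcoef f r n) with (tcoef f r n - tcoef f s n + tcoef f s n)%C by ring. rewrite H. ring.
Qed.

(** * The means [Mp] *)

(** What makes the integrals and suprema in [Mp] genuine. It covers functions not yet known to be
    [regular]: dilations, and the limit of a series before it is placed in the space. *)
Record tame (f : C -> C) : Prop := {
  tame_ccont : forall z : C, ccont (U := C_UniformSpace) f z;
  tame_bounded : forall s, exists M, 0 <= M /\ forall z, Cmod z <= s -> Cmod (f z) <= M
}.

Lemma regular_tame (f : C -> C) : regular f -> tame f.
Proof.
  intros Hf. split. apply regular_ccont, Hf.
  intros s. set (s' := Rabs s). assert (Hs : 0 <= s') by apply Rabs_pos.
  pose proof (M1_ge_0 f (s' + 1) (regular_ccont f Hf)) as HM.
  exists ((s' + 1) / (s' + 1 - s') * M1 f (s' + 1)). split.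
  - apply Rmult_le_pos; auto. left. apply Rdiv_lt_0_compat; lra.
  - intros z Hz. apply regular_bound; auto; [|lra]. pose proof (Rle_abs s). fold s' in H. lra.
Qed.

Lemma tame_add (f g : C -> C) : tame f -> tame g -> tame (fadd f g).
Proof.
  intros [F1 F2] [G1 G2]. split.
  - intros z. apply ccont_add; auto.
  - intros s. destruct (F2 s) as [M [HM H]], (G2 s) as [N [HN H']].
    exists (M + N). split; [lra|]. intros z Hz. eapply Rle_trans. apply Cmod_triangle.
    specialize (H z Hz). specialize (H' z Hz). lra.
Qed.

Lemma tame_scal (c : C) (f : C -> C) : tame f -> tame (fscal c f).
Proof.
  intros [F1 F2]. split.
  - intros z. apply ccont_mult; auto. apply ccont_const.
  - intros s. destruct (F2 s) as [M [HM H]].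
    exists (Cmod c * M). split. apply Rmult_le_pos; auto; apply Cmod_ge_0.
    intros z Hz. unfold fscal. rewrite Cmod_mult. apply Rmult_le_compat_l; auto. apply Cmod_ge_0.
Qed.

Lemma tame_zero : tame fzero.
Proof.
  split. intros z; apply ccont_const.
  intros s. exists 0. split; [lra|]. intros z _. unfold fzero. rewrite Cmod_0. lra.
Qed.

Lemma tame_sub (f g : C -> C) : tame f -> tame g -> tame (fsub f g).
Proof. intros Hf Hg. rewrite fsub_eq. apply tame_add; auto. apply tame_scal; auto. Qed.

Definition dilate (rho : R) (f : C -> C) : C -> C := fun z => f (RtoC rho * z)%C.

Lemma tame_dilate (rho : R) (f : C -> C) : 0 < rho -> tame f -> tame (dilate rho f).
Proof.
  intros Hr [F1 F2]. split.
  - intros z. apply (ccont_comp f (fun z : C_UniformSpace => (RtoC rho * z)%C)); auto.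
    apply ccont_mult. apply ccont_const. apply ccont_id.
  - intros s. destruct (F2 (rho * s)) as [M [HM H]]. exists M. split; auto.
    intros z Hz. apply H. rewrite Cmod_mult, Cmod_R, Rabs_pos_eq by lra.
    apply Rmult_le_compat_l; lra.
Qed.

Lemma circle_pair (r t : R) : circle r t = (r * cos t, r * sin t).
Proof. unfold circle, cis, RtoC, Cmult. simpl. f_equal; ring. Qed.

Lemma Cmod_circle (r t : R) : 0 <= r -> Cmod (circle r t) = r.
Proof. intros H. unfold circle. rewrite Cmod_mult, Cmod_cis, Cmod_R, Rabs_pos_eq by auto. ring. Qed.

Section IntegralMeans.
Variable p : Rbar.
Hypothesis hp : Rbar_le (Finite 1) p.

Lemma Mp_lp (q : R) (f : C -> C) (r : R) :
  Mp (Finite q) f r = lp_mean q (fun t => Cmod (f (circle r t))).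
Proof.
  unfold Mp, lp_mean. f_equal. apply mean_ext. intros t. rewrite circle_pair. auto.
Qed.

Lemma circle_cont (f : C -> C) (r : R) : tame f -> forall t : R, continuous (fun t => Cmod (f (circle r t))) t.
Proof. intros H t. apply continuous_Cmod. apply ccont_circle_comp, tame_ccont, H. Qed.

Lemma sup_bound (f : C -> C) (r : R) : tame f ->
  exists M, forall y, (exists z : C, Cmod z = r /\ y = Cmod (f z)) -> y <= M.
Proof.
  intros H. destruct (tame_bounded f H r) as [M [_ HM]]. exists M. intros y [z [Hz ->]].
  apply HM. lra.
Qed.

Lemma sup_inhabited (f : C -> C) (r : R) : 0 < r ->
  exists z : C, Cmod z = r /\ Cmod (f (RtoC r)) = Cmod (f z).
Proof. intros Hr. exists (RtoC r). split; auto. rewrite Cmod_R, Rabs_pos_eq; lra. Qed.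

Lemma Mp_ge_0 (f : C -> C) (r : R) : tame f -> 0 < r -> 0 <= Mp p f r.
Proof.
  intros Hf Hr. destruct p as [q| |]; [| |contradiction].
  - rewrite Mp_lp. apply lp_mean_ge_0.
  - simpl. destruct (sup_bound f r Hf) as [M HM].
    eapply Rle_trans; [apply Cmod_ge_0|]. eapply le_Lub; [|apply HM]. apply sup_inhabited; auto.
Qed.

Lemma Mp_bound (f : C -> C) (r M : R) : tame f -> 0 < r -> 0 <= M ->
  (forall z, Cmod z = r -> Cmod (f z) <= M) -> Mp p f r <= M.
Proof.
  intros Hf Hr HM H. destruct p as [q| |]; [| |contradiction].
  - simpl in hp. rewrite Mp_lp, <- (lp_mean_const q hp M) by auto. apply lp_mean_le; auto.
    apply circle_cont; auto. intros; apply continuous_const.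
    intros t. split. apply Cmod_ge_0. apply H. apply Cmod_circle; lra.
  - simpl. apply Lub_le with (Cmod (f (RtoC r))). apply sup_inhabited; auto.
    intros y [z [Hz ->]]. auto.
Qed.

Lemma Mp_add (f g : C -> C) (r : R) : tame f -> tame g -> 0 < r ->
  Mp p (fadd f g) r <= Mp p f r + Mp p g r.
Proof.
  intros Hf Hg Hr. pose proof (tame_add f g Hf Hg) as Hfg.
  destruct p as [q| |]; [| |contradiction].
  - rewrite !Mp_lp. simpl in hp. eapply Rle_trans; [|apply lp_mean_triangle; auto].
    + apply lp_mean_le; auto. apply circle_cont; auto.
      * intros t. apply (continuous_plus (V := R_NormedModule)); apply circle_cont; auto.
      * intros t. split. apply Cmod_ge_0. apply Cmod_triangle.
    + apply circle_cont; auto.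
    + apply circle_cont; auto.
    + intros; apply Cmod_ge_0.
    + intros; apply Cmod_ge_0.
  - simpl. apply Lub_le with (Cmod (fadd f g (RtoC r))). apply (sup_inhabited (fadd f g)); auto.
    intros y [z [Hz ->]]. destruct (sup_bound f r Hf) as [M HM], (sup_bound g r Hg) as [N HN].
    eapply Rle_trans; [apply Cmod_triangle|].
    apply Rplus_le_compat; (eapply le_Lub; [exists z; eauto|eauto]).
Qed.

Lemma Mp_scal (c : C) (f : C -> C) (r : R) : tame f -> 0 < r ->
  Mp p (fscal c f) r <= Cmod c * Mp p f r.
Proof.
  intros Hf Hr. destruct p as [q| |]; [| |contradiction].
  - rewrite !Mp_lp. simpl in hp. right. rewrite <- lp_mean_scal; auto.
    + f_equal. apply functional_extensionality. intros t. apply Cmod_mult.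
    + apply Cmod_ge_0.
    + apply circle_cont; auto.
    + intros; apply Cmod_ge_0.
  - simpl. apply Lub_le with (Cmod (fscal c f (RtoC r))). apply (sup_inhabited (fscal c f)); auto.
    intros y [z [Hz ->]]. destruct (sup_bound f r Hf) as [M HM].
    unfold fscal. rewrite Cmod_mult. apply Rmult_le_compat_l; [apply Cmod_ge_0|].
    eapply le_Lub; [exists z; eauto|eauto].
Qed.

Lemma M1_le_Mp (f : C -> C) (r : R) : tame f -> 0 < r -> M1 f r <= Mp p f r.
Proof.
  intros Hf Hr. destruct p as [q| |]; [| |contradiction].
  - rewrite Mp_lp. simpl in hp. apply mean_le_lp_mean; auto. apply circle_cont; auto.
    intros; apply Cmod_ge_0.
  - simpl. destruct (sup_bound f r Hf) as [M HM]. apply mean_le_const. apply circle_cont; auto.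
    intros t. eapply le_Lub; [|apply HM]. exists (circle r t). split; auto. apply Cmod_circle; lra.
Qed.

Lemma Mp_dilate (rho : R) (f : C -> C) (r : R) : tame f -> 0 < rho -> 0 < r ->
  Mp p (dilate rho f) r <= Mp p f (rho * r).
Proof.
  intros Hf Hrho Hr. destruct p as [q| |]; [| |contradiction].
  - rewrite !Mp_lp. right. f_equal. apply functional_extensionality. intros t.
    unfold dilate, circle. rewrite RtoC_mult. do 2 f_equal. ring.
  - simpl. apply Lub_le with (Cmod (dilate rho f (RtoC r))). apply (sup_inhabited (dilate rho f)); auto.
    intros y [z [Hz ->]]. destruct (sup_bound f (rho * r) Hf) as [M HM].
    eapply le_Lub; [|apply HM]. exists (RtoC rho * z)%C. split; auto.
    rewrite Cmod_mult, Cmod_R, Rabs_pos_eq, Hz; lra.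
Qed.

End IntegralMeans.

(** * The Banach space [Bp0 p v] *)

Lemma real_series_limit (u : nat -> R) (M : R) : (forall k, Rabs (u k) <= M * (1 / 2) ^ k) ->
  exists l, forall K, Rabs (l - rsum u K) <= 2 * M * (1 / 2) ^ K.
Proof.
  intros H.
  assert (HM : 0 <= M). { specialize (H O). pose proof (Rabs_pos (u O)). simpl in H. lra. }
  assert (T : forall K n, Rabs (rsum u (K + n) - rsum u K) <= 2 * M * (1 / 2) ^ K - 2 * M * (1 / 2) ^ (K + n)).
  { intros K n. induction n.
    - rewrite Nat.add_0_r, !Rminus_diag, Rabs_R0. lra.
    - rewrite Nat.add_succ_r. simpl.
      replace (rsum u (K + n) + u (K + n)%nat - rsum u K) with
        ((rsum u (K + n) - rsum u K) + u (K + n)%nat) by ring.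
      eapply Rle_trans. apply Rabs_triang. specialize (H (K + n)%nat). lra. }
  assert (T' : forall K n, (K <= n)%nat -> Rabs (rsum u n - rsum u K) <= 2 * M * (1 / 2) ^ K).
  { intros K n Hn. specialize (T K (n - K)%nat). replace (K + (n - K))%nat with n in T by lia.
    assert (0 <= 2 * M * (1 / 2) ^ n) by (apply Rmult_le_pos; [lra|apply pow_le; lra]). lra. }
  destruct (Rcomplete.R_complete (rsum u)) as [l Hl].
  - intros eps He. destruct (pow_half_small (eps / (4 * (M + 1)))) as [N HN].
    { apply Rdiv_lt_0_compat; lra. }
    exists N. intros n m Hn Hm. unfold Rdist.
    pose proof (T' N n Hn). pose proof (T' N m Hm). specialize (HN N (le_n _)).
    replace (rsum u n - rsum u m) with ((rsum u n - rsum u N) + - (rsum u m - rsum u N)) by ring.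
    eapply Rle_lt_trans. apply Rabs_triang. rewrite Rabs_Ropp.
    assert (4 * M * (1 / 2) ^ N < eps); [|lra].
    apply Rle_lt_trans with (4 * (M + 1) * (1 / 2) ^ N).
    + pose proof (pow_half_bounds N). nra.
    + apply Rlt_div_r in HN; lra.
  - exists l. intros K. apply le_epsilon. intros eps He. destruct (Hl eps He) as [N HN].
    specialize (HN (N + K)%nat ltac:(lia)). unfold Rdist in HN.
    specialize (T' K (N + K)%nat ltac:(lia)).
    replace (l - rsum u K) with (- (rsum u (N + K) - l) + (rsum u (N + K) - rsum u K)) by ring.
    eapply Rle_trans. apply Rabs_triang. rewrite Rabs_Ropp. lra.
Qed.

Fixpoint csum (c : nat -> C) (n : nat) : C :=
  match n with O => RtoC 0 | S m => (csum c m + c m)%C end.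

Lemma fsum_csum (g : nat -> C -> C) (n : nat) (z : C) : fsum g n z = csum (fun k => g k z) n.
Proof. induction n; simpl; auto. unfold fadd. rewrite IHn. auto. Qed.

Lemma csum_sub (b c : nat -> C) (n : nat) : csum (fun k => b k - c k)%C n = (csum b n - csum c n)%C.
Proof. induction n; simpl. ring. rewrite IHn. ring. Qed.

Lemma csum_mult_r (b : nat -> C) (c : C) (n : nat) : csum (fun k => b k * c)%C n = (csum b n * c)%C.
Proof. induction n; simpl. ring. rewrite IHn. ring. Qed.

Lemma csum_parts (c : nat -> C) (n : nat) :
  csum c n = (rsum (fun k => Re (c k)) n, rsum (fun k => Im (c k)) n).
Proof. induction n; simpl. reflexivity. rewrite IHn. reflexivity. Qed.

Lemma series_limit (c : nat -> C) (M : R) : (forall k, Cmod (c k) <= M * (1 / 2) ^ k) ->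
  exists l, forall K, Cmod (l - csum c K) <= 4 * M * (1 / 2) ^ K.
Proof.
  intros H.
  destruct (real_series_limit (fun k => Re (c k)) M) as [a Ha].
  { intros k. eapply Rle_trans. apply re_le_Cmod. auto. }
  destruct (real_series_limit (fun k => Im (c k)) M) as [b Hb].
  { intros k. eapply Rle_trans. apply im_le_Cmod. auto. }
  exists (a, b). intros K. eapply Rle_trans. apply Cmod_le_Rabs. rewrite csum_parts.
  specialize (Ha K). specialize (Hb K).
  change (Rabs (a - rsum (fun k => Re (c k)) K) + Rabs (b - rsum (fun k => Im (c k)) K)
    <= 4 * M * (1 / 2) ^ K). lra.
Qed.

Lemma csum_bound (c : nat -> C) (M : R) (n : nat) : (forall k, Cmod (c k) <= M * (1 / 2) ^ k) ->
  Cmod (csum c n) <= 2 * M.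
Proof.
  intros H.
  assert (HM : 0 <= M). { specialize (H O). pose proof (Cmod_ge_0 (c O)). simpl in H. lra. }
  assert (T : Cmod (csum c n) <= 2 * M - 2 * M * (1 / 2) ^ n).
  { induction n; simpl. rewrite Cmod_0. lra.
    eapply Rle_trans. apply Cmod_triangle. specialize (H n). lra. }
  assert (0 <= 2 * M * (1 / 2) ^ n) by (apply Rmult_le_pos; [lra|apply pow_le; lra]). lra.
Qed.

Section Space.
Variables (p : Rbar) (v : C -> R).
Hypothesis hp : Rbar_le (Finite 1) p.
Hypothesis hv : weight v.

Local Notation wM f r := (v (RtoC r) * Mp p f r).

Lemma weight_gt_0 (r : R) : 0 < v (RtoC r).
Proof. apply (weight_pos v hv). Qed.

Lemma wM_ge_0 (f : C -> C) (r : R) : tame f -> 0 < r -> 0 <= wM f r.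
Proof. intros Hf Hr. apply Rmult_le_pos. left; apply weight_gt_0. apply Mp_ge_0; auto. Qed.

Lemma wM_add (f g : C -> C) (r : R) : tame f -> tame g -> 0 < r ->
  wM (fadd f g) r <= wM f r + wM g r.
Proof.
  intros Hf Hg Hr. rewrite <- Rmult_plus_distr_l. apply Rmult_le_compat_l.
  left; apply weight_gt_0. apply Mp_add; auto.
Qed.

Lemma wM_scal (c : C) (f : C -> C) (r : R) : tame f -> 0 < r ->
  wM (fscal c f) r <= Cmod c * wM f r.
Proof.
  intros Hf Hr. replace (Cmod c * wM f r) with (v (RtoC r) * (Cmod c * Mp p f r)) by ring.
  apply Rmult_le_compat_l. left; apply weight_gt_0. apply Mp_scal; auto.
Qed.

Lemma wM_bound (f : C -> C) (r M : R) : tame f -> 0 < r -> 0 <= M ->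
  (forall z, Cmod z = r -> Cmod (f z) <= M) -> wM f r <= v (RtoC 0) * M.
Proof.
  intros Hf Hr HM H. apply Rmult_le_compat. left; apply weight_gt_0. apply Mp_ge_0; auto.
  apply (weight_nonincreasing v hv); lra. apply Mp_bound; auto.
Qed.

Definition vanishing (f : C -> C) : Prop :=
  forall eps, 0 < eps -> exists R0, 0 < R0 /\ forall r, R0 <= r -> wM f r <= eps.

Lemma Bp0_vanishing (f : C -> C) : Bp0 p v f -> vanishing f.
Proof.
  intros [_ H] eps He. apply is_lim_spec in H. destruct (H (mkposreal eps He)) as [M HM].
  exists (Rmax M 0 + 1). pose proof (Rmax_l M 0). pose proof (Rmax_r M 0). split; [lra|].
  intros r Hr. assert (Hr' : M < r) by lra. specialize (HM r Hr'). simpl in HM.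
  rewrite Rminus_0_r in HM. pose proof (Rle_abs (wM f r)). lra.
Qed.

Lemma vanishing_Bp0 (f : C -> C) : entire f -> tame f -> vanishing f -> Bp0 p v f.
Proof.
  intros He Hf H. split; auto. apply is_lim_spec. intros eps.
  assert (He2 : 0 < eps / 2) by (destruct eps; simpl; lra).
  destruct (H _ He2) as [R0 [HR0 HR]]. exists R0. intros r Hr.
  rewrite Rminus_0_r, Rabs_pos_eq by (apply wM_ge_0; auto; lra).
  specialize (HR r ltac:(lra)). lra.
Qed.

Hypothesis hD : well_defined (Bp0 p v) C_derive.

Lemma Bp0_regular (f : C -> C) : Bp0 p v f -> regular f.
Proof. intros H. split. apply H. apply (hD f H). Qed.

Lemma Bp0_tame (f : C -> C) : Bp0 p v f -> tame f.
Proof. intros H. apply regular_tame, Bp0_regular, H. Qed.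

Lemma Bp0_bounded (f : C -> C) : Bp0 p v f -> exists M, forall r, 0 < r -> wM f r <= M.
Proof.
  intros Hf. destruct (Bp0_vanishing f Hf 1 Rlt_0_1) as [R0 [HR0 H]].
  pose proof (Bp0_tame f Hf) as Ht.
  destruct (tame_bounded f Ht R0) as [M [HM HM']].
  assert (0 <= v (RtoC 0) * M) by (apply Rmult_le_pos; auto; left; apply weight_gt_0).
  exists (1 + v (RtoC 0) * M). intros r Hr. destruct (Rle_dec R0 r) as [h|h].
  - specialize (H r h). lra.
  - eapply Rle_trans. apply wM_bound with (M := M); auto. intros z Hz. apply HM'. lra. lra.
Qed.

Lemma le_norm (f : C -> C) (r : R) : Bp0 p v f -> 0 < r -> wM f r <= norm_pv p v f.
Proof.
  intros Hf Hr. destruct (Bp0_bounded f Hf) as [M HM].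
  apply le_Lub with M. exists r; auto. intros y [s [Hs ->]]. auto.
Qed.

Lemma norm_le (f : C -> C) (A : R) : (forall r, 0 < r -> wM f r <= A) -> norm_pv p v f <= A.
Proof.
  intros H. apply Lub_le with (wM f 1). exists 1; split; auto; lra.
  intros y [s [Hs ->]]. auto.
Qed.

Lemma Bp0_add (f g : C -> C) : Bp0 p v f -> Bp0 p v g -> Bp0 p v (fadd f g).
Proof.
  intros Hf Hg. pose proof (Bp0_tame f Hf). pose proof (Bp0_tame g Hg).
  apply vanishing_Bp0.
  - apply cderiv_entire with (fadd (C_derive f) (C_derive g)). intros z.
    apply has_cderiv_add; apply entire_cderiv; [apply Hf|apply Hg].
  - apply tame_add; auto.
  - intros eps He. destruct (Bp0_vanishing f Hf (eps / 2)) as [R1 [H1 H1']]; [lra|].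
    destruct (Bp0_vanishing g Hg (eps / 2)) as [R2 [H2 H2']]; [lra|].
    exists (Rmax R1 R2). pose proof (Rmax_l R1 R2). pose proof (Rmax_r R1 R2). split; [lra|].
    intros r Hr. eapply Rle_trans. apply wM_add; auto. lra.
    specialize (H1' r ltac:(lra)). specialize (H2' r ltac:(lra)). lra.
Qed.

Lemma Bp0_scal (c : C) (f : C -> C) : Bp0 p v f -> Bp0 p v (fscal c f).
Proof.
  intros Hf. pose proof (Bp0_tame f Hf). pose proof (Cmod_ge_0 c).
  apply vanishing_Bp0.
  - apply cderiv_entire with (fscal c (C_derive f)). intros z.
    apply has_cderiv_scal; apply entire_cderiv, Hf.
  - apply tame_scal; auto.
  - intros eps He. destruct (Bp0_vanishing f Hf (eps / (Cmod c + 1))) as [R1 [H1 H1']].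
    { apply Rdiv_lt_0_compat; lra. }
    exists R1. split; auto. intros r Hr. eapply Rle_trans. apply wM_scal; auto. lra.
    specialize (H1' r Hr). pose proof (wM_ge_0 f r ltac:(auto) ltac:(lra)).
    apply Rle_trans with ((Cmod c + 1) * (eps / (Cmod c + 1))).
    + apply Rmult_le_compat; lra.
    + right; field; lra.
Qed.

Lemma Bp0_zero : Bp0 p v fzero.
Proof.
  apply vanishing_Bp0.
  - apply cderiv_entire with fzero. intros z. apply has_cderiv_const.
  - apply tame_zero.
  - intros eps He. exists 1. split; [lra|]. intros r Hr. eapply Rle_trans.
    apply wM_bound with (M := 0); try lra. apply tame_zero.
    intros z _. unfold fzero. rewrite Cmod_0. lra. lra.
Qed.

Lemma Bp0_normed_space : normed_space (Bp0 p v) (norm_pv p v).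
Proof.
  split.
  - apply Bp0_zero.
  - apply Bp0_add.
  - apply Bp0_scal.
  - intros f Hf. apply Rle_trans with (wM f 1).
    apply wM_ge_0; [apply Bp0_tame; auto|lra]. apply le_norm; auto; lra.
  - intros f g Hf Hg. apply norm_le. intros r Hr. eapply Rle_trans.
    apply wM_add; auto; apply Bp0_tame; auto. apply Rplus_le_compat; apply le_norm; auto.
  - intros c f Hf. apply norm_le. intros r Hr. eapply Rle_trans.
    apply wM_scal; auto; apply Bp0_tame; auto.
    apply Rmult_le_compat_l. apply Cmod_ge_0. apply le_norm; auto.
Qed.

Lemma derive_linear : linear_on (Bp0 p v) C_derive.
Proof.
  split; auto.
  - intros f g Hf Hg. apply cderiv_unique. intros z.
    apply has_cderiv_add; apply entire_cderiv; [apply Hf|apply Hg].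
  - intros c f Hf. apply cderiv_unique. intros z. apply has_cderiv_scal, entire_cderiv, Hf.
Qed.

Lemma M1_le_norm (f : C -> C) (r : R) : Bp0 p v f -> 0 < r -> M1 f r <= norm_pv p v f / v (RtoC r).
Proof.
  intros Hf Hr. pose proof (weight_gt_0 r) as Hv.
  apply (proj1 (Rle_div_r (M1 f r) (norm_pv p v f) (v (RtoC r)) Hv)).
  eapply Rle_trans; [|apply (le_norm f r); auto]. rewrite Rmult_comm.
  apply Rmult_le_compat_l. lra. apply M1_le_Mp; auto. apply Bp0_tame; auto.
Qed.

(** The norms bound [M1] on the circle of radius [2 s], hence the terms uniformly on the disc of
    radius [s]; this gives a pointwise limit [f]. Summing the first-order expansions of the terms
    makes [f] differentiable, and the norm estimate is obtained on each circle separately before the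
    supremum is taken. *)
Lemma Bp0_complete : series_complete (Bp0 p v) (norm_pv p v).
Proof.
  intros g Bg Ng. pose proof Bp0_normed_space as HB.
  assert (HM1 : forall r k, 0 < r -> M1 (g k) r <= / v (RtoC r) * (1 / 2) ^ k).
  { intros r k Hr. eapply Rle_trans. apply M1_le_norm; auto. unfold Rdiv at 1. rewrite Rmult_comm.
    apply Rmult_le_compat_l; auto. left. apply Rinv_0_lt_compat, weight_gt_0. }
  (* The 2 is the kernel bound [2 s / (2 s - s)], and [/ v (RtoC (2 * s))] converts a norm into a
     bound for [M1]. *)
  set (A := fun s => 2 * / v (RtoC (2 * s))).
  assert (HA : forall s, 0 < A s).
  { intros s. unfold A. pose proof (weight_gt_0 (2 * s)). apply Rmult_lt_0_compat; [lra|].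
    apply Rinv_0_lt_compat; auto. }
  assert (Hpt : forall s z k, 0 < s -> Cmod z <= s -> Cmod (g k z) <= A s * (1 / 2) ^ k).
  { intros s z k Hs Hz. eapply Rle_trans. apply (regular_bound (g k) (2 * s) s); auto.
    apply Bp0_regular; auto. lra.
    replace (2 * s / (2 * s - s)) with 2 by (field; lra). unfold A. rewrite Rmult_assoc.
    apply Rmult_le_compat_l; [lra|]. apply HM1. lra. }
  (* The limit has to satisfy the estimate for every admissible radius [s], and not only for the one
     that defines it; uniqueness of limits identifies the candidates. *)
  assert (Hlim : forall z, exists l, forall s, 0 < s -> Cmod z <= s ->
    forall K, Cmod (l - fsum g K z) <= 4 * A s * (1 / 2) ^ K).
  { intros z.
    destruct (series_limit (fun k => g k z) (A (Cmod z + 1))) as [l Hl].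
    { intros k. apply Hpt. pose proof (Cmod_ge_0 z); lra. lra. }
    exists l. intros s Hs Hz K.
    destruct (series_limit (fun k => g k z) (A s)) as [l' Hl'].
    { intros k. apply Hpt; auto. }
    assert (E : l = l').
    { apply Ceq_minus. apply Cmod_eq_0. apply Rle_antisym; [|apply Cmod_ge_0].
      apply le_epsilon. intros eps He. rewrite Rplus_0_l.
      set (W := 4 * A (Cmod z + 1) + 4 * A s).
      assert (HW : 0 < W) by (unfold W; pose proof (HA s); pose proof (HA (Cmod z + 1)); lra).
      destruct (pow_half_small (eps / W)) as [N HN]. apply Rdiv_lt_0_compat; auto.
      specialize (HN N (le_n _)). specialize (Hl N). specialize (Hl' N).
      replace (l - l')%C with ((l - csum (fun k => g k z) N) - (l' - csum (fun k => g k z) N))%C by ring.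
      eapply Rle_trans. apply Cmod_triangle. rewrite Cmod_opp.
      apply Rlt_div_r in HN; auto. unfold W in HN. lra. }
    rewrite fsum_csum, E. apply Hl'. }
  apply functional_choice in Hlim. destruct Hlim as [f Hf].
  assert (Ef : entire f).
  { intros z. set (s := Cmod z + 1). assert (Hs : 0 < s) by (unfold s; pose proof (Cmod_ge_0 z); lra).
    (* First-order coefficients of the terms at [z]; their sum [l] will be the derivative of [f]. *)
    assert (Hd : forall k, exists d,
      Cmod d <= (2 * s / (2 * s - s) ^ 2 * / v (RtoC (2 * s))) * (1 / 2) ^ k /\
      forall w, Cmod w <= s -> Cmod (g k w - g k z - d * (w - z)) <=
       (2 * s / (2 * s - s) ^ 3 * / v (RtoC (2 * s)) * Cmod (w - z) ^ 2) * (1 / 2) ^ k).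
    { intros k. destruct (cauchy_first_order (g k) (2 * s) s z) as [d [Hd1 Hd2]].
      apply Bp0_regular; auto. unfold s; lra. lra.
      pose proof (HM1 (2 * s) k ltac:(lra)) as Hm.
      exists d. split.
      - eapply Rle_trans; [apply Hd1|]. rewrite Rmult_assoc. apply Rmult_le_compat_l; auto.
        left; apply Rdiv_lt_0_compat; [lra|]. apply pow_lt; lra.
      - intros w Hw. eapply Rle_trans; [apply Hd2; auto|].
        replace (2 * s / (2 * s - s) ^ 3 * / v (RtoC (2 * s)) * Cmod (w - z) ^ 2 * (1 / 2) ^ k) with
         (2 * s / (2 * s - s) ^ 3 * Cmod (w - z) ^ 2 * (/ v (RtoC (2 * s)) * (1 / 2) ^ k)) by ring.
        apply Rmult_le_compat_l; auto. apply Rmult_le_pos.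
        left; apply Rdiv_lt_0_compat; [lra|]. apply pow_lt; lra. apply pow_le, Cmod_ge_0. }
    apply functional_choice in Hd. destruct Hd as [d Hd].
    destruct (series_limit d _ (fun k => proj1 (Hd k))) as [l Hl].
    set (Q := 2 * s / (2 * s - s) ^ 3 * / v (RtoC (2 * s))) in *.
    assert (HQ : 0 < Q).
    { unfold Q. apply Rmult_lt_0_compat. apply Rdiv_lt_0_compat; [lra|]. apply pow_lt; lra.
      apply Rinv_0_lt_compat, weight_gt_0. }
    (* The quadratic error survives the limit: a long partial sum replaces [f] and [l] up to
       [eps]. *)
    assert (H2 : forall w, Cmod w <= s -> Cmod (f w - f z - l * (w - z)) <= 2 * Q * Cmod (w - z) ^ 2).
    { intros w Hw. apply le_epsilon. intros eps He.
      set (D := 2 * s / (2 * s - s) ^ 2 * / v (RtoC (2 * s))) in *.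
      assert (HDp : 0 < D).
      { unfold D. apply Rmult_lt_0_compat. apply Rdiv_lt_0_compat; [lra|]. apply pow_lt; lra.
        apply Rinv_0_lt_compat, weight_gt_0. }
      pose proof (Cmod_ge_0 (w - z)) as Hwz.
      set (W := 8 * A s + 4 * D * Cmod (w - z)).
      assert (HW : 0 < W) by (unfold W; pose proof (HA s); nra).
      destruct (pow_half_small (eps / W)) as [N HN]. apply Rdiv_lt_0_compat; auto.
      specialize (HN N (le_n _)). apply Rlt_div_r in HN; auto.
      pose proof (Hf w s Hs Hw N) as Fw.
      pose proof (Hf z s Hs ltac:(unfold s; lra) N) as Fz. specialize (Hl N).
      pose proof (csum_bound (fun k => g k w - g k z - d k * (w - z))%C (Q * Cmod (w - z) ^ 2) N
        (fun k => proj2 (Hd k) w Hw)) as Hc.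
      rewrite !csum_sub, csum_mult_r, <- !fsum_csum in Hc.
      replace (f w - f z - l * (w - z))%C with
        ((fsum g N w - fsum g N z - csum d N * (w - z)) + (f w - fsum g N w)
          + - (f z - fsum g N z) + - ((l - csum d N) * (w - z)))%C by ring.
      eapply Rle_trans. apply Cmod_triangle. rewrite Cmod_opp, Cmod_mult.
      eapply Rle_trans. apply Rplus_le_compat_r, Cmod_triangle. rewrite Cmod_opp.
      eapply Rle_trans. apply Rplus_le_compat_r, Rplus_le_compat_r, Cmod_triangle.
      apply Rmult_le_compat_r with (r := Cmod (w - z)) in Hl; auto.
      unfold W in HN. lra. }
    exists l. apply has_cderiv_eps. intros eps He.
    exists (Rmin 1 (eps / (2 * Q))). split.
    { apply Rmin_glb_lt; [lra|]. apply Rdiv_lt_0_compat; lra. }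
    intros w Hw. assert (W1 : Cmod (w - z) < 1) by (eapply Rlt_le_trans; [exact Hw|apply Rmin_l]).
    assert (W2 : Cmod (w - z) < eps / (2 * Q)) by (eapply Rlt_le_trans; [exact Hw|apply Rmin_r]).
    eapply Rle_trans. apply H2.
    - pose proof (Cmod_triangle_rev w z). unfold s. lra.
    - apply Rlt_div_r in W2; [|lra]. pose proof (Cmod_ge_0 (w - z)). simpl. nra. }
  assert (Tf : tame f).
  { split. intros z. apply entire_ccont, Ef.
    intros s. set (s' := Rabs s + 1). assert (Hs : 0 < s') by (unfold s'; pose proof (Rabs_pos s); lra).
    exists (4 * A s'). split. pose proof (HA s'); lra.
    intros z Hz. assert (Hz' : Cmod z <= s') by (unfold s'; pose proof (Rle_abs s); lra).
    pose proof (Hf z s' Hs Hz' O) as H. simpl in H. unfold fzero in H.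
    replace (f z - 0)%C with (f z) in H by ring. lra. }
  assert (BS : forall K, Bp0 p v (fsum g K)) by (intros; apply ns_fsum with (norm_pv p v); auto).
  assert (TS : forall K, tame (fsub f (fsum g K))) by (intros; apply tame_sub; auto; apply Bp0_tame; auto).
  (* On a fixed circle a partial sum of length [L] is uniformly close to [f]. How large [L] must be
     depends on [r], but the terms from [K] to [L] are bounded by a geometric tail that does not. *)
  assert (HK : forall K r, 0 < r -> wM (fsub f (fsum g K)) r <= 2 * (1 / 2) ^ K).
  { intros K r Hr. apply le_epsilon. intros eps He.
    pose proof (weight_gt_0 0) as Hv0. pose proof (HA r) as HAr.
    destruct (pow_half_small (eps / (v (RtoC 0) * (4 * A r)))) as [N HN].
    { apply Rdiv_lt_0_compat; auto. apply Rmult_lt_0_compat; lra. }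
    set (L := (N + K)%nat). specialize (HN L ltac:(unfold L; lia)).
    apply Rlt_div_r in HN; [|apply Rmult_lt_0_compat; lra].
    set (h := fun k => if le_lt_dec K k then g k else fzero).
    assert (Bh : forall k, Bp0 p v (h k)).
    { intros k. unfold h. destruct le_lt_dec; auto. apply Bp0_zero. }
    assert (Hh : fsum g L = fadd (fsum g K) (fsum h L)).
    { assert (H : forall L, (K <= L)%nat -> fsum g L = fadd (fsum g K) (fsum h L)).
      { clear L HN. intros L HL. induction HL.
        - rewrite (fsum_zero h). fun_ring. intros k Hk. unfold h. destruct le_lt_dec; auto; lia.
        - simpl. rewrite IHHL. unfold h at 3. destruct le_lt_dec; [|lia]. fun_ring. }
      apply H. unfold L; lia. }
    replace (fsub f (fsum g K)) with (fadd (fsub f (fsum g L)) (fsum h L)) by (rewrite Hh; fun_ring).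
    assert (BhL : Bp0 p v (fsum h L)) by (apply ns_fsum with (norm_pv p v); auto).
    eapply Rle_trans. apply wM_add; auto. apply Bp0_tame; auto.
    assert (H1 : wM (fsub f (fsum g L)) r <= v (RtoC 0) * (4 * A r * (1 / 2) ^ L)).
    { apply wM_bound; auto. pose proof (pow_half_bounds L). nra.
      intros z Hz. apply (Hf z r Hr). lra. }
    assert (H2 : wM (fsum h L) r <= 2 * (1 / 2) ^ K).
    { eapply Rle_trans. apply le_norm; auto.
      eapply Rle_trans. apply (ns_norm_fsum _ _ HB); auto.
      eapply Rle_trans; [|apply (rsum_geom_tail K L)].
      apply rsum_le. intros k _. unfold h. destruct le_lt_dec; auto.
      rewrite (ns_norm_zero _ _ HB). lra. }
    lra. }
  assert (Bf : Bp0 p v f).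
  { apply vanishing_Bp0; auto. intros eps He.
    destruct (pow_half_small (eps / 4)) as [K HKe]; [lra|]. specialize (HKe K (le_n _)).
    destruct (Bp0_vanishing _ (BS K) (eps / 2)) as [R0 [HR0 HR]]; [lra|].
    exists R0. split; auto. intros r Hr.
    replace f with (fadd (fsub f (fsum g K)) (fsum g K)) by fun_ring.
    eapply Rle_trans. apply wM_add; auto. apply Bp0_tame; auto. lra.
    specialize (HR r Hr). specialize (HK K r ltac:(lra)). lra. }
  exists f. split; auto.
  apply is_lim_seq_spec. intros eps.
  destruct (pow_half_small (eps / 2)) as [N HN]. destruct eps; simpl; lra.
  exists N. intros K HKN. specialize (HN K HKN). rewrite Rminus_0_r, Rabs_pos_eq.
  - eapply Rle_lt_trans. apply norm_le. intros r Hr. apply HK; auto. lra.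
  - apply (ns_norm_ge_0 _ _ HB). apply (ns_sub _ _ HB); auto.
Qed.

End Space.

(** * The exponential function and density of polynomials *)

Lemma derive_monomial (n : nat) :
  C_derive (monomial n) = fscal (RtoC (INR n)) (monomial (pred n)).
Proof. apply cderiv_unique. intros z. apply has_cderiv_pow. Qed.

Lemma entire_monomial (n : nat) : entire (monomial n).
Proof. eapply cderiv_entire. intros z. apply has_cderiv_pow. Qed.

Lemma regular_monomial (n : nat) : regular (monomial n).
Proof.
  split. apply entire_monomial. rewrite derive_monomial.
  eapply cderiv_entire. intros z. apply has_cderiv_scal, has_cderiv_pow.
Qed.

Definition cexp (z : C) : C := (exp (Re z) * cos (Im z), exp (Re z) * sin (Im z)).

Lemma Cmod_cexp (z : C) : Cmod (cexp z) = exp (Re z).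
Proof.
  replace (cexp z) with (RtoC (exp (Re z)) * cis (Im z))%C
    by (unfold cexp, cis, RtoC, Cmult; simpl; f_equal; ring).
  rewrite Cmod_mult, Cmod_cis, Cmod_R, Rabs_pos_eq by (left; apply exp_pos). ring.
Qed.

Lemma differentiable_exp_mult (k dk : R -> R) (x y : R) : (forall t, is_derive k t (dk t)) ->
  (forall t, continuous k t) ->
  differentiable_pt_lim (fun a b => exp a * k b) x y (exp x * k y) (exp x * dk y).
Proof.
  intros Hk Ck. apply filterdiff_differentiable_pt_lim.
  apply is_derive_filterdiff with (f := fun a b => exp a * k b) (dfx := fun a b => exp a * k b).
  - apply filter_forall. intros u. auto_derive; auto. ring.
  - apply is_derive_scal. apply Hk.
  - apply (continuous_mult (K := R_AbsRing)).
    + apply (continuous_comp (fun u : R * R => fst u) exp). apply continuous_fst. apply continuous_exp.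
    + apply (continuous_comp (fun u : R * R => snd u) k). apply continuous_snd. apply Ck.
Qed.

(** Both components are differentiated as real functions of two variables; the partial derivatives
    assemble into multiplication by [cexp z]. *)
Lemma has_cderiv_cexp (z : C) : has_cderiv cexp z (cexp z).
Proof.
  apply has_cderiv_eps. intros eps He. destruct z as [x y].
  assert (He2 : 0 < eps / 2) by lra.
  destruct (differentiable_exp_mult cos (fun t => - sin t) x y is_derive_cos continuous_cos_R
    (mkposreal _ He2)) as [d1 H1].
  destruct (differentiable_exp_mult sin cos x y is_derive_sin continuous_sin_R
    (mkposreal _ He2)) as [d2 H2].
  exists (Rmin d1 d2). split. { apply Rmin_glb_lt; apply cond_pos. }
  intros [a b] Hw.
  pose proof (re_le_Cmod ((a, b) - (x, y))) as Hre. pose proof (im_le_Cmod ((a, b) - (x, y))) as Him.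
  change (Re ((a, b) - (x, y))) with (a - x) in Hre.
  change (Im ((a, b) - (x, y))) with (b - y) in Him.
  set (h := Cmod ((a, b) - (x, y))) in *.
  pose proof (Rmin_l d1 d2). pose proof (Rmin_r d1 d2).
  specialize (H1 a b ltac:(lra) ltac:(lra)). specialize (H2 a b ltac:(lra) ltac:(lra)). simpl in H1, H2.
  assert (Hm : Rmax (Rabs (a - x)) (Rabs (b - y)) <= h) by (apply Rmax_lub; auto).
  assert (Hm2 : eps / 2 * Rmax (Rabs (a - x)) (Rabs (b - y)) <= eps / 2 * h)
    by (apply Rmult_le_compat_l; lra).
  eapply Rle_trans. apply Cmod_le_Rabs.
  apply Rle_trans with (eps / 2 * h + eps / 2 * h); [|right; field].
  apply Rplus_le_compat.
  - eapply Rle_trans; [|exact Hm2]. eapply Rle_trans; [|exact H1]. right. f_equal.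
    unfold cexp, Re, Im. simpl. ring.
  - eapply Rle_trans; [|exact Hm2]. eapply Rle_trans; [|exact H2]. right. f_equal.
    unfold cexp, Re, Im. simpl. ring.
Qed.

Lemma derive_cexp : C_derive cexp = cexp.
Proof. apply cderiv_unique, has_cderiv_cexp. Qed.

Lemma regular_cexp : regular cexp.
Proof.
  assert (H : entire cexp) by (apply cderiv_entire with cexp; apply has_cderiv_cexp).
  split; auto. rewrite derive_cexp. auto.
Qed.

(* The Poisson kernel is a real part of the Cauchy kernel and has mean 1. *)
Lemma poisson_mean (rho : R) : 0 <= rho < 1 ->
  mean (fun t => (1 - rho ^ 2) / (1 - 2 * rho * cos t + rho ^ 2)) = 1.
Proof.
  intros Hrho.
  assert (Hz : Cmod (RtoC rho) < 1) by (rewrite Cmod_R, Rabs_pos_eq; lra).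
  assert (E : forall t, (1 - rho ^ 2) / (1 - 2 * rho * cos t + rho ^ 2) =
    2 * Re (cauchy_kernel 1 (RtoC rho) t) + - 1).
  { intros t. assert (Hp : 0 < 1 - 2 * rho * cos t + rho ^ 2).
    { pose proof (COS_bound t). nra. }
    pose proof (sin2_cos2 t) as Hs. unfold Rsqr in Hs.
    unfold cauchy_kernel. rewrite circle_pair, !Rmult_1_l.
    unfold Re, Cdiv, Cminus, Cplus, Copp, Cinv, Cmult, RtoC. cbn [fst snd].
    assert (Hd : (cos t + - rho) ^ 2 + (sin t + - 0) ^ 2 = 1 - 2 * rho * cos t + rho ^ 2) by nra.
    rewrite Hd. replace (1 - rho ^ 2) with
      (2 * (cos t * (cos t + - rho) + sin t * (sin t + - 0)) - (1 - 2 * rho * cos t + rho ^ 2)) by nra.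
    field. lra. }
  rewrite (mean_ext _ _ E).
  assert (CK : forall t : R, continuous (fun t => Re (cauchy_kernel 1 (RtoC rho) t)) t)
    by (intros t; apply (ccont_K 1 (RtoC rho) Hz t)).
  rewrite mean_add, mean_scal, mean_const; auto.
  - pose proof (cmean_K 1 (RtoC rho) Hz) as H. apply (f_equal Re) in H.
    change (mean (fun t => Re (cauchy_kernel 1 (RtoC rho) t)) = 1) in H. rewrite H. ring.
  - intros; apply continuous_scal_R; auto.
  - intros; apply continuous_const.
Qed.

(** The mean is the modified Bessel value [I_0(b)]. By [exp (- x) <= / (1 + x)] with
    [x = b (1 - cos t)], the integrand is at most [exp b / (1 + x)], which is dominated by a
    multiple of a Poisson kernel, whose mean is known. *)
Lemma mean_exp_cos (b : R) : 2 < b ->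
  mean (fun t => exp (b * cos t)) <= exp b * sqrt (2 / b).
Proof.
  (* With [d ^ 2 * b = 2], the quantity [d ^ 2 * (1 + x) = d ^ 2 + 2 (1 - cos t)] dominates the
     Poisson denominator [d ^ 2 + 2 rho (1 - cos t)]; [2 < b] ensures [d < 1]. *)
  intros Hb. set (d := sqrt (2 / b)). set (rho := 1 - d).
  assert (Hd2 : d ^ 2 * b = 2).
  { unfold d. rewrite pow2_sqrt. field; lra. left; apply Rdiv_lt_0_compat; lra. }
  assert (Hd0 : 0 < d) by (apply sqrt_lt_R0, Rdiv_lt_0_compat; lra).
  assert (Hd1 : d < 1).
  { destruct (Rlt_dec d 1) as [|h]; auto. assert (1 <= d ^ 2) by nra. nra. }
  set (P := fun t => (1 - rho ^ 2) / (1 - 2 * rho * cos t + rho ^ 2)).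
  assert (Hp : forall t, 0 < 1 - 2 * rho * cos t + rho ^ 2).
  { intros t. pose proof (COS_bound t). unfold rho. nra. }
  assert (CP : forall t, continuous P t).
  { intros t. apply (ex_derive_continuous (K := R_AbsRing) (V := R_NormedModule)).
    unfold P. auto_derive. specialize (Hp t). simpl in Hp. lra. }
  apply Rle_trans with (mean (fun t => (exp b * (d / (2 - d))) * P t)).
  - apply mean_le.
    + intros t. apply (ex_derive_continuous (K := R_AbsRing) (V := R_NormedModule)). auto_derive. auto.
    + intros t. apply continuous_scal_R; auto.
    + intros t. pose proof (COS_bound t) as Hc. set (x := b * (1 - cos t)).
      assert (Hx : 0 <= x) by (unfold x; nra).
      replace (b * cos t) with (b + - x) by (unfold x; ring). rewrite exp_plus, Rmult_assoc.
      apply Rmult_le_compat_l. left; apply exp_pos.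
      apply Rle_trans with (/ (1 + x)).
      * rewrite exp_Ropp. apply Rinv_le_contravar. lra. apply exp_ineq1_le.
      * unfold P.
        replace (d / (2 - d) * ((1 - rho ^ 2) / (1 - 2 * rho * cos t + rho ^ 2))) with
          (/ ((1 - 2 * rho * cos t + rho ^ 2) / d ^ 2)).
        2:{ specialize (Hp t). unfold rho in *. field. repeat split; lra. }
        specialize (Hp t). apply Rinv_le_contravar. apply Rdiv_lt_0_compat; auto. nra.
        apply Rle_div_l. nra. unfold x, rho.
        replace ((1 + b * (1 - cos t)) * d ^ 2) with (d ^ 2 + (d ^ 2 * b) * (1 - cos t)) by ring.
        rewrite Hd2. nra.
  - rewrite mean_scal by auto. unfold P. rewrite poisson_mean by (unfold rho; lra).
    rewrite Rmult_1_r. apply Rmult_le_compat_l. left; apply exp_pos.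
    apply Rle_div_l; nra.
Qed.

(** For finite [p = q], [|e^z|^q = exp (q r cos t)] on the circle, and the preceding bound with
    [b = q r] gives [e^r (2 / q)^(1 / (2 q)) r^(- 1 / (2 q))]; the middle constant is at most 2. *)
Lemma Mp_cexp (p : Rbar) (r : R) : Rbar_le (Finite 1) p -> 2 < r ->
  Mp p cexp r <= 2 * (exp r / Rpower r (inv_2p p)).
Proof.
  intros hp Hr. pose proof (exp_pos r).
  destruct p as [q| |]; [| |contradiction].
  - simpl in hp. rewrite Mp_lp. unfold lp_mean.
    assert (Hqr : 2 < q * r) by nra.
    rewrite (mean_ext _ (fun t => exp (q * r * cos t))).
    2:{ intros t. rewrite Cmod_cexp, rpow_pos by apply exp_pos. unfold Rpower. rewrite ln_exp.
        rewrite circle_pair. f_equal. unfold Re; simpl. ring. }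
    assert (Hm : 0 <= mean (fun t => exp (q * r * cos t))).
    { apply mean_ge_0. intros t. apply (ex_derive_continuous (K := R_AbsRing) (V := R_NormedModule)).
      auto_derive. auto. intros; left; apply exp_pos. }
    assert (Hs : 0 < 2 / (q * r)) by (apply Rdiv_lt_0_compat; lra).
    eapply Rle_trans. apply rpow_le_compat. apply Rinv_0_lt_compat; lra.
    split; [exact Hm|apply mean_exp_cos; auto].
    rewrite rpow_pos by (apply Rmult_lt_0_compat; [apply exp_pos|apply sqrt_lt_R0; auto]).
    simpl inv_2p. unfold Rpower at 1.
    rewrite ln_mult, ln_exp by (try apply exp_pos; apply sqrt_lt_R0; auto).
    rewrite <- Rpower_sqrt by auto. unfold Rpower at 1. rewrite ln_exp.
    rewrite ln_div, ln_mult by lra.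
    replace (/ q * (q * r + / 2 * (ln 2 - (ln q + ln r)))) with
      (r + (/ (2 * q) * (ln 2 - ln q) + - (/ (2 * q) * ln r))) by (field; lra).
    rewrite !exp_plus, exp_Ropp. unfold Rpower, Rdiv.
    replace (2 * (exp r * / exp (/ (2 * q) * ln r))) with (exp r * (2 * / exp (/ (2 * q) * ln r))) by ring.
    apply Rmult_le_compat_l; [lra|]. apply Rmult_le_compat_r.
    left; apply Rinv_0_lt_compat, exp_pos.
    apply Rle_trans with (exp (ln 2)); [|rewrite exp_ln; lra].
    assert (L2 : 0 < ln 2) by (rewrite <- ln_1; apply ln_increasing; lra).
    assert (Lq : 0 <= ln q).
    { destruct hp as [hq|<-]. left; rewrite <- ln_1; apply ln_increasing; lra. rewrite ln_1; lra. }
    assert (0 < / (2 * q) <= 1).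
    { split. apply Rinv_0_lt_compat; lra. rewrite <- Rinv_1. apply Rinv_le_contravar; lra. }
    assert (Hle : / (2 * q) * (ln 2 - ln q) <= ln 2) by nra.
    destruct Hle as [Hle|Heq]. left; apply exp_increasing; auto. rewrite Heq; lra.
  - simpl inv_2p. rewrite Rpower_O by lra.
    apply Mp_bound; auto; try lra. apply regular_tame, regular_cexp.
    intros z Hz. rewrite Cmod_cexp.
    assert (Re z <= r). { rewrite <- Hz. eapply Rle_trans; [apply Rle_abs|apply re_le_Cmod]. }
    assert (exp (Re z) <= exp r); [|lra].
    destruct H0 as [H0| ->]; [left; apply exp_increasing; auto|lra].
Qed.

Section Density.
Variables (p : Rbar) (v : C -> R).
Hypothesis hp : Rbar_le (Finite 1) p.
Hypothesis hv : weight v.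
Hypothesis hlim : is_lim (fun r => v (RtoC r) * (exp r / Rpower r (inv_2p p))) p_infty 0.

Lemma Bp0_cexp : Bp0 p v cexp.
Proof.
  apply vanishing_Bp0; auto. apply regular_cexp. apply regular_tame, regular_cexp.
  intros eps He. apply is_lim_spec in hlim.
  assert (He2 : 0 < eps / 2) by lra.
  destruct (hlim (mkposreal _ He2)) as [M HM].
  exists (Rmax M 2 + 1). pose proof (Rmax_l M 2). pose proof (Rmax_r M 2). split; [lra|].
  intros r Hr. assert (Hr' : M < r) by lra. specialize (HM r Hr'). simpl in HM.
  rewrite Rminus_0_r in HM. apply Rabs_def2 in HM.
  apply Rle_trans with (v (RtoC r) * (2 * (exp r / Rpower r (inv_2p p)))); [|lra].
  apply Rmult_le_compat_l. left; apply (weight_pos v hv). apply Mp_cexp; auto. lra.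
Qed.

Lemma Bp0_monomial (n : nat) : Bp0 p v (monomial n).
Proof.
  apply vanishing_Bp0; auto. apply entire_monomial. apply regular_tame, regular_monomial.
  (* The decay is stated for positive exponents, so [S n] is used, with [r ^ n <= r ^ S n] for
     [r >= 1]. *)
  intros eps He. pose proof (weight_decay v hv (S n) ltac:(lia)) as H.
  apply is_lim_spec in H. destruct (H (mkposreal _ He)) as [M HM].
  exists (Rmax M 1 + 1). pose proof (Rmax_l M 1). pose proof (Rmax_r M 1). split; [lra|].
  intros r Hr. assert (Hr' : M < r) by lra. specialize (HM r Hr').
  rewrite Rminus_0_r in HM. apply Rabs_def2 in HM. simpl pos in HM.
  apply Rle_trans with (v (RtoC r) * r ^ S n); [|lra].
  apply Rmult_le_compat_l. left; apply (weight_pos v hv).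
  apply Mp_bound; auto; try lra. apply regular_tame, regular_monomial. apply pow_le; lra.
  intros z Hz. unfold monomial. rewrite Cmod_pow, Hz. simpl.
  assert (0 < r ^ n) by (apply pow_lt; lra). nra.
Qed.

Hypothesis hD : well_defined (Bp0 p v) C_derive.

Lemma iter_derive_monomial (n j : nat) : (n < j)%nat -> Nat.iter j C_derive (monomial n) = fzero.
Proof.
  pose proof (Bp0_normed_space p v hp hv hD) as HB.
  assert (L : forall j, linear_on (Bp0 p v) (Nat.iter j C_derive))
    by (intros i; apply iter_linear; apply derive_linear; auto).
  revert j. induction n; intros j Hj; (destruct j; [lia|]); rewrite Nat.iter_succ_r, derive_monomial,
    (lin_scal _ _ (L j)) by apply Bp0_monomial.
  - change (INR 0) with 0. fun_ring.
  - simpl pred. rewrite IHn by lia. fun_ring.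
Qed.

(** The comparison of the dilation with its Taylor polynomial is uniform in the radius: for
    [|z| = r] the remainder of [f] at [rho z] is taken from Cauchy's formula on the circle of radius
    [r] itself, where the geometric ratio is [rho] whatever [r] is. *)
Lemma polynomials_dense (f : C -> C) (eps : R) : Bp0 p v f -> 0 < eps ->
  exists a N, norm_pv p v (fsub f (fsum (fun n => fscal (a n) (monomial n)) N)) < eps.
Proof.
  intros Bf He. pose proof (Bp0_regular p v hD f Bf) as Rf.
  pose proof (regular_tame f Rf) as Tf.
  pose proof (weight_pos v hv (RtoC 0)) as Hv0.
  destruct (Bp0_vanishing p v f Bf (eps / 8)) as [R0 [HR0 HR]]; [lra|].
  (* As [rho >= 1 / 2], both [r] and [rho * r] are at least [R0] when [r >= s]. *)
  set (s := 2 * R0).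
  assert (Hs : 0 < s) by (unfold s; lra).
  assert (HLip : exists K, 0 < K /\ forall z w, Cmod z <= s -> Cmod w <= s ->
    Cmod (f w - f z) <= K * Cmod (w - z)).
  { set (m := M1 f (s + 1)). assert (Hm : 0 <= m) by (apply M1_ge_0, regular_ccont, Rf).
    (* Bound of the derivative plus the quadratic error with one factor [|w - z|] replaced by [2 s];
       the final 1 makes the constant positive. *)
    exists ((s + 1) * m + (s + 1) * (2 * s) * m + 1). split.
    { assert (0 <= (s + 1) * m) by (apply Rmult_le_pos; lra).
      assert (0 <= (s + 1) * (2 * s) * m) by (apply Rmult_le_pos; [apply Rmult_le_pos|]; lra). lra. }
    intros z w Hz Hw.
    destruct (cauchy_first_order f (s + 1) s z Rf Hz ltac:(lra)) as [d [Hd1 Hd2]].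
    specialize (Hd2 w Hw). replace (s + 1 - s) with 1 in * by ring.
    rewrite pow1, Rdiv_1_r in Hd1, Hd2.
    change (M1 f (s + 1)) with m in Hd1, Hd2. clearbody m.
    replace (f w - f z)%C with ((f w - f z - d * (w - z)) + d * (w - z))%C by ring.
    eapply Rle_trans. apply Cmod_triangle. rewrite Cmod_mult.
    assert (Hwz : Cmod (w - z) <= 2 * s).
    { eapply Rle_trans. apply Cmod_triangle. rewrite Cmod_opp. lra. }
    pose proof (Cmod_ge_0 (w - z)). set (h := Cmod (w - z)) in *.
    assert (I1 : (s + 1) * h ^ 2 * m <= (s + 1) * (2 * s) * m * h).
    { replace ((s + 1) * h ^ 2 * m) with ((s + 1) * m * h * h) by ring.
      replace ((s + 1) * (2 * s) * m * h) with ((s + 1) * m * h * (2 * s)) by ring.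
      apply Rmult_le_compat_l; auto. repeat apply Rmult_le_pos; lra. }
    assert (I2 : Cmod d * h <= (s + 1) * m * h) by (apply Rmult_le_compat_r; auto).
    lra. }
  destruct HLip as [K [HK HLip]].
  (* Inside the disc [|z - rho z| <= del * s], so this [del] brings the weighted Lipschitz bound
     down to [eps / 4]. *)
  set (del := Rmin (1 / 2) (eps / (4 * (v (RtoC 0) * (K * s))))).
  assert (HKs : 0 < K * s) by (apply Rmult_lt_0_compat; auto).
  assert (HvKs : 0 < v (RtoC 0) * (K * s)) by (apply Rmult_lt_0_compat; auto).
  assert (Hdel : 0 < del) by (apply Rmin_glb_lt; [lra|apply Rdiv_lt_0_compat; lra]).
  assert (Hdel1 : del <= 1 / 2) by apply Rmin_l.
  assert (Hdel2 : del <= eps / (4 * (v (RtoC 0) * (K * s)))) by apply Rmin_r.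
  set (rho := 1 - del).
  assert (Hrho : 1 / 2 <= rho < 1) by (unfold rho; lra).
  assert (Td : tame (dilate rho f)) by (apply tame_dilate; auto; lra).
  assert (H1 : forall r, 0 < r -> v (RtoC r) * Mp p (fsub f (dilate rho f)) r <= eps / 4).
  { intros r Hr. destruct (Rle_dec s r) as [h|h].
    - rewrite fsub_eq. eapply Rle_trans. apply wM_add; auto. apply tame_scal; auto.
      assert (A1 : v (RtoC r) * Mp p f r <= eps / 8) by (apply HR; unfold s in h; lra).
      assert (A2 : v (RtoC r) * Mp p (fscal (RtoC (-1)) (dilate rho f)) r <= eps / 8); [|lra].
      eapply Rle_trans. apply wM_scal; auto. rewrite Cmod_R, Rabs_left by lra.
      replace (- -1 * (v (RtoC r) * Mp p (dilate rho f) r)) with (v (RtoC r) * Mp p (dilate rho f) r) by ring.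
      apply Rle_trans with (v (RtoC (rho * r)) * Mp p f (rho * r)).
      + apply Rmult_le_compat. left; apply (weight_pos v hv). apply Mp_ge_0; auto.
        apply (weight_nonincreasing v hv); nra. apply Mp_dilate; auto; lra.
      + apply HR. unfold s in h. nra.
    - eapply Rle_trans. apply wM_bound with (M := K * (del * s)); auto.
      + apply tame_sub; auto.
      + apply Rmult_le_pos; nra.
      + intros z Hz. unfold fsub, dilate. eapply Rle_trans. apply HLip.
        * rewrite Cmod_mult, Cmod_R, Rabs_pos_eq, Hz by lra. nra.
        * lra.
        * replace (z - rho * z)%C with (RtoC del * z)%C
            by (unfold rho; rewrite RtoC_minus; ring).
          rewrite Cmod_mult, Cmod_R, Rabs_pos_eq, Hz by lra.
          apply Rmult_le_compat_l; [lra|]. apply Rmult_le_compat_l; lra.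
      + apply Rle_trans with (v (RtoC 0) * (K * s) * (eps / (4 * (v (RtoC 0) * (K * s))))).
        * replace (v (RtoC 0) * (K * (del * s))) with (v (RtoC 0) * (K * s) * del) by ring.
          apply Rmult_le_compat_l; lra.
        * right. field. split; lra. }
  set (B := norm_pv p v f).
  assert (HB : 0 <= B) by (apply (ns_norm_ge_0 _ _ (Bp0_normed_space p v hp hv hD)), Bf).
  (* On the circle of radius [r] the remainder is at most [rho ^ N / (1 - rho)] times
     [B / v (RtoC r)], so the weight cancels; [B + 1] keeps the divisor positive. *)
  destruct (pow_lt_1_zero rho) with (y := eps / (4 * (/ (1 - rho) * (B + 1)))) as [N HN].
  { rewrite Rabs_pos_eq; lra. }
  { apply Rdiv_lt_0_compat; auto. apply Rmult_lt_0_compat; [lra|].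
    apply Rmult_lt_0_compat; [|lra]. apply Rinv_0_lt_compat; lra. }
  specialize (HN N (le_n _)). rewrite Rabs_pos_eq in HN by (apply pow_le; lra).
  set (a := fun n => (tcoef f 1 n * RtoC rho ^ n)%C).
  set (P := fsum (fun n => fscal (a n) (monomial n)) N).
  assert (BP : Bp0 p v P).
  { apply (ns_fsum _ _ (Bp0_normed_space p v hp hv hD)). intros.
    apply (Bp0_scal p v hp hv hD), Bp0_monomial. }
  assert (TP : tame P) by (apply (Bp0_tame p v hD); auto).
  assert (HP : forall r z, 0 < r -> P z = tpoly (tcoef f r) N (RtoC rho * z)%C).
  { intros r z Hr. unfold P, tpoly. rewrite !fsum_csum. f_equal. apply functional_extensionality.
    intros n. unfold fscal, monomial, a. rewrite (tcoef_radius f 1 r n Rf) by lra.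
    rewrite Cpow_mult_l. ring. }
  assert (H2 : forall r, 0 < r -> v (RtoC r) * Mp p (fsub (dilate rho f) P) r <= eps / 4).
  { intros r Hr.
    pose proof (M1_ge_0 f r (regular_ccont f Rf)) as HM1.
    pose proof (M1_le_norm p v hp hv hD f r Bf Hr) as HM1'. fold B in HM1'.
    pose proof (weight_pos v hv (RtoC r)) as Hvr.
    assert (Hi : 0 < / (1 - rho)) by (apply Rinv_0_lt_compat; lra).
    assert (Hpw : 0 <= rho ^ N) by (apply pow_le; lra).
    apply Rle_trans with (v (RtoC r) * (rho ^ N * / (1 - rho) * M1 f r)).
    - apply Rmult_le_compat_l; [lra|]. apply Mp_bound; auto. apply tame_sub; auto.
      apply Rmult_le_pos; auto. apply Rmult_le_pos; lra.
      intros z Hz. unfold fsub, dilate. rewrite (HP r z Hr).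
      assert (Hrz : Cmod (rho * z)%C = rho * r) by (rewrite Cmod_mult, Cmod_R, Rabs_pos_eq, Hz; lra).
      eapply Rle_trans. apply taylor_remainder; auto. rewrite Hrz. nra.
      rewrite Hrz. replace (rho * r / r) with rho by (field; lra).
      replace (r / (r - rho * r)) with (/ (1 - rho)) by (field; split; nra). lra.
    - assert (HM2 : M1 f r * v (RtoC r) <= B) by (apply Rle_div_r in HM1'; auto).
      replace (v (RtoC r) * (rho ^ N * / (1 - rho) * M1 f r)) with
        (rho ^ N * (/ (1 - rho) * (M1 f r * v (RtoC r)))) by ring.
      apply Rle_trans with (eps / (4 * (/ (1 - rho) * (B + 1))) * (/ (1 - rho) * (B + 1))).
      + apply Rmult_le_compat; auto; try lra.
        * apply Rmult_le_pos; [lra|]. apply Rmult_le_pos; lra.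
        * apply Rmult_le_compat_l; lra.
      + right. field. split; lra. }
  exists a, N. fold P. apply Rle_lt_trans with (eps / 2); [|lra].
  apply norm_le. intros r Hr.
  replace (fsub f P) with (fadd (fsub f (dilate rho f)) (fsub (dilate rho f) P)) by fun_ring.
  eapply Rle_trans. apply wM_add; auto; apply tame_sub; auto.
  specialize (H1 r Hr). specialize (H2 r Hr). lra.
Qed.

End Density.

Theorem theorem15 (p : Rbar) (v : C -> R)
  (hp : Rbar_le (Finite 1) p)
  (hv : weight v)
  (hlim : is_lim (fun r => v (RtoC r) * (exp r / Rpower r (inv_2p p))) p_infty 0)
  (hD : well_defined (Bp0 p v) C_derive)
  (hDc : continuous_operator (Bp0 p v) (norm_pv p v) C_derive) :
  exists V : (C -> C) -> Prop,
    vector_subspace (Bp0 p v) V /\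
    dense_in (Bp0 p v) (norm_pv p v) V /\
    forall f, V f -> f <> (fun _ => RtoC 0) ->
      distributionally_irregular (norm_pv p v) C_derive f.
Proof.
  pose proof (Bp0_cexp p v hp hv hlim) as Bexp.
  (* [cexp] has modulus 1 at 0, so the Cauchy bound on the unit circle gives [1 <= M1 cexp 1]. *)
  assert (Hnorm : 0 < norm_pv p v cexp).
  { pose proof (le_norm p v hp hv hD cexp 1 Bexp Rlt_0_1) as Hle.
    pose proof (regular_tame _ regular_cexp) as Texp.
    pose proof (M1_le_Mp p hp cexp 1 Texp Rlt_0_1) as H1.
    pose proof (regular_bound cexp 1 0 (RtoC 0) regular_cexp) as H0.
    rewrite Cmod_0, Cmod_cexp in H0. unfold Re in H0. simpl in H0. rewrite exp_0 in H0.
    specialize (H0 (Rle_refl 0) Rlt_0_1).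
    eapply Rlt_le_trans; [|exact Hle]. apply Rmult_lt_0_compat. apply (weight_pos v hv). lra. }
  apply (dense_irregular_manifold (Bp0 p v) (norm_pv p v)) with
    (e := monomial) (u := cexp) (eta := norm_pv p v cexp / 2).
  - apply Bp0_normed_space; auto.
  - apply derive_linear; auto.
  - exact hDc.
  - apply Bp0_monomial; auto.
  - apply (iter_derive_monomial p v); auto.
  - intros f eps. apply polynomials_dense; auto.
  - apply Bp0_complete; auto.
  - exact Bexp.
  - apply derive_cexp.
  - lra.
  - lra.
Qed.
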